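(* Let $\ell\in\mathbb{Z}_{\ge 0}$, $b\in\mathbb{C}\setminus\{0\}$ and $c\in\mathbb{R}$, let $f:\mathbb{C}_+\to\mathbb{C}$ and $g:\mathbb{C}_+\to\mathbb{C}_+$ be analytic functions, and let $W_{f,g}$ be a (not necessarily maximal) weighted composition operator, i.e. $W_{f,g}\preceq W_{f,g,\max}$. Then $W_{f,g}$ is $U_{b,c}\mathcal{C}_\star U_{b,c}^*$-selfadjoint on $\mathbb{B}_\ell(\mathbb{C}_+)$ if and only if both of the following conditions hold. (1) The operator $W_{f,g}$ is maximal, that is, $W_{f,g}=W_{f,g,\max}$. (2) One of the following three cases holds (for all $w\in\mathbb{C}_+$): (a) $g(w)=|b|^{-\frac{2}{\ell+2}}(\alpha-ic)$ and $f(w)=\dfrac{\beta}{\left(1+\alpha(|b|^{\frac{2}{\ell+2}}w+ic)\right)^{\ell+2}}$, where $\alpha\in\mathbb{C}_+$ and $\beta\in\mathbb{C}$; (b) $g(w)=\lambda\left(w+ic|b|^{-\frac{2}{\ell+2}}\right)-ic$ and $f(w)=\theta$, where $\lambda\in\mathbb{R}_{>0}$ and $\theta\in\mathbb{C}$; (c) $g(w)=|b|^{-\frac{2}{\ell+2}}\left(\dfrac{1-\delta\kappa}{|b|^{\frac{2}{\ell+2}}w+ic+\kappa}+\delta-ic\right)$ and $f(w)=\dfrac{r}{\left(|b|^{\frac{2}{\ell+2}}w+ic+\kappa\right)^{\ell+2}}$, where $\delta,\kappa,r\in\mathbb{C}$ and either $\delta\in i\mathbb{R}$, $\delta\kappa\in\mathbb{R}$,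 $\delta\kappa<1$ and $\operatorname{Re}\kappa\ge 0$, or $-\operatorname{Re}\delta<0\le\operatorname{Re}\kappa-\dfrac{\operatorname{Re}(\delta\kappa-1)+|\delta\kappa-1|}{2\operatorname{Re}\delta}$. In this case, the operator $W_{f,g}$ is bounded.
   Context: $\mathbb{C}_+=\{z\in\mathbb{C}:\operatorname{Re}z>0\}$. For $\ell\in\mathbb{Z}_{\ge0}$, the weighted Bergman space $\mathbb{B}_\ell(\mathbb{C}_+)$ is the Hilbert space of analytic functions $h:\mathbb{C}_+\to\mathbb{C}$ with $\|h\|^2=\frac1\pi\int_{-\infty}^{\infty}\int_0^\infty x^\ell|h(x+iy)|^2\,dx\,dy<\infty$. For analytic $f:\mathbb{C}_+\to\mathbb{C}$ and $g:\mathbb{C}_+\to\mathbb{C}_+$, the maximal weighted composition operator $W_{f,g,\max}$ has domain $\{h\in\mathbb{B}_\ell(\mathbb{C}_+): f\cdot(h\circ g)\in\mathbb{B}_\ell(\mathbb{C}_+)\}$ and acts by $W_{f,g,\max}h=f\cdot(h\circ g)$. For linear operators, $A\preceq B$ means $\operatorname{dom}(A)\subseteq\operatorname{dom}(B)$ and $Ax=Bx$ for $x\in\operatorname{dom}(A)$; $W_{f,g}$ denotes an operator with $W_{f,g}\preceq W_{f,g,\max}$. It is called bounded if its domain is all of $\mathbb{B}_\ell(\mathbb{C}_+)$ and there is $L>0$ with $\|W_{f,g}h\|\le L\|h\|$ for every $h$. A conjugation is an anti-linear isometric involution. For a conjugation $\mathcal{C}$, a (not necessarily bounded) linear operator $B$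 is called $\mathcal{C}$-selfadjoint if $B=\mathcal{C}B^*\mathcal{C}$ (equality including domains). $\mathcal{C}_\star$ is the conjugation on $\mathbb{B}_\ell(\mathbb{C}_+)$ given by $\mathcal{C}_\star h(z)=\dfrac{1}{z^{\ell+2}}\overline{h\left(\dfrac{1}{\overline z}\right)}$. For $b\in\mathbb{C}\setminus\{0\}$ and $c\in\mathbb{R}$, $U_{b,c}$ is the unitary operator on $\mathbb{B}_\ell(\mathbb{C}_+)$ given by $U_{b,c}\xi(z)=b\,\xi\left(|b|^{\frac{2}{\ell+2}}z+ic\right)$; $U_{b,c}\mathcal{C}_\star U_{b,c}^*$ is a conjugation.
   Formalization: In case (b) the final term −ic is corrected to −ic|b|^{−2/(ℓ+2)}, and condition (2) is required only when f is not identically zero; as printed, the identity operator (c≠0, |b|≠1) and f≡0 with g(w)=w+1 are counterexamples. *)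

(* Defs.v *)
From HB Require Import structures.
From mathcomp Require Import all_boot all_order all_algebra.
From mathcomp Require Import all_classical all_reals all_analysis.
From mathcomp Require Export complex.

Set Implicit Arguments.
Unset Strict Implicit.
Unset Printing Implicit Defensive.

Import Order.TTheory GRing.Theory Num.Theory.
Import numFieldNormedType.Exports.

Local Open Scope classical_set_scope.
Local Open Scope ring_scope.
Local Open Scope complex_scope.

Definition Cplus (R : realType) : Type := {z : R[i] | 0 < complex.Re z}.

(* The modulus as an element of R; the norm `|z| of R[i] has values in R[i]. *)
Definition modulus (R : realType) (z : R[i]) : R := ComplexField.Normc.normc z.

(* Extension by 0 to R[i], used only through its values on C_+. *)
Definition ext (R : realType) (h : Cplus R -> R[i]) (z : R[i]) : R[i] :=
  oapp h 0 (insub z).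

(* R[i]^o is R[i] seen as a normed module over itself, so that the limit of
   the difference quotient is taken over complex increments. *)
Definition analytic (R : realType) (h : Cplus R -> R[i]) : Prop :=
  forall z : Cplus R, derivable (ext h : R[i]^o -> R[i]^o) (val z) 1.

Definition analytic_self (R : realType) (g : Cplus R -> Cplus R) : Prop :=
  analytic (fun z => val (g z)).

Section Bergman.
Context {R : realType} (l : nat).
Implicit Types (h k : Cplus R -> R[i]) (p : R * R).

Definition area :
    {measure set (measurableTypeR R * measurableTypeR R) -> \bar R} :=
  [the measure _ R of (@lebesgue_measure R \x @lebesgue_measure R)%E].

Definition half_plane : set (R * R) := [set p | 0 < p.1].

Definition sqnorm h : \bar R :=
  ((pi^-1)%:E *
   \int[area]_(p in half_plane)
      (p.1 ^+ l * modulus (ext h (p.1 +i* p.2)) ^+ 2)%:E)%E.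

Definition bergman : set (Cplus R -> R[i]) :=
  [set h | analytic h /\ (sqnorm h < +oo)%E].

Definition bnorm h : R := Num.sqrt (fine (sqnorm h)).

Definition inner h k : R[i] :=
  let F p := (p.1 ^+ l)%:C * (ext h (p.1 +i* p.2) * (ext k (p.1 +i* p.2))^*) in
  (pi^-1 * Rintegral area half_plane (fun p => complex.Re (F p))) +i*
  (pi^-1 * Rintegral area half_plane (fun p => complex.Im (F p))).

End Bergman.

(* A partially defined map on functions; the values outside of [dom] are
   irrelevant, hence the equality [op_eq] below instead of [=]. *)
Record operator (R : realType) := Operator {
  dom : set (Cplus R -> R[i]);
  app :> (Cplus R -> R[i]) -> (Cplus R -> R[i]) }.

Section Operators.
Context {R : realType}.
Implicit Types (A B : operator R).

Definition op_le A B : Prop :=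
  dom A `<=` dom B /\ (forall h, dom A h -> A h = B h).

Definition op_eq A B : Prop := op_le A B /\ op_le B A.

Definition op_comp A B : operator R :=
  Operator [set h | dom B h /\ dom A (B h)] (A \o B).

Definition linear_operator (l : nat) A : Prop :=
  [/\ dom A `<=` bergman l,
      (forall h, dom A h -> bergman l (A h)),
      dom A (fun=> 0) &
      (forall (a : R[i]) h k, dom A h -> dom A k ->
         dom A (fun z => a * h z + k z) /\
         A (fun z => a * h z + k z) = (fun z => a * A h z + A k z))].

Definition densely_defined (l : nat) A : Prop :=
  forall h, bergman l h -> forall e : R, 0 < e ->
  exists2 k, dom A k & bnorm l (fun z => h z - k z) < e.

Definition adjoint_value (l : nat) A k : set (Cplus R -> R[i]) :=
  [set k' | bergman l k' /\
            (forall h, dom A h -> inner l (A h) k = inner l h k')].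

(* [adjoint_value] has at most one element when A is densely defined. *)
Definition adjoint (l : nat) A : operator R :=
  Operator [set k | bergman l k /\ (exists k', adjoint_value l A k k')]
           (fun k => xget (fun=> 0) (adjoint_value l A k)).

Definition bounded_operator (l : nat) A : Prop :=
  dom A = bergman l /\
  (exists2 L : R, 0 < L & forall h, bergman l h -> bnorm l (A h) <= L * bnorm l h).

(* Density of the domain is what makes the adjoint an operator. *)
Definition selfadjoint_wrt (l : nat) (C B : operator R) : Prop :=
  densely_defined l B /\ op_eq B (op_comp C (op_comp (adjoint l B) C)).

Definition Wmax (l : nat) (f : Cplus R -> R[i]) (g : Cplus R -> Cplus R) :
    operator R :=
  let W h := fun z => f z * h (g z) in
  Operator [set h | bergman l h /\ bergman l (W h)] W.

Definition Cstar (l : nat) : operator R :=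
  Operator (bergman l)
    (fun h z => (val z ^+ (l + 2))^-1 * (ext h ((val z)^*)^-1)^*).

(* |b| ^ (2 / (l + 2)) *)
Definition scale (l : nat) (b : R[i]) : R := modulus b `^ (2 / (l + 2)%:R).

Definition Ubc (l : nat) (b : R[i]) (c : R) : operator R :=
  Operator (bergman l)
    (fun xi z => b * ext xi ((scale l b)%:C * val z + 'i * c%:C)).

Definition conj_bc (l : nat) (b : R[i]) (c : R) : operator R :=
  op_comp (Ubc l b c) (op_comp (Cstar l) (adjoint l (Ubc l b c))).

End Operators.

(* The arguments of [ext] in [Cstar] and [Ubc] do lie in C_+. *)
Lemma Cstar_arg (R : realType) (z : Cplus R) :
  0 < complex.Re ((val z)^*)^-1.
Proof.
case: z => -[x y] /= x0; rewrite divr_gt0// ltr_wpDr ?exprn_gt0//.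
by rewrite sqr_ge0.
Qed.

Lemma Ubc_arg (R : realType) (l : nat) (b : R[i]) (c : R) (z : Cplus R) :
  b != 0 -> 0 < complex.Re ((scale l b)%:C * val z + 'i * c%:C).
Proof.
case: z => -[x y] /= x0 b0; rewrite !mul0r mulr0 subrr subr0 addr0 mulr_gt0//.
rewrite powR_gt0// lt_neqAle; apply/andP; split; last first.
  by case: b b0 => u v _; apply: sqrtr_ge0.
by rewrite eq_sym; apply: contra b0 => /eqP /ComplexField.Normc.eq0_normc ->.
Qed.

Section Cases.
Context {R : realType} (l : nat) (b : R[i]) (c : R).
Variables (f : Cplus R -> R[i]) (g : Cplus R -> Cplus R).

Let s : R[i] := (scale l b)%:C.
Let ic : R[i] := 'i * c%:C.

Definition case_a : Prop :=
  exists alpha beta : R[i],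
  0 < complex.Re alpha /\
  (forall w : Cplus R,
     val (g w) = s^-1 * (alpha - ic) /\
     f w = beta / (1 + alpha * (s * val w + ic)) ^+ (l + 2)).

(* g is z |-> lambda z conjugated by z |-> s z + ic, hence the last term is
   - ic / s. With - ic instead, g = id (lambda = 1) would be excluded, although
   the identity operator is selfadjoint for every conjugation. *)
Definition case_b : Prop :=
  exists (lambda : R) (theta : R[i]),
  0 < lambda /\
  (forall w : Cplus R,
     val (g w) = lambda%:C * (val w + ic * s^-1) - ic * s^-1 /\
     f w = theta).

Definition case_c_coeffs (delta kappa : R[i]) : Prop :=
  [/\ complex.Re delta = 0,
      complex.Im (delta * kappa) = 0,
      complex.Re (delta * kappa) < 1 &
      0 <= complex.Re kappa]
  \/
  (- complex.Re delta < 0 /\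
   0 <= complex.Re kappa -
        (complex.Re (delta * kappa - 1) + modulus (delta * kappa - 1)) /
        (2 * complex.Re delta)).

Definition case_c : Prop :=
  exists delta kappa r : R[i],
  case_c_coeffs delta kappa /\
  (forall w : Cplus R,
     val (g w) =
       s^-1 * ((1 - delta * kappa) / (s * val w + ic + kappa) + delta - ic) /\
     f w = r / (s * val w + ic + kappa) ^+ (l + 2)).

End Cases.

(* Main.v *)
(* Put m = l + 2, s = |b|^(2/m) and sigma(w) = s w + ic.  If W is C-selfadjoint,
   evaluating W = C W^* C on the reproducing kernels k_z, where
   W^* k_z = conj(f(z)) k_{g(z)}, gives the functional equation
     f(u) (1 + sigma(u) sigma(g(z)))^m = f(z) (1 + sigma(z) sigma(g(u)))^m.
   With G = sigma g sigma^-1, the product of the quotients (1 + u G(z)) / (1 + z G(u))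
   over the three pairs of a triple of points is an m-th root of unity; it is
   continuous in the points and is 1 on the diagonal, hence is always 1.  This forces
   G to be linear fractional, and Re G > 0 gives the conditions on its coefficients.

   Conversely, for f and g as in (a), (b) or (c), the Schwarz-Pick inequality and the
   change of variables g bound W_max on the whole space.  The functional equation
   says that W_max agrees with C W_max^* C on kernels; expanding both sides of
   <W h, k> = <h, C W C k> by the reproducing property leaves one exchange of
   integrals, which Schur's test justifies.

   The reproducing property is Cauchy's mean value property transported by the Cayley
   transform and averaged over rotations. *)

(* Two obstacles shape the proof. First, [W] is only known to be some restriction of the maximal
   operator, so its domain is as unknown as its coefficients. It suffices, however, that [wcomp f g]
   is bounded and symmetric under the conjugation on the whole space ([conj_symmetric]): shrinking a
   domain enlarges the adjoint, so a selfadjoint restriction is then everywhere defined, and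
   maximality and boundedness follow together. Second, symmetry is easy on kernels but has to reach
   the whole space. The density of their span is never established; each function is instead written
   as an integral of kernels, which leaves a question of absolute convergence. Schur's test answers
   it with the test function x^(-1/2), whose exponent suits every l >= 0 at once. No normalising
   integral is computed: the mass of the disc enters only through its positivity and finiteness. If
   f = 0, the functional equation leaves g free and the maximal operator is 0, selfadjoint whatever
   g is; hence the cases are asked only of a nonzero f. *)
From HB Require Import structures.
Require Import Defs.
From mathcomp Require Import all_boot all_order all_algebra.
From mathcomp Require Import all_classical all_reals all_analysis.
From mathcomp Require Import measurable_realfun ring lra.

Set Implicit Arguments.
Unset Strict Implicit.
Unset Printing Implicit Defensive.

Import Order.TTheory GRing.Theory Num.Theory.
Import numFieldNormedType.Exports.

Local Open Scope classical_set_scope.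
Local Open Scope ring_scope.
Local Open Scope complex_scope.

(** * Mean value property *)

Section Goursat.
Context {R : realType}.
Local Notation mu := (@lebesgue_measure R).
Local Notation I a b f := (\int[mu]_(x in `[a, b]) f x).

Definition cont_on (a b : R) (f : R -> R) :=
  forall x, a <= x <= b -> {for x, continuous f}.

Lemma cont_on_sub a b a' b' f : a <= a' -> b' <= b ->
  cont_on a b f -> cont_on a' b' f.
Proof. by move=> aa bb cf x /andP[x1 x2]; apply: cf; lra. Qed.

Lemma cont_on_integrable a b f : cont_on a b f ->
  mu.-integrable `[a, b] (EFin \o f).
Proof.
move=> cf; apply: continuous_compact_integrable; first exact: segment_compact.
by apply: continuous_in_subspaceT => x /[!inE]/= /itvP xab; apply: cf; rewrite !xab.
Qed.

Lemma Rintegral_split a m b f : a <= m -> m <= b -> cont_on a b f ->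
  I a b f = I a m f + I m b f.
Proof.
move=> am mb cf; apply/eqP; rewrite addrC -subr_eq; apply/eqP.
rewrite Rintegral_itvB ?bnd_simp//; last exact: cont_on_integrable.
rewrite Rintegral_itv_obnd_cbnd//.
by apply: integrableS (cont_on_integrable cf) => //; apply: subset_itvr; rewrite bnd_simp.
Qed.

(** Used twice: for the sides of a small rectangle, and for the mean over a small circle. *)
Lemma Rintegral_near_cst a b f (C M : R) : a <= b -> cont_on a b f ->
  (forall x, a <= x <= b -> `|f x - C| <= M) ->
  `|I a b f - C * (b - a)| <= M * (b - a).
Proof.
move=> ab cf fM.
have mab : mu `[a, b] = (b - a)%:E.
  rewrite lebesgue_measure_itv/= lte_fin; case: ltP => // ba.
  by have -> : a = b; [lra|rewrite subrr].
have ic (c : R) : mu.-integrable `[a, b] (EFin \o cst c).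
  by apply: cont_on_integrable => x _; exact: cvg_cst.
have Ic (c : R) : I a b (cst c) = c * (b - a).
  by rewrite Rintegral_cst//= [X in fine X]mab.
have ifC : mu.-integrable `[a, b] (EFin \o (fun x => f x - C)).
  by apply: cont_on_integrable => x xab; apply: cvgB; [exact: cf|exact: cvg_cst].
rewrite -[C * _]Ic -RintegralB//; last exact: cont_on_integrable.
apply: (le_trans (le_normr_Rintegral _ ifC)) => //.
rewrite -Ic; apply: le_Rintegral => //.
  exact: (integrable_norm ifC).
Qed.

Section closed_form.
Variables P Q : R -> R -> R.

(* The cross terms agree: the 1-form P dx + Q dy is closed at (x, y), for total
   differentials whose continuity is not assumed. *)
Definition closed_at (x y : R) := exists px r qy : R,
  forall e : R, 0 < e -> exists2 d : R, 0 < d & forall x' y',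
   `|x' - x| < d -> `|y' - y| < d ->
   `|P x' y' - P x y - px * (x' - x) - r * (y' - y)|
      <= e * (`|x' - x| + `|y' - y|) /\
   `|Q x' y' - Q x y - r * (x' - x) - qy * (y' - y)|
      <= e * (`|x' - x| + `|y' - y|).

Definition circ a b c d : R :=
  I c d (Q b) - I c d (Q a) - (I a b (P^~ d) - I a b (P^~ c)).

Variables a0 b0 c0 d0 : R.
Hypothesis ab0 : a0 < b0.
Hypothesis cd0 : c0 < d0.
Hypothesis closedPQ : forall x y, a0 <= x <= b0 -> c0 <= y <= d0 -> closed_at x y.

Lemma closed_at_cont x y : closed_at x y ->
  {for y, continuous (Q x)} /\ {for x, continuous (P^~ y)}.
Proof.
move=> [px [r [qy H]]]; split; apply/cvgrPdist_le => e e0.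
  have [d d0' Hd] := H 1 ltr01.
  have K0 : 0 < 1 + `|qy| by rewrite ltr_pwDl.
  near=> y'.
  have yd : `|y' - y| < d by rewrite distrC; near: y'; apply: (@nbhsx_ballx _ _ y d).
  have [|_] := Hd x y' _ yd; first by rewrite subrr normr0.
  rewrite subrr mulr0 subr0 normr0 add0r mul1r => h.
  have : `|y' - y| < e / (1 + `|qy|).
    by rewrite distrC; near: y'; apply: (@nbhsx_ballx _ _ y (e / (1 + `|qy|))); rewrite divr_gt0.
  rewrite ltr_pdivlMr// mulrC => h2.
  rewrite distrC (le_trans _ (ltW h2))// -[Q x y' - _](subrK (qy * (y' - y))).
  by rewrite (le_trans (ler_normD _ _))// normrM mulrDl mul1r lerD.
have [d d0' Hd] := H 1 ltr01.
have K0 : 0 < 1 + `|px| by rewrite ltr_pwDl.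
near=> x'.
have yd : `|x' - x| < d by rewrite distrC; near: x'; apply: (@nbhsx_ballx _ _ x d).
have [|+ _] := Hd x' y yd; first by rewrite subrr normr0.
rewrite subrr mulr0 subr0 normr0 addr0 mul1r => h.
have : `|x' - x| < e / (1 + `|px|).
  by rewrite distrC; near: x'; apply: (@nbhsx_ballx _ _ x (e / (1 + `|px|))); rewrite divr_gt0.
rewrite ltr_pdivlMr// mulrC => h2.
rewrite distrC (le_trans _ (ltW h2))// -[P x' y - _](subrK (px * (x' - x))).
by rewrite (le_trans (ler_normD _ _))// normrM mulrDl mul1r lerD.
Unshelve. all: by end_near. Qed.

Let cQ x : a0 <= x <= b0 -> cont_on c0 d0 (Q x).
Proof. by move=> xab y ycd; exact: (closed_at_cont (closedPQ xab ycd)).1. Qed.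

Let cP y : c0 <= y <= d0 -> cont_on a0 b0 (P^~ y).
Proof. by move=> ycd x xab; exact: (closed_at_cont (closedPQ xab ycd)).2. Qed.

Lemma circ_split a m b c n d : a0 <= a -> a <= m -> m <= b -> b <= b0 ->
  c0 <= c -> c <= n -> n <= d -> d <= d0 ->
  circ a b c d = circ a m c n + circ m b c n + circ a m n d + circ m b n d.
Proof.
move=> a0a am mb bb0 c0c cn nd dd0; rewrite /circ.
have Qs x : a <= x <= b -> I c d (Q x) = I c n (Q x) + I n d (Q x).
  by move=> xab; apply: Rintegral_split => //; apply: cont_on_sub (cQ _) => //; lra.
have Ps y : c <= y <= d -> I a b (P^~ y) = I a m (P^~ y) + I m b (P^~ y).
  by move=> xab; apply: Rintegral_split => //; apply: cont_on_sub (cP _) => //; lra.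
rewrite (Qs a) ?(Qs b) ?(Ps c) ?(Ps d); lra.
Qed.

(** The affine parts contribute r (b - a) (d - c) to the vertical and to the horizontal sides alike,
    and cancel because [closed_at] has the same r in both lines. The remainders are at most e times
    the square of half the perimeter. *)
Lemma circ_small x y (e : R) : a0 <= x <= b0 -> c0 <= y <= d0 -> 0 < e ->
  exists2 dl : R, 0 < dl & forall a b c d, a0 <= a -> b <= b0 -> c0 <= c -> d <= d0 ->
   a <= x <= b -> c <= y <= d -> b - a < dl -> d - c < dl ->
   `|circ a b c d| <= e * (b - a + (d - c)) ^+ 2.
Proof.
move=> xab ycd e0; have [px [r [qy H]]] := closedPQ xab ycd.
have [dl dl0 Hd] := H (e / 2) (divr_gt0 e0 (ltr0Sn _ _)).
exists dl => // a b c d a0a bb0 c0c dd0 axb cyd ba dc.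
set s := b - a + (d - c).
have /andP[ax xb] := axb; have ab := le_trans ax xb.
have /andP[cy yd] := cyd; have cd := le_trans cy yd.
have nx t : a <= t <= b -> `|t - x| <= b - a by move=> ?; rewrite ler_norml; lra.
have ny t : c <= t <= d -> `|t - y| <= d - c by move=> ?; rewrite ler_norml; lra.
have HQ : `|I c d (Q b) - I c d (Q a) - r * (b - a) * (d - c)| <= e * s * (d - c).
  have cab t : a <= t <= b -> cont_on c d (Q t).
    by move=> ?; apply: cont_on_sub (cQ _) => //; lra.
  rewrite -RintegralB//; [|apply: cont_on_integrable; apply: cab; rewrite ?ab ?cd lexx//..].
  apply: Rintegral_near_cst; [by []| |].
    by move=> t tcd; apply: cvgB; apply: cab => //; rewrite ?ab ?cd lexx.
  move=> t tcd.
  have [||_ h1] := Hd b t; [rewrite (le_lt_trans (nx _ _))// ab lexx//|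
    by rewrite (le_lt_trans (ny _ _))|].
  have [||_ h2] := Hd a t; [rewrite (le_lt_trans (nx _ _))// ab lexx//|
    by rewrite (le_lt_trans (ny _ _))|].
  have nt := ny _ tcd.
  have nb : `|b - x| <= b - a by apply: nx; rewrite ab lexx.
  have na : `|a - x| <= b - a by apply: nx; rewrite ab lexx.
  have -> : Q b t - Q a t - r * (b - a) =
    (Q b t - Q x y - r * (b - x) - qy * (t - y)) -
    (Q a t - Q x y - r * (a - x) - qy * (t - y)) by ring.
  rewrite (le_trans (ler_normB _ _))//.
  have k1 : e / 2 * (`|b - x| + `|t - y|) <= e / 2 * s.
    by rewrite ler_pM2l ?divr_gt0// /s lerD.
  have k2 : e / 2 * (`|a - x| + `|t - y|) <= e / 2 * s.
    by rewrite ler_pM2l ?divr_gt0// /s lerD.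
  clear - h1 h2 k1 k2; lra.
have HP : `|I a b (P^~ d) - I a b (P^~ c) - r * (d - c) * (b - a)| <= e * s * (b - a).
  have cab t : c <= t <= d -> cont_on a b (P^~ t).
    by move=> ?; apply: cont_on_sub (cP _) => //; lra.
  rewrite -RintegralB//; [|apply: cont_on_integrable; apply: cab; rewrite ?ab ?cd lexx//..].
  apply: Rintegral_near_cst; [by []| |].
    by move=> t tcd; apply: cvgB; apply: cab => //; rewrite ?ab ?cd lexx.
  move=> t tcd.
  have [||h1 _] := Hd t d; [by rewrite (le_lt_trans (nx _ _))|
    rewrite (le_lt_trans (ny _ _))// cd lexx//|].
  have [||h2 _] := Hd t c; [by rewrite (le_lt_trans (nx _ _))|
    rewrite (le_lt_trans (ny _ _))// cd lexx//|].
  have nt := nx _ tcd.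
  have nb : `|d - y| <= d - c by apply: ny; rewrite cd lexx.
  have na : `|c - y| <= d - c by apply: ny; rewrite cd lexx.
  have -> : P t d - P t c - r * (d - c) =
    (P t d - P x y - px * (t - x) - r * (d - y)) -
    (P t c - P x y - px * (t - x) - r * (c - y)) by ring.
  rewrite (le_trans (ler_normB _ _))//.
  have k1 : e / 2 * (`|t - x| + `|d - y|) <= e / 2 * s.
    by rewrite ler_pM2l ?divr_gt0// /s lerD.
  have k2 : e / 2 * (`|t - x| + `|c - y|) <= e / 2 * s.
    by rewrite ler_pM2l ?divr_gt0// /s lerD.
  clear - h1 h2 k1 k2; lra.
rewrite /circ.
have -> : forall A B C D k : R, A - B - (C - D) =
  (A - B - r * (b - a) * (d - c)) - (C - D - r * (d - c) * (b - a)).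
  by move=> *; ring.
rewrite (le_trans (ler_normB _ _))// (le_trans (lerD HQ HP))// /s.
by rewrite le_eqVlt; apply/orP; left; apply/eqP; ring.
exact: 0.
Qed.

(** Repeated quadrisection: some quarter always keeps at least a quarter of the circulation, and the
    rectangles shrink to a point where [circ_small] is contradicted. *)
Theorem goursat : circ a0 b0 c0 d0 = 0.
Proof.
apply/eqP; rewrite -normr_le0 leNgt; apply/negP => circ0.
(* Half of the circulation, so that the invariant in [ok] is strict from the start and contradicts
   the weak inequality of [circ_small]. *)
set K := `|circ a0 b0 c0 d0| / 2.
have K0 : 0 < K by rewrite /K divr_gt0.
set h := b0 - a0; set k := d0 - c0.
pose cn n (p : R * R) := circ p.1 (p.1 + h / 2 ^+ n) p.2 (p.2 + k / 2 ^+ n).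
pose ok n (p : R * R) := [/\ a0 <= p.1, p.1 + h / 2 ^+ n <= b0,
   c0 <= p.2, p.2 + k / 2 ^+ n <= d0 & K / 4 ^+ n < `|cn n p|].
pose nxt n (p q : R * R) := [/\ p.1 <= q.1, q.1 + h / 2 ^+ n.+1 <= p.1 + h / 2 ^+ n,
   p.2 <= q.2 & q.2 + k / 2 ^+ n.+1 <= p.2 + k / 2 ^+ n].
have h0 : 0 < h by rewrite /h subr_gt0.
have k0 : 0 < k by rewrite /k subr_gt0.
have e2 (n : nat) : 0 < (2 : R) ^- n by rewrite invr_gt0 exprn_gt0.
(* Stated as an implication, so that [choice] yields a total successor function; (0, 0) is a dummy
   value. *)
have step (np : nat * (R * R)) : exists q, ok np.1 np.2 -> ok np.1.+1 q /\ nxt np.1 np.2 q.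
  case: np => n [a c] /=.
  have [[/= A1 A2 A3 A4 A5]|nok] := pselect (ok n (a, c)); last by exists (0, 0).
  set hn := h / 2 ^+ n.+1; set kn := k / 2 ^+ n.+1.
  have hnE : h / 2 ^+ n = hn + hn.
    by rewrite /hn exprS; field; rewrite expf_neq0.
  have knE : k / 2 ^+ n = kn + kn.
    by rewrite /kn exprS; field; rewrite expf_neq0.
  have hn0 : 0 < hn by rewrite /hn mulr_gt0.
  have kn0 : 0 < kn by rewrite /kn mulr_gt0.
  rewrite hnE knE in A2 A4.
  move: A5; rewrite /cn/= hnE knE => A5.
  have cE : circ a (a + (hn + hn)) c (c + (kn + kn)) =
    circ a (a + hn) c (c + kn) + circ (a + hn) (a + (hn + hn)) c (c + kn) +
    circ a (a + hn) (c + kn) (c + (kn + kn)) +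
    circ (a + hn) (a + (hn + hn)) (c + kn) (c + (kn + kn)).
    by apply: circ_split => //; clear - hn0 kn0; lra.
  have K4 : K / 4 ^+ n = K / 4 ^+ n.+1 *+ 4.
    by rewrite exprS -mulr_natr; field; rewrite expf_neq0.
  have : exists2 q, q \in [:: (a, c); (a + hn, c); (a, c + kn); (a + hn, c + kn)] &
     K / 4 ^+ n.+1 < `|cn n.+1 q|.
    apply: contrapT => no.
    have b q : q \in [:: (a, c); (a + hn, c); (a, c + kn); (a + hn, c + kn)] ->
      `|cn n.+1 q| <= K / 4 ^+ n.+1.
      by move=> qin; rewrite leNgt; apply/negP => ?; apply: no; exists q.
    have b1 := b (a, c); have b2 := b (a + hn, c); have b3 := b (a, c + kn).
    have b4 := b (a + hn, c + kn).
    rewrite /cn/= -/hn -/kn !inE !eqxx ?orbT -!addrA in b1 b2 b3 b4.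
    have {}b1 := b1 isT; have {}b2 := b2 isT; have {}b3 := b3 isT; have {}b4 := b4 isT.
    move: A5; rewrite cE ltNge => /negP; apply.
    rewrite K4; do 3 rewrite mulrS; rewrite mulr1n.
    apply: (le_trans (ler_normD _ _)).
    have := ler_normD (circ a (a + hn) c (c + kn) + circ (a + hn) (a + (hn + hn)) c (c + kn))
      (circ a (a + hn) (c + kn) (c + (kn + kn))).
    have := ler_normD (circ a (a + hn) c (c + kn)) (circ (a + hn) (a + (hn + hn)) c (c + kn)).
    lra.
  move=> [q qin qK]; exists q => _; split; last first.
    rewrite /nxt/= hnE knE -/hn -/kn.
    move: qin {qK}; clear - hn0 kn0; rewrite !inE => /or4P[] /eqP ->/=; split; lra.
  split => //; rewrite -/hn -/kn;
    move: qin {qK}; clear - hn0 kn0 A1 A2 A3 A4; rewrite !inE => /or4P[] /eqP ->/=; lra.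
have [F HF] := choice step.
pose p := fix p n := if n is n.+1 then F (n, p n) else (a0, c0).
have okp n : ok n (p n).
  elim: n => [|n /(HF (n, p n))[]//].
  rewrite /ok /cn/= !expr0 !divr1; split; rewrite /h /k; try lra.
  rewrite !subrKC /K; lra.
have nxp n : nxt n (p n) (p n.+1) by have [] := HF (n, p n) (okp n).
have mono n i : [/\ (p n).1 <= (p (n + i)%N).1,
   (p (n + i)%N).1 + h / 2 ^+ (n + i)%N <= (p n).1 + h / 2 ^+ n,
   (p n).2 <= (p (n + i)%N).2 &
   (p (n + i)%N).2 + k / 2 ^+ (n + i)%N <= (p n).2 + k / 2 ^+ n].
  elim: i => [|i [I1 I2 I3 I4]]; first by rewrite addn0; split.
  have [] := nxp (n + i)%N; rewrite -addnS => J1 J2 J3 J4; split; lra.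
have mono1 n i : (p i).1 <= (p n).1 + h / 2 ^+ n.
  have [ni|ni] := leqP n i.
    have [_ + _ _] := mono n (i - n)%N; rewrite subnKC// => ?.
    have : 0 < h / 2 ^+ i by rewrite mulr_gt0.
    lra.
  have [+ _ _ _] := mono i (n - i)%N; rewrite subnKC 1?ltnW// => ?.
  have : 0 < h / 2 ^+ n by rewrite mulr_gt0.
  lra.
have mono2 n i : (p i).2 <= (p n).2 + k / 2 ^+ n.
  have [ni|ni] := leqP n i.
    have [_ _ _] := mono n (i - n)%N; rewrite subnKC// => ?.
    have : 0 < k / 2 ^+ i by rewrite mulr_gt0.
    lra.
  have [_ _ + _] := mono i (n - i)%N; rewrite subnKC 1?ltnW// => ?.
  have : 0 < k / 2 ^+ n by rewrite mulr_gt0.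
  lra.
(* The common point of the rectangles: in each coordinate, the supremum of the lower left
   corners. *)
pose X := [set (p n).1 | n in [set: nat]]; pose Y := [set (p n).2 | n in [set: nat]].
have supX : has_sup X.
  split; first by exists (p 0%N).1; exists 0%N.
  by exists ((p 0%N).1 + h / 2 ^+ 0) => _ [i _ <-]; exact: mono1.
have supY : has_sup Y.
  split; first by exists (p 0%N).2; exists 0%N.
  by exists ((p 0%N).2 + k / 2 ^+ 0) => _ [i _ <-]; exact: mono2.
have xin n : (p n).1 <= sup X <= (p n).1 + h / 2 ^+ n.
  apply/andP; split; first by apply: (ub_le_sup supX.2); exists n.
  by apply: (ge_sup supX.1) => _ [i _ <-]; exact: mono1.
have yin n : (p n).2 <= sup Y <= (p n).2 + k / 2 ^+ n.
  apply/andP; split; first by apply: (ub_le_sup supY.2); exists n.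
  by apply: (ge_sup supY.1) => _ [i _ <-]; exact: mono2.
have hk0 : 0 < (h + k) ^+ 2 by rewrite exprn_gt0// addr_gt0.
(* With this constant the bound on the n-th rectangle is exactly K / 4^n. *)
have [||dl dl0 Hdl] := @circ_small (sup X) (sup Y) (K / (h + k) ^+ 2) _ _ (divr_gt0 K0 hk0).
- have := xin 0%N; rewrite expr0 divr1 /= /h; lra.
- have := yin 0%N; rewrite expr0 divr1 /= /k; lra.
have [n hn] : exists n, (h + k) / 2 ^+ n < dl.
  have hk : 0 < h + k by rewrite addr_gt0.
  have := @near_infty_natSinv_expn_lt R (PosNum (divr_gt0 dl0 hk)).
  move=> [N _ /(_ N (leqnn N))] /=; rewrite div1r => hN.
  exists N; rewrite mulrC; rewrite ltr_pdivlMr// in hN.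
have hhn : 0 < h / 2 ^+ n by rewrite mulr_gt0.
have hkn : 0 < k / 2 ^+ n by rewrite mulr_gt0.
rewrite mulrDl in hn.
have [A1 A2 A3 A4] := okp n.
have e4 : (4 : R) ^+ n = 2 ^+ n * 2 ^+ n by rewrite -exprMn -natrM.
rewrite ltNge => /negP; apply.
apply: (le_trans (Hdl (p n).1 ((p n).1 + h / 2 ^+ n) (p n).2 ((p n).2 + k / 2 ^+ n)
  A1 A2 A3 A4 (xin n) (yin n) _ _)); [lra..|].
have addK (u v : R) : u + v - u = v by ring.
rewrite e4 !addK.
have -> : K / (h + k) ^+ 2 * (h / 2 ^+ n + k / 2 ^+ n) ^+ 2 = K / (2 ^+ n * 2 ^+ n).
  by field; rewrite ?expf_neq0//= gt_eqF// addr_gt0.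
by [].
Qed.

End closed_form.
End Goursat.

(** * Total differentials of functions of two real variables *)

Section TotalDifferential.
Context {R : realType}.
Implicit Types (F : R -> R -> R) (x y fx fy : R).

(** Differentiability at a single point, in the epsilon form that [closed_at] requires. *)
Definition tdiff F x y fx fy := forall e : R, 0 < e ->
  exists2 d : R, 0 < d & forall x' y', `|x' - x| < d -> `|y' - y| < d ->
  `|F x' y' - F x y - fx * (x' - x) - fy * (y' - y)| <= e * (`|x' - x| + `|y' - y|).

Lemma tdiff_lip F x y fx fy : tdiff F x y fx fy ->
  exists K d : R, [/\ 0 < K, 0 < d & forall x' y', `|x' - x| < d -> `|y' - y| < d ->
  `|F x' y' - F x y| <= K * (`|x' - x| + `|y' - y|)].
Proof.
move=> H; have [d d0 Hd] := H 1 ltr01.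
exists (1 + `|fx| + `|fy|), d; split => //; last move=> x' y' xd yd.
have := Hd _ _ xd yd; set A := (X in `|X| <= _) => h.
have -> : F x' y' - F x y = A + (fx * (x' - x) + fy * (y' - y)) by rewrite /A; ring.
have k : `|fx * (x' - x) + fy * (y' - y)| <=
    `|fx| * (`|x' - x| + `|y' - y|) + `|fy| * (`|x' - x| + `|y' - y|).
  by rewrite (le_trans (ler_normD _ _))// !normrM lerD// ler_wpM2l// ?lerDl ?lerDr.
rewrite (le_trans (ler_normD _ _))// !mulrDl -addrA; exact: lerD.
Qed.

Lemma tdiff_comp F G1 G2 x y g1x g1y g2x g2y f1 f2 :
  tdiff G1 x y g1x g1y -> tdiff G2 x y g2x g2y ->
  tdiff F (G1 x y) (G2 x y) f1 f2 ->
  tdiff (fun x y => F (G1 x y) (G2 x y)) x y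
    (f1 * g1x + f2 * g2x) (f1 * g1y + f2 * g2y).
Proof.
move=> D1 D2 DF e e0.
have [K1 [k1 [K10 k10 L1]]] := tdiff_lip D1.
have [K2 [k2 [K20 k20 L2]]] := tdiff_lip D2.
(* Half of e is spent on F, whose arguments move by at most (K1 + K2) s in total, and a quarter on
   each of G1 and G2; 1 + |f1| and 1 + |f2| avoid a division by 0. *)
have KK : 0 < 2 * (K1 + K2) by rewrite mulr_gt0// addr_gt0.
have [dF dF0 HF] := DF _ (divr_gt0 e0 KK).
have f0 (t : R) : 0 < 4 * (1 + `|t|) by rewrite mulr_gt0// ltr_pwDl.
have [d1 d10 H1] := D1 _ (divr_gt0 e0 (f0 f1)).
have [d2 d20 H2] := D2 _ (divr_gt0 e0 (f0 f2)).
pose d3 := dF / (2 * (K1 + K2)).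
have d30 : 0 < d3 by rewrite divr_gt0.
exists (Num.min (Num.min k1 k2) (Num.min d3 (Num.min d1 d2))).
  by rewrite !lt_min k10 k20 d30 d10 d20.
move=> x' y'; rewrite !lt_min => /andP[/andP[xk1 xk2] /and3P[xd3 xd1 xd2]].
move=> /andP[/andP[yk1 yk2] /and3P[yd3 yd1 yd2]].
have {L1} l1 := L1 _ _ xk1 yk1; have {L2} l2 := L2 _ _ xk2 yk2.
have {H1} h1 := H1 _ _ xd1 yd1; have {H2} h2 := H2 _ _ xd2 yd2.
set s := `|x' - x| + `|y' - y| in l1 l2 h1 h2 *.
have s0 : 0 <= s by rewrite addr_ge0.
have sd : s * (K1 + K2) < dF.
  have := ltrD xd3 yd3; rewrite -/s /d3 => sd.
  have -> : dF = dF / (2 * (K1 + K2)) * (2 * (K1 + K2)) by rewrite divfK// gt_eqF.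
  have K0 : 0 < K1 + K2 by rewrite addr_gt0.
  have -> : dF / (2 * (K1 + K2)) * (2 * (K1 + K2)) =
    (dF / (2 * (K1 + K2)) + dF / (2 * (K1 + K2))) * (K1 + K2) by ring.
  by rewrite ltr_pM2r.
have l1' : `|G1 x' y' - G1 x y| < dF.
  by rewrite (le_lt_trans l1)// (le_lt_trans _ sd)// mulrC ler_wpM2l// lerDl ltW.
have l2' : `|G2 x' y' - G2 x y| < dF.
  by rewrite (le_lt_trans l2)// (le_lt_trans _ sd)// mulrC ler_wpM2l// lerDr ltW.
have hF := HF _ _ l1' l2'.
have -> : F (G1 x' y') (G2 x' y') - F (G1 x y) (G2 x y) -
  (f1 * g1x + f2 * g2x) * (x' - x) - (f1 * g1y + f2 * g2y) * (y' - y) =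
  (F (G1 x' y') (G2 x' y') - F (G1 x y) (G2 x y) - f1 * (G1 x' y' - G1 x y)
    - f2 * (G2 x' y' - G2 x y)) +
  f1 * (G1 x' y' - G1 x y - g1x * (x' - x) - g1y * (y' - y)) +
  f2 * (G2 x' y' - G2 x y - g2x * (x' - x) - g2y * (y' - y)) by ring.
have m1 (t g : R) : `|g| <= e / (4 * (1 + `|t|)) * s -> `|t * g| <= e / 4 * s.
  move=> gs; rewrite normrM (le_trans (ler_wpM2l _ gs))//.
  have -> : `|t| * (e / (4 * (1 + `|t|)) * s) = (`|t| / (1 + `|t|)) * (e / 4 * s).
    by field; rewrite gt_eqF// ltr_pwDl.
  rewrite ler_piMl//; first by rewrite mulr_ge0// divr_ge0// ltW.
  by rewrite ler_pdivrMr ?ltr_pwDl// mul1r lerDr.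
have q1 := m1 _ _ h1; have q2 := m1 _ _ h2.
have q3 : e / (2 * (K1 + K2)) * (`|G1 x' y' - G1 x y| + `|G2 x' y' - G2 x y|) <= e / 2 * s.
  have -> : e / 2 * s = e / (2 * (K1 + K2)) * (K1 * s + K2 * s).
    by field; rewrite gt_eqF// addr_gt0.
  apply: ler_wpM2l; last exact: lerD.
  by rewrite divr_ge0 ?ltW// mulr_ge0// ltW// addr_gt0.
rewrite (le_trans (ler_normD _ _))// (le_trans (lerD (ler_normD _ _) (lexx _)))//.
clear - hF q1 q2 q3; lra.
Qed.

Lemma tdiff_mul x y : tdiff (fun x y => x * y) x y y x.
Proof.
move=> e e0; exists e => // x' y' xe ye.
have -> : x' * y' - x * y - y * (x' - x) - x * (y' - y) = (x' - x) * (y' - y) by ring.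
by rewrite normrM mulrDr [leLHS]mulrC (le_trans (ler_wpM2r _ (ltW ye)))// lerDl mulr_ge0// ltW.
Qed.

Lemma derive_tdiff (f : R -> R) x df : is_derive x 1 f df ->
  forall e : R, 0 < e -> exists2 d : R, 0 < d & forall x', `|x' - x| < d ->
    `|f x' - f x - df * (x' - x)| <= e * `|x' - x|.
Proof.
move=> [fx <-] e e0.
have /cvgrPdist_le/(_ e e0)[d /= d0 H] := fx.
exists d => // x' xd.
have [x0|x0] := eqVneq (x' - x) 0; [rewrite x0|].
  have [->|] := eqVneq x' x; first by rewrite subrr mulr0 subr0 normr0 mulr0.
  by rewrite -subr_eq0 x0 eqxx.
have := H (x' - x); rewrite /= sub0r normrN => /(_ xd x0).
rewrite /GRing.scale/= mulr1 subrK -(ler_pM2r (x := `|x' - x|)) ?normr_gt0//.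
rewrite -normrM mulrBl mulrAC mulVf// mul1r distrC => h; exact: h.
Qed.

Lemma tdiff_fst (f : R -> R) x y df : is_derive x 1 f df ->
  tdiff (fun x _ => f x) x y df 0.
Proof.
move=> fd e e0; have [d d0 H] := derive_tdiff fd e0.
exists d => // x' y' xd _; rewrite mul0r subr0 (le_trans (H _ xd))//.
by rewrite ler_wpM2l ?lerDl// ltW.
Qed.

Lemma tdiff_snd (f : R -> R) x y df : is_derive y 1 f df ->
  tdiff (fun _ y => f y) x y 0 df.
Proof.
move=> fd e e0; have [d d0 H] := derive_tdiff fd e0.
exists d => // x' y' _ yd; rewrite mul0r subr0 (le_trans (H _ yd))//.
by rewrite ler_wpM2l ?lerDr// ltW.
Qed.

End TotalDifferential.

Arguments modulus {R} z : simpl never.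

(** * Modulus, real and imaginary parts, complex derivatives as real differentials *)

Section ComplexBasics.
Context {R : realType}.
Local Notation C := R[i].
Implicit Types (z w : C).

Lemma normC_modulus z : `|z| = (modulus z)%:C.
Proof. by case: z => a b; rewrite normc_def. Qed.

Lemma modulus_ge0 z : 0 <= modulus z.
Proof. by case: z => a b; exact: sqrtr_ge0. Qed.

Lemma sqr_modulus z : modulus z ^+ 2 = complex.Re z ^+ 2 + complex.Im z ^+ 2.
Proof. by case: z => a b; rewrite sqr_sqrtr// addr_ge0// sqr_ge0. Qed.

Lemma modulusM z w : modulus (z * w) = modulus z * modulus w.
Proof. exact: ComplexField.Normc.normcM. Qed.

Lemma modulusV z : modulus z^-1 = (modulus z)^-1.
Proof. exact: ComplexField.Normc.normcV. Qed.

Lemma modulus0 : modulus (0 : C) = 0.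
Proof. exact: ComplexField.Normc.normc0. Qed.

Lemma modulus1 : modulus (1 : C) = 1.
Proof. exact: ComplexField.Normc.normc1. Qed.

Lemma modulus_eq0 z : (modulus z == 0) = (z == 0).
Proof.
apply/eqP/eqP => [|->]; first exact: ComplexField.Normc.eq0_normc.
exact: modulus0.
Qed.

Lemma modulus_gt0 z : (0 < modulus z) = (z != 0).
Proof. by rewrite lt_neqAle eq_sym modulus_eq0 modulus_ge0 andbT. Qed.

Lemma modulusX z n : modulus (z ^+ n) = modulus z ^+ n.
Proof. by elim: n => [|n IH]; rewrite ?expr0 ?modulus1// !exprS modulusM IH. Qed.

Lemma modulusJ z : modulus z^*%C = modulus z.
Proof. by case: z => a b /=; rewrite /modulus/= sqrrN. Qed.

Lemma modulusN z : modulus (- z) = modulus z.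
Proof. by case: z => a b /=; rewrite /modulus/= !sqrrN. Qed.

Lemma modulus_real (x : R) : modulus x%:C = `|x|.
Proof. by rewrite /modulus/= expr0n addr0 sqrtr_sqr. Qed.

Lemma modulus_Re z : `|complex.Re z| <= modulus z.
Proof. by rewrite -lecR -normC_modulus normc_ge_Re. Qed.

Lemma modulus_Im z : `|complex.Im z| <= modulus z.
Proof.
rewrite -(ler_pXn2r (n := 2))// ?nnegrE ?modulus_ge0// sqr_modulus.
by rewrite real_normK ?num_real// lerDr sqr_ge0.
Qed.

Lemma modulus_le z : modulus z <= `|complex.Re z| + `|complex.Im z|.
Proof.
rewrite -(ler_pXn2r (n := 2))// ?nnegrE ?modulus_ge0 ?addr_ge0// sqr_modulus.
rewrite sqrrD !real_normK ?num_real// addrAC lerDl.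
by rewrite mulrn_wge0// mulr_ge0.
Qed.

Lemma cReD z w : complex.Re (z + w) = complex.Re z + complex.Re w.
Proof. by case: z w => [a b] []. Qed.
Lemma cImD z w : complex.Im (z + w) = complex.Im z + complex.Im w.
Proof. by case: z w => [a b] []. Qed.
Lemma cReN z : complex.Re (- z) = - complex.Re z.
Proof. by case: z. Qed.
Lemma cImN z : complex.Im (- z) = - complex.Im z.
Proof. by case: z. Qed.
Lemma cReM z w : complex.Re (z * w) = complex.Re z * complex.Re w - complex.Im z * complex.Im w.
Proof. by case: z w => [a b] []. Qed.
Lemma cImM z w : complex.Im (z * w) = complex.Re z * complex.Im w + complex.Im z * complex.Re w.
Proof. by case: z w => [a b] []. Qed.

Lemma derivable_cdiff (f : C^o -> C^o) z : derivable f z 1 ->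
  exists D : C, forall e : R, 0 < e -> exists2 d : R, 0 < d & forall w,
    modulus (w - z) < d -> modulus (f w - f z - D * (w - z)) <= e * modulus (w - z).
Proof.
move=> fz; exists ('D_1 f z) => e e0.
have e0' : 0 < e%:C by rewrite ltcR.
have /cvgrPdist_le/(_ _ e0')[d /= d0 H] := fz.
(* The radius is itself a complex number; being positive, it is real. *)
have dE : d = (complex.Re d)%:C.
  have := d0 : (0 : C) < d; rewrite ltcE => /andP[/eqP/= dI _].
  by rewrite [LHS]complexE dI mulr0 addr0.
rewrite dE ltcR in d0.
exists (complex.Re d) => // w wd.
have [wz|x0] := eqVneq (w - z) 0.
  have -> : w = z by apply/eqP; rewrite -subr_eq0 wz.
  by rewrite !subrr mulr0 subr0 modulus0 mulr0.
have := H (w - z); rewrite /= sub0r normrN dE normC_modulus ltcR => /(_ wd x0).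
rewrite /GRing.scale/= mulr1 subrK normC_modulus lecR => h.
have := ler_wpM2r (modulus_ge0 (w - z)) h.
rewrite -modulusM mulrBl mulrAC mulVf// mul1r.
by rewrite -modulusN opprB => h'; exact: h'.
Qed.

(** The Cauchy-Riemann equations: multiplication by D = p + iq is the real linear map with rows (p,
    - q) and (q, p). *)
Lemma derivable_tdiff (f : C^o -> C^o) z : derivable f z 1 ->
  exists D : C,
    tdiff (fun a b => complex.Re (f (a +i* b))) (complex.Re z) (complex.Im z)
      (complex.Re D) (- complex.Im D) /\
    tdiff (fun a b => complex.Im (f (a +i* b))) (complex.Re z) (complex.Im z)
      (complex.Im D) (complex.Re D).
Proof.
move=> /derivable_cdiff[D HD]; exists D.
have zE : complex.Re z +i* complex.Im z = z by case: (z).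
suff H (e : R) : 0 < e -> exists2 d : R, 0 < d & forall x' y',
    `|x' - complex.Re z| < d -> `|y' - complex.Im z| < d ->
    modulus (f (x' +i* y') - f z - D * (x' +i* y' - z)) <=
      e * (`|x' - complex.Re z| + `|y' - complex.Im z|).
  split => e /H[d d0 Hd]; exists d => // x' y' xd yd;
    have := Hd _ _ xd yd; rewrite zE.
    apply: le_trans; apply: le_trans (modulus_Re _).
    rewrite !(cReD, cReN, cReM, cImD, cImN)/=; rewrite le_eqVlt; apply/orP; left; apply/eqP.
    by congr `|_|; ring.
  apply: le_trans; apply: le_trans (modulus_Im _).
  rewrite !(cReD, cReN, cImM, cImD, cImN)/=; rewrite le_eqVlt; apply/orP; left; apply/eqP.
  by congr `|_|; ring.
move=> e0; have [d d0 Hd] := HD _ e0.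
exists (d / 2) => [|x' y' xd yd]; first by rewrite divr_gt0.
have m1 : modulus (x' +i* y' - z) <= `|x' - complex.Re z| + `|y' - complex.Im z|.
  by apply: le_trans (modulus_le _) _; case: (z).
apply: le_trans (Hd _ _) _; last by rewrite ler_wpM2l// ltW.
by apply: le_lt_trans m1 _; lra.
Qed.

End ComplexBasics.

(** * Mean value over circles *)

Section MeanValue.
Context {R : realType}.
Local Notation mu := (@lebesgue_measure R).
Local Notation C := R[i].

Definition rot (t : R) (p : R * R) : R * R :=
  (cos t * p.1 - sin t * p.2, sin t * p.1 + cos t * p.2).

Lemma rot_norm t p : (rot t p).1 ^+ 2 + (rot t p).2 ^+ 2 = p.1 ^+ 2 + p.2 ^+ 2.
Proof.
rewrite /rot/=; have := cos2Dsin2 t => h.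
rewrite -[RHS]mul1r -h; ring.
Qed.

(** In the coordinates (l, t) of the point l e^(it) p, the form (Im f / l) dl + Re f dt is closed
    for l > 0. On [e, 1] x [0, 2 pi] the sides t = 0 and t = 2 pi cancel by periodicity, so
    shrinking the circle by e does not change the mean of Re f; then e tends to 0. *)
Theorem mean_value (f : C^o -> C^o) (p : R * R) :
  (forall z : C, modulus z < 1 -> derivable f z 1) ->
  p.1 ^+ 2 + p.2 ^+ 2 < 1 ->
  mu.-integrable `[0, pi *+ 2]
    (fun t => (complex.Re (f ((rot t p).1 +i* (rot t p).2)))%:E) /\
  \int[mu]_(t in `[0, pi *+ 2]) complex.Re (f ((rot t p).1 +i* (rot t p).2)) =
  complex.Re (f 0) * (pi *+ 2).
Proof.
move=> df p1.
pose w1 (l t : R) := l * (rot t p).1; pose w2 (l t : R) := l * (rot t p).2.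
pose Q l t := complex.Re (f (w1 l t +i* w2 l t)).
pose V l t := complex.Im (f (w1 l t +i* w2 l t)).
pose P l t := V l t * l^-1.
have d1 t : is_derive t (1 : R) (fun t => (rot t p).1) (- (rot t p).2).
  by rewrite /rot/=; apply: is_derive_eq; rewrite /GRing.scale/=; ring.
have d2 t : is_derive t (1 : R) (fun t => (rot t p).2) ((rot t p).1).
  by rewrite /rot/=; apply: is_derive_eq; rewrite /GRing.scale/=; ring.
have tw1 l t := tdiff_comp (tdiff_fst t (is_derive_id l (1 : R))) (tdiff_snd l (d1 t)) (tdiff_mul _ _).
have tw2 l t := tdiff_comp (tdiff_fst t (is_derive_id l (1 : R))) (tdiff_snd l (d2 t)) (tdiff_mul _ _).
have in1 l t : 0 <= l <= 1 -> modulus (w1 l t +i* w2 l t) < 1.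
  move=> /andP[l0 l1].
  rewrite -(ltr_pXn2r (n := 2))// ?nnegrE ?modulus_ge0// sqr_modulus/= expr1n.
  rewrite /w1 /w2 !exprMn -mulrDr rot_norm.
  by rewrite (le_lt_trans _ p1)// ler_piMl ?addr_ge0 ?sqr_ge0// exprn_ile1.
have closed l t : 0 < l <= 1 -> closed_at P Q l t.
  move=> /andP[l0 l1]; have l01 : 0 <= l <= 1 by rewrite ltW.
  have [D [DQ DV]] := derivable_tdiff (df _ (in1 _ t l01)).
  have tQ := tdiff_comp (tw1 l t) (tw2 l t) DQ.
  have tV := tdiff_comp (tw1 l t) (tw2 l t) DV.
  have ti : is_derive l (1 : R) (fun x => x^-1) (- l ^- 2).
    have nl : l != 0 by rewrite gt_eqF.
    split; first exact: (@derivableV _ _ id).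
    by rewrite (@deriveV _ _ id)// derive_id /GRing.scale/= mulr1.
  have tP := tdiff_comp tV (tdiff_fst t ti) (tdiff_mul _ _).
  do 3 eexists; move=> e e0.
  have [dQ dQ0 HQ] := tQ e e0; have [dP dP0 HP] := tP e e0.
  exists (Num.min dQ dP); first by rewrite lt_min dQ0.
  move=> l' t'; rewrite !lt_min => /andP[lQ lP] /andP[yQ yP].
  split; first exact: HP _ _ lP yP.
  (* The cross term has been fixed by [P]; what remains is a Cauchy-Riemann equation in polar
     form. *)
  move: (HQ _ _ lQ yQ); congr (`|_ - _ * _ - _| <= _).
  by field; rewrite gt_eqF.
have pi20 : (0 : R) < pi *+ 2 by rewrite mulrn_wgt0// pi_gt0.
have Qe e : 0 < e < 1 -> \int[mu]_(t in `[0, pi *+ 2]) Q 1 t =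
    \int[mu]_(t in `[0, pi *+ 2]) Q e t.
  move=> /andP[e0 e1].
  have xin (x : R) : e <= x <= 1 -> 0 < x <= 1 by lra.
  have := @goursat R P Q e 1 0 (pi *+ 2) e1 pi20.
  rewrite /circ => cE; have {}cE := cE (fun x y xe _ => closed x y (xin x xe)).
  move: cE.
  have PE x : P x (pi *+ 2) = P x 0.
    by rewrite /P /V /w1 /w2 /rot cos2pi sin2pi cos0 sin0.
  under [X in _ - (X - _) = _]eq_Rintegral do rewrite PE.
  by rewrite subrr subr0 => /eqP; rewrite subr_eq0 => /eqP.
split.
  have c1 : cont_on 0 (pi *+ 2) (Q 1).
    by move=> t _; have [] := closed_at_cont (closed 1 t _); rewrite ?ltr01 ?lexx.
  move: (cont_on_integrable c1); apply: eq_integrable => // t _.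
  by rewrite /= /Q /w1 /w2 !mul1r.
transitivity (\int[mu]_(t in `[0, pi *+ 2]) Q 1 t).
  by apply: eq_Rintegral => t _; rewrite /Q /w1 /w2 !mul1r.
apply/eqP; rewrite -subr_eq0 -normr_le0; apply/ler_addgt0Pr => eta eta0; rewrite add0r.
have [|D [DQ _]] := derivable_tdiff (df 0 _); first by rewrite modulus0.
have [K [d [K0 d0 HK]]] := tdiff_lip DQ.
rewrite /= in HK.
(* Below d / 2 the Lipschitz bound at 0 applies; the last entry makes K (2 e) (2 pi) at most eta. *)
pose e := Num.min (2^-1) (Num.min (d / 2) (eta / (2 * K * (pi *+ 2)))).
have e01 : 0 < e < 1.
  apply/andP; split; last by rewrite /e gt_min invf_lt1// ltr1n.
  by rewrite !lt_min invr_gt0 ltr0n/= !divr_gt0// !mulr_gt0.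
rewrite (Qe e)//.
have ed : e <= d / 2 by rewrite /e !ge_min lexx orbT.
have eK : e <= eta / (2 * K * (pi *+ 2)) by rewrite /e !ge_min lexx !orbT.
have r1 t : `|(rot t p).1| <= 1.
  rewrite -(ler_pXn2r (n := 2))// ?nnegrE// expr1n real_normK ?num_real//.
  by rewrite (le_trans _ (ltW p1))// -(rot_norm t) lerDl sqr_ge0.
have r2 t : `|(rot t p).2| <= 1.
  rewrite -(ler_pXn2r (n := 2))// ?nnegrE// expr1n real_normK ?num_real//.
  by rewrite (le_trans _ (ltW p1))// -(rot_norm t) lerDr sqr_ge0.
have e0 : 0 < e by case/andP: e01.
have ew (r : R) : `|r| <= 1 -> `|e * r - 0| <= e.
  by move=> r1'; rewrite subr0 normrM gtr0_norm// ler_piMr// ltW.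
rewrite -[X in _ * X]subr0.
have e01' : 0 < e <= 1 by case/andP: e01 => -> /ltW.
have cQ : cont_on 0 (pi *+ 2) (Q e).
  by move=> t _; exact: (closed_at_cont (closed e t e01')).1.
have QK t : 0 <= t <= pi *+ 2 -> `|Q e t - complex.Re (f 0)| <= K * (2 * e).
  move=> _; rewrite /Q.
  have := HK (w1 e t) (w2 e t).
  have a1 := ew _ (r1 t); have a2 := ew _ (r2 t).
  have ed' : e < d by apply: le_lt_trans ed _; clear - d0; lra.
  move=> /(_ (le_lt_trans a1 ed') (le_lt_trans a2 ed')) h.
  apply: le_trans h _; rewrite ler_pM2l//; rewrite /w1 /w2; clear - a1 a2; lra.
apply: le_trans (Rintegral_near_cst (ltW pi20) cQ QK) _.
rewrite subr0 -ler_pdivlMr//.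
rewrite (le_trans (_ : _ <= K * (2 * (eta / (2 * K * (pi *+ 2))))))//.
  by rewrite !ler_pM2l.
have -> // : K * (2 * (eta / (2 * K * (pi *+ 2)))) = eta / (pi *+ 2).
move: (pi *+ 2) pi20 => q q0; field.
by rewrite !gt_eqF.
Qed.

End MeanValue.

(** * Change of variables in the plane *)

Section OneDim.
Context {R : realType}.
Local Notation mu := (@lebesgue_measure R).
Local Open Scope ereal_scope.

Lemma integral_mrestr d (T : measurableType d) (m : {measure set T -> \bar R})
    (E : set T) (mE : measurable E) (f : T -> \bar R) :
  measurable_fun setT f -> (forall x, 0 <= f x) ->
  \int[mrestr m mE]_x f x = \int[m]_(x in E) f x.
Proof.
move=> mf f0; rewrite -(setUv E) ge0_integral_setU//; last 3 first.
- exact: measurableC.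
- by rewrite setUv.
- by apply/disj_setPS; rewrite setICr.
rewrite [X in _ + X](_ : _ = 0) ?adde0; last first.
  apply: null_set_integral => //; first exact: measurableC.
    exact: measurable_funTS.
  by rewrite /= /mrestr setICl measure0.
apply: eq_measure_integral => A mA AE.
by rewrite /mrestr/=; congr (m _); apply/setIidPl.
Qed.

Lemma measurable_patch d (T : measurableType d) (D : set T) (f : T -> \bar R) :
  measurable D -> measurable_fun setT f -> measurable_fun setT (f \_ D).
Proof. by move=> mD mf; apply: (measurable_restrictT f mD).1; exact: measurable_funTS. Qed.

Section density.
Variables (T J : R -> R).
Hypothesis mT : measurable_fun setT T.
Hypothesis mJ : measurable_fun setT J.
Hypothesis J0 : forall x, (0 <= J x)%R.

(** The measure J dx is realised as the area restricted to the region under the graph of J, so that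
    it is a measure by construction and its integrals unfold by Tonelli. *)
Let E : set (measurableTypeR R * measurableTypeR R) :=
  [set p | (0 < p.2)%R && (p.2 <= J p.1)%R].

Let mE : measurable E.
Proof.
rewrite (_ : E = (fun p => (0 < p.2)%R && (p.2 <= J p.1)%R) @^-1` [set true]) //.
rewrite -[X in measurable X]setTI.
apply: measurable_and => //.
  exact: measurable_fun_ltr.
apply: measurable_fun_ler => //.
exact: measurableT_comp.
Qed.

Let mTfst : measurable_fun setT (fun p : measurableTypeR R * measurableTypeR R => (T p.1 : measurableTypeR R)).
Proof. exact: measurableT_comp. Qed.

Let nu := pushforward (mrestr (@area R) mE)
  (fun p : measurableTypeR R * measurableTypeR R => (T p.1 : measurableTypeR R)).

Let int_nu (G : R -> \bar R) : measurable_fun setT G -> (forall x, 0 <= G x) ->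
  \int[nu]_x G x = \int[mu]_x (G (T x) * (J x)%:E).
Proof.
move=> mG G0; rewrite /nu ge0_integral_pushforward//= preimage_setT.
rewrite integral_mrestr//; last exact: (measurableT_comp mG).
rewrite integral_mkcond/=.
have mGE : measurable_fun setT ((G \o (fun p : measurableTypeR R * measurableTypeR R => T p.1)) \_ E).
  by apply: measurable_patch => //; exact: (measurableT_comp mG).
rewrite (@fubini_tonelli1 _ _ _ _ _ mu mu)//; last first.
  by move=> p; apply: erestrict_ge0.
apply: eq_integral => x _; rewrite /fubini_F.
transitivity (\int[mu]_(y in `]0%R, J x]) (cst (G (T x)) y)).
  rewrite [RHS]integral_mkcond; apply: eq_integral => y _.
  by rewrite /patch/=; congr (if _ then _ else _).
rewrite integral_cst//= lebesgue_measure_itv/= lte_fin.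
case: ltP => [_|Jx0]; first by rewrite oppr0 adde0.
by have /eqP -> : (J x == 0)%R by rewrite eq_le Jx0 J0.
Qed.

(** The image of J dx under T agrees with the Lebesgue measure on half-open intervals, hence
    everywhere by uniqueness. *)
Lemma change_of_variable1 :
  (forall p q : R, (p < q)%R ->
    \int[mu]_x ((\1_(`]p, q]%classic) (T x))%:E * (J x)%:E) = (q - p)%:E) ->
  forall G : R -> \bar R, measurable_fun setT G -> (forall x, 0 <= G x) ->
  \int[mu]_x (G (T x) * (J x)%:E) = \int[mu]_x G x.
Proof.
move=> H G mG G0; rewrite -int_nu//; apply: eq_measure_integral => //= A mA _.
apply/esym/lebesgue_measure_unique => // _ [[p q]/= pq <-].
have [pq'|qp] := ltP p q; last first.
  by rewrite set_itv_ge ?measure0// -leNgt bnd_simp.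
rewrite lebesgue_measure_itv/= lte_fin pq' -EFinB -H//.
rewrite -(int_nu (G := fun x => (\1_(`]p, q]%classic) x)%:E))//.
  by rewrite integral_indic// setIT.
exact/measurable_EFinP.
Qed.

End density.

Lemma cov1_affine (a b : R) : a != 0%R ->
  forall G : R -> \bar R, measurable_fun setT G -> (forall x, 0 <= G x) ->
  \int[mu]_x (G (a * x + b)%R * (`|a|)%:E) = \int[mu]_x G x.
Proof.
move=> a0; apply: (@change_of_variable1 (fun x => a * x + b)%R (fun=> `|a|%R)) => //.
  by apply: measurable_funD => //; exact: measurable_funM.
move=> p q pq.
rewrite ge0_integralZr//; last first.
  apply/measurable_EFinP; apply: measurableT_comp => //.
  by apply: measurable_funD => //; exact: measurable_funM.
have mP : measurable ((fun x : R => a * x + b)%R @^-1` `]p, q]%classic).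
  rewrite -[X in measurable X]setTI.
  suff : measurable_fun setT (fun x : R => a * x + b)%R by apply.
  by apply: measurable_funD => //; exact: measurable_funM.
rewrite [X in X * _](_ : _ = mu ((fun x : R => a * x + b)%R @^-1` `]p, q]%classic)); last first.
  by have := integral_indic mu measurableT mP; rewrite setIT => <-.
have [a_gt0|a_lt0|/esym/eqP] := ltgtP 0%R a; last by rewrite (negbTE a0).
  rewrite (_ : _ @^-1` _ = `](p - b) / a, (q - b) / a]%classic)%R; last first.
    apply/seteqP; split => x /=; rewrite !in_itv/= ltr_pdivrMr// ler_pdivlMr//;
    by rewrite ltrBlDr lerBrDr [(x * a)%R]mulrC.
  rewrite lebesgue_measure_itv/= lte_fin ltr_pM2r ?invr_gt0// ltrD2r pq.
  rewrite gtr0_norm// -EFinB -EFinM; congr EFin.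
  by field; rewrite gt_eqF.
rewrite (_ : _ @^-1` _ = `[(q - b) / a, (p - b) / a[%classic)%R; last first.
  apply/seteqP; split => x /=; rewrite !in_itv/= ltr_ndivlMr// ler_ndivrMr//;
  by rewrite ltrBlDr lerBrDr [(x * a)%R]mulrC andbC.
rewrite lebesgue_measure_itv/= lte_fin ltr_nM2r ?invr_lt0// ltrD2r pq.
rewrite ltr0_norm// -EFinB -EFinM; congr EFin.
by field; rewrite lt_eqF.
Qed.

(** This settles [cov1_cinv] for ]0, q], whose preimage under inversion is [1/q, +oo[. *)
Lemma integral_inv_sqr (q : R) : (0 < q)%R ->
  \int[mu]_(x in `[q^-1%R, +oo[) (x ^- 2)%:E = q%:E.
Proof.
move=> q0; have qV0 : (0 < q^-1)%R by rewrite invr_gt0.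
have dF (x : R) : (q^-1 <= x)%R -> is_derive x (1%R : R) (fun x : R => - x^-1)%R (x ^- 2)%R.
  move=> qx; have x0 : (x != 0)%R by rewrite gt_eqF// (lt_le_trans qV0).
  have -> : (x ^- 2 = - (- x ^- 2))%R by rewrite opprK.
  apply: is_deriveN; split; first exact: (@derivableV _ _ id).
  by rewrite (@deriveV _ _ id)// derive_id /GRing.scale/= mulr1.
rewrite (@ge0_continuous_FTC2y _ _ (fun x => - x^-1)%R _ 0%R).
- by rewrite invrK -EFinB opprK add0r.
- by move=> x qx; rewrite invr_ge0 exprn_ge0// (le_trans _ qx)// ltW.
- apply: continuous_in_subspaceT => x /[!inE]/=; rewrite in_itv/= andbT => qx.
  apply: cvgV; last exact: exprn_continuous.
  by rewrite expf_neq0// gt_eqF// (lt_le_trans qV0).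
- rewrite -oppr0; apply: cvgN.
  apply/gtr0_cvgV0; last exact: cvg_id.
  exact: nbhs_pinfty_gt.
- by move=> x qx; have [] := dF x (ltW qx).
- apply: cvg_at_right_filter.
  have [d _] := dF _ (lexx q^-1%R).
  have /differentiable_continuous : differentiable (fun x : R => - x^-1)%R q^-1%R.
    exact/derivable1_diffP.
  exact.
- move=> x; rewrite in_itv/= andbT => qx.
  by rewrite derive1E; have [_ ->] := dF x (ltW qx).
Qed.

(** Inversion of the positive half line, continued by the identity so that the substitution covers
    all of R, as [change_of_variable1] requires; [cov1_inv] discards the negative part. *)
Let cinv (x : R) : R := if (0 < x)%R then x^-1%R else x.
Let jinv (x : R) : R := if (0 < x)%R then (x ^- 2)%R else 1%R.

Let mgt0 : measurable_fun setT (fun x : R => (0 < x)%R).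
Proof. exact: measurable_fun_ltr. Qed.

(** The inverse is discontinuous at 0, but x^-1 = x |x|^(-2) holds there too, both sides being 0,
    and real powers are measurable. *)
Lemma measurable_fun_inv : measurable_fun setT (@GRing.inv R).
Proof.
have -> : @GRing.inv R = fun x : R => (x * `|x| `^ (- 2%:R))%R.
  apply/funext => x; rewrite powRN powR_mulrn//.
  have [->|x0] := eqVneq x 0%R; first by rewrite invr0 mul0r.
  by rewrite real_normK ?num_real// expr2 invfM mulrA divff// mul1r.
apply: measurable_funM => //.
exact: (measurableT_comp (measurable_powR _)).
Qed.

Let jinv_ge0 x : (0 <= jinv x)%R.
Proof. by rewrite /jinv; case: ifPn => // /ltW x0; rewrite invr_ge0 exprn_ge0. Qed.
Hint Resolve jinv_ge0 : core.

Let mcinv : measurable_fun setT cinv.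
Proof. by apply: measurable_fun_ifT => //; exact: measurable_fun_inv. Qed.

Let mjinv : measurable_fun setT jinv.
Proof.
apply: measurable_fun_ifT => //.
apply: (measurableT_comp measurable_fun_inv); exact: exprn_measurable.
Qed.

(** Additivity reduces an interval to its part left of 0, where [cinv] is the identity, and to
    differences of intervals ]0, q]. *)
Let cov1_cinv (G : R -> \bar R) : measurable_fun setT G -> (forall x, 0 <= G x) ->
  \int[mu]_x (G (cinv x) * (jinv x)%:E) = \int[mu]_x G x.
Proof.
apply: change_of_variable1 => //.
pose I (A : set R) := \int[mu]_x ((\1_A (cinv x))%:E * (jinv x)%:E).
have I0 A : 0 <= I A.
  apply: integral_ge0 => x _; rewrite -EFinM lee_fin mulr_ge0//.
have IU A B : measurable A -> measurable B -> A `&` B = set0 -> I (A `|` B) = I A + I B.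
  move=> mA mB AB; rewrite /I -ge0_integralD//.
  - apply: eq_integral => x _; rewrite -muleDl// ?ge0_adde_def ?inE//.
    rewrite -EFinD !indicE in_setU; case: (boolP (cinv x \in A)) => //= xA; last by rewrite add0r.
    rewrite memNset ?addr0// => xB.
    have : (A `&` B) (cinv x) by split => //; exact: set_mem xA.
    by rewrite AB.
  - by move=> x _; rewrite -EFinM lee_fin mulr_ge0//.
  - apply/measurable_EFinP; apply: measurable_funM => //.
    exact: (measurableT_comp (measurable_indic _)).
  - by move=> x _; rewrite -EFinM lee_fin mulr_ge0//.
  - apply/measurable_EFinP; apply: measurable_funM => //.
    exact: (measurableT_comp (measurable_indic _)).
have Ineg p q : (p < q)%R -> (q <= 0)%R -> I `]p, q]%classic = (q - p)%:E.
  move=> pq q0; transitivity (\int[mu]_x (\1_(`]p, q]%classic) x)%:E).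
    apply: eq_integral => x _; rewrite /cinv /jinv; case: ifPn => x0; last by rewrite mule1.
    rewrite !indicE !memNset ?mul0e//= in_itv/= => /andP[_].
      by rewrite leNgt (le_lt_trans q0).
    by rewrite leNgt (le_lt_trans q0)// invr_gt0.
  transitivity (mu `]p, q]%classic); first by rewrite integral_indic// setIT.
  by rewrite lebesgue_measure_itv/= lte_fin pq -EFinB.
have Ipos q : (0 < q)%R -> I `]0%R, q]%classic = q%:E.
  move=> q0; rewrite -[RHS]integral_inv_sqr// [RHS]integral_mkcond.
  apply: eq_integral => x _; rewrite /patch /cinv /jinv indicE; case: ifPn => x0.
    rewrite mem_setE in_itv/= invr_gt0 x0/= mem_setE in_itv/= andbT.
    have -> : (x^-1 <= q)%R = (q^-1 <= x)%R.
      by rewrite -[in RHS](invrK x) lef_pV2 ?posrE ?invr_gt0.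
    by case: ifPn; rewrite ?mul1e ?mul0e.
  rewrite mem_setE in_itv/= (negbTE x0)/= mul0e mem_setE in_itv/= andbT.
  case: ifPn => // qx; exfalso; move/negP: x0; apply; rewrite (lt_le_trans _ qx)// invr_gt0//.
move=> p q pq; rewrite -/(I _).
have [q0|q0] := leP q 0%R; first exact: Ineg.
have [p0|p0] := ltP p 0%R.
  have p0' := ltW p0; have q0' := ltW q0.
  rewrite (@itv_bndbnd_setU _ _ _ (BRight 0%R)) ?bnd_simp//.
  rewrite IU//; last first.
    apply/seteqP; split => x //= []; rewrite !in_itv/= => /andP[_ x0] /andP[].
    by rewrite ltNge x0.
  by rewrite Ineg// Ipos// -EFinD sub0r addrC.
move: p0; rewrite le_eqVlt => /predU1P[<-|p0]; first by rewrite Ipos// subr0.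
have : I `]0%R, q]%classic = I `]0%R, p]%classic + I `]p, q]%classic.
  rewrite -IU//; last first.
    apply/seteqP; split => x //= []; rewrite !in_itv/= => /andP[_ x0] /andP[].
    by rewrite ltNge x0.
  by congr I; apply: itv_bndbnd_setU; rewrite bnd_simp// ltW.
rewrite !Ipos// EFinB => ->; rewrite addeAC subee ?add0e//.
Qed.

Lemma cov1_inv (G : R -> \bar R) : measurable_fun setT G -> (forall x, 0 <= G x) ->
  \int[mu]_u (G u^-1%R * (if (0 < u)%R then u ^- 2 else 0)%:E) =
  \int[mu]_(x in `]0%R, +oo[) G x.
Proof.
move=> mG G0; rewrite [RHS]integral_mkcond -[RHS]cov1_cinv//; last 2 first.
- exact: measurable_patch.
- by move=> x; apply: erestrict_ge0.
apply: eq_integral => x _; rewrite /patch /cinv /jinv mem_setE in_itv/= andbT.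
by case: ifPn => x0; rewrite ?invr_gt0 ?x0// (negbTE x0) mule0 mul0e.
Qed.

End OneDim.

(** * Measurability of complex-valued functions *)

Section ComplexMeasurable.
Context {R : realType} d (T : measurableType d).
Local Notation C := R[i].
Implicit Types F G : T -> C.

Definition cmeas F := measurable_fun setT (fun x => complex.Re (F x)) /\
  measurable_fun setT (fun x => complex.Im (F x)).

Lemma cmeas_cst (c : C) : cmeas (fun=> c).
Proof. by split. Qed.

Lemma cmeas_real (f : T -> R) : measurable_fun setT f -> cmeas (fun x => (f x)%:C).
Proof. by move=> mf; split. Qed.

Lemma cmeasD F G : cmeas F -> cmeas G -> cmeas (fun x => F x + G x).
Proof.
move=> [F1 F2] [G1 G2]; split.
  rewrite [X in measurable_fun _ X](_ : _ = fun x => complex.Re (F x) + complex.Re (G x)).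
    exact: measurable_funD.
  by apply/funext => x; rewrite cReD.
rewrite [X in measurable_fun _ X](_ : _ = fun x => complex.Im (F x) + complex.Im (G x)).
  exact: measurable_funD.
by apply/funext => x; rewrite cImD.
Qed.

Lemma cmeasM F G : cmeas F -> cmeas G -> cmeas (fun x => F x * G x).
Proof.
move=> [F1 F2] [G1 G2]; split.
  rewrite [X in measurable_fun _ X](_ : _ = fun x =>
    complex.Re (F x) * complex.Re (G x) - complex.Im (F x) * complex.Im (G x)).
    by apply: measurable_funB; exact: measurable_funM.
  by apply/funext => x; rewrite cReM.
rewrite [X in measurable_fun _ X](_ : _ = fun x =>
    complex.Re (F x) * complex.Im (G x) + complex.Im (F x) * complex.Re (G x)).
  by apply: measurable_funD; exact: measurable_funM.
by apply/funext => x; rewrite cImM.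
Qed.

Lemma cmeasJ F : cmeas F -> cmeas (fun x => (F x)^*%C).
Proof.
move=> [F1 F2]; split.
  rewrite [X in measurable_fun _ X](_ : _ = fun x => complex.Re (F x))//.
  by apply/funext => x; case: (F x).
rewrite [X in measurable_fun _ X](_ : _ = fun x => - complex.Im (F x)).
  exact: measurableT_comp.
by apply/funext => x; case: (F x).
Qed.

Lemma cmeasN F : cmeas F -> cmeas (fun x => - F x).
Proof.
move=> mF; have := cmeasM (cmeas_cst (- 1)) mF.
by congr cmeas; apply/funext => x; rewrite mulN1r.
Qed.

Lemma cmeasV F : cmeas F -> cmeas (fun x => (F x)^-1).
Proof.
move=> [F1 F2].
have mn : measurable_fun setT (fun x => (complex.Re (F x) ^+ 2 + complex.Im (F x) ^+ 2)^-1).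
  apply: (measurableT_comp measurable_fun_inv).
  by apply: measurable_funD; exact: measurable_funX.
split.
  rewrite [X in measurable_fun _ X](_ : _ = fun x =>
    complex.Re (F x) * (complex.Re (F x) ^+ 2 + complex.Im (F x) ^+ 2)^-1).
    exact: measurable_funM.
  by apply/funext => x; case: (F x).
rewrite [X in measurable_fun _ X](_ : _ = fun x =>
    - (complex.Im (F x) * (complex.Re (F x) ^+ 2 + complex.Im (F x) ^+ 2)^-1)).
  by apply: measurableT_comp => //; exact: measurable_funM.
by apply/funext => x; case: (F x).
Qed.

Lemma cmeasX F n : cmeas F -> cmeas (fun x => F x ^+ n).
Proof.
move=> mF; elim: n => [|n IH]; first exact: cmeas_cst.
by have := cmeasM mF IH; congr cmeas; apply/funext => x; rewrite exprS.
Qed.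

Lemma measurable_modulus F : cmeas F -> measurable_fun setT (fun x => modulus (F x)).
Proof.
move=> [F1 F2].
rewrite [X in measurable_fun _ X](_ : _ = fun x =>
   (complex.Re (F x) ^+ 2 + complex.Im (F x) ^+ 2) `^ (2^-1)).
  apply: (measurableT_comp (measurable_powR _)).
  by apply: measurable_funD; exact: measurable_funX.
apply/funext => x; rewrite powR12_sqrt ?addr_ge0 ?sqr_ge0//.
by case: (F x).
Qed.

End ComplexMeasurable.

Lemma cmeas_comp {R : realType} d1 d2 (T1 : measurableType d1) (T2 : measurableType d2)
  (F : T2 -> R[i]) (g : T1 -> T2) :
  cmeas F -> measurable_fun setT g -> cmeas (fun x => F (g x)).
Proof. by move=> [F1 F2] mg; split; [exact: (measurableT_comp F1 mg)|exact: (measurableT_comp F2 mg)]. Qed.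

(** * A calculus of substitutions in the plane *)

Section PlaneChangeOfVariables.
Context {R : realType}.
Local Notation C := R[i].
Local Notation mu := (@lebesgue_measure R).
Local Notation T2 := (measurableTypeR R * measurableTypeR R)%type.
Local Notation H := (@half_plane R).

Definition cplx (p : R * R) : C := p.1 +i* p.2.
Definition pl (z : C) : R * R := (complex.Re z, complex.Im z).

Lemma plK : cancel pl cplx. Proof. by case. Qed.
Lemma cplxK : cancel cplx pl. Proof. by case. Qed.

Lemma cmeas_cplx : @cmeas R _ T2 cplx.
Proof. by split; [exact: measurable_fst|exact: measurable_snd]. Qed.

Lemma measurable_pl d (T : measurableType d) (F : T -> C) : cmeas F ->
  measurable_fun setT ((fun x => pl (F x)) : T -> T2).
Proof. by move=> [F1 F2]; exact: measurable_fun_pair. Qed.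

Lemma measurable_half_plane : measurable (H : set T2).
Proof.
rewrite (_ : H = (fun p : T2 => 0 < p.1) @^-1` [set true]).
  rewrite -[X in measurable X]setTI.
  suff : measurable_fun setT (fun p : T2 => 0 < p.1) by apply.
  apply: measurable_fun_ltr => //; exact: measurable_fst.
by apply/seteqP; split.
Qed.

Local Open Scope ereal_scope.

(* J vanishes where T is not a substitution, so that T is arbitrary there. *)
Definition cov (T : T2 -> T2) (J : T2 -> R) (S : set T2) :=
  [/\ measurable_fun setT T, measurable_fun setT J, (forall p, (0 <= J p)%R),
      measurable S &
      forall G : T2 -> \bar R, measurable_fun setT G -> (forall p, 0 <= G p) ->
      \int[area]_p (G (T p) * (J p)%:E) = \int[area]_(p in S) G p].

(** The first substitution reaches only Sa; the second would lose mass if its weight did not vanish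
    off Sa. *)
Lemma cov_comp Ta Ja Sa Tb Jb Sb : cov Ta Ja Sa -> cov Tb Jb Sb ->
  (forall p, ~ Sa p -> Jb p = 0%R) ->
  cov (fun p => Tb (Ta p)) (fun p => Jb (Ta p) * Ja p)%R Sb.
Proof.
move=> [a1 a2 a3 a4 a5] [b1 b2 b3 b4 b5] ab; split => //.
- exact: measurableT_comp.
- by apply: measurable_funM => //; exact: measurableT_comp.
- by move=> p; rewrite mulr_ge0.
move=> G mG G0; rewrite -b5//.
under eq_integral do rewrite EFinM muleA.
rewrite (a5 (fun p => G (Tb p) * (Jb p)%:E)).
- rewrite integral_mkcond; apply: eq_integral => p _; rewrite /patch.
  by case: ifPn => // /negP; rewrite inE => /ab ->; rewrite mule0.
- apply: emeasurable_funM; first exact: (measurableT_comp mG).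
  exact/measurable_EFinP.
- by move=> p; rewrite mule_ge0// lee_fin.
Qed.

(** Cuts a substitution down to U by making its weight vanish elsewhere; in [cov_mobius] this
    follows the half plane through a chain of maps. *)
Lemma cov_restrict T J S (U V : set T2) : cov T J S -> measurable U -> measurable V ->
  (forall p, J p != 0%R -> V (T p) <-> U p) ->
  cov T (fun p => if p \in U then J p else 0%R) (S `&` V).
Proof.
move=> [a1 a2 a3 a4 a5] mU mV UV; split => //.
- rewrite [X in measurable_fun _ X](_ : _ = J \_ U)%R.
    by apply: (measurable_restrictT _ mU).1; exact: measurable_funTS.
  by apply/funext => p; rewrite /patch.
- by move=> p; case: ifPn.
- exact: measurableI.
move=> G mG G0.
transitivity (\int[area]_(p in S) (G \_ V) p); last first.
  rewrite integral_mkcond [RHS]integral_mkcond; apply: eq_integral => p _.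
  by rewrite /patch in_setI; case: (p \in S).
rewrite -a5//; last by move=> p; apply: erestrict_ge0.
  apply: eq_integral => p _; rewrite /patch.
  have [->|J0] := eqVneq (J p) 0%R; first by rewrite if_same !mule0.
  have -> : (p \in U) = (T p \in V) by apply/idP/idP; rewrite !inE => /(UV p J0).
  by case: ifPn; rewrite ?mule0 ?mul0e.
exact: measurable_patch.
Qed.

Lemma cov_ext T J S T' J' S' : cov T J S -> measurable_fun setT T' ->
  (forall p, J p = J' p) -> (forall p, J p != 0%R -> T p = T' p) -> S = S' ->
  cov T' J' S'.
Proof.
move=> [a1 a2 a3 a4 a5] mT' JJ TT <-; have <- : J = J' by exact/funext.
split => // G mG G0; rewrite -a5//; apply: eq_integral => p _.
have [->|J0] := eqVneq (J p) 0%R; first by rewrite !mule0.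
by rewrite TT.
Qed.

(** By Tonelli, a family of one-dimensional substitutions along the slices is a plane one. The plane
    maps below are composed from such shears. *)
Lemma cov_slice_y (tau j : T2 -> R) (S1 : set (measurableTypeR R)) : measurable S1 ->
  measurable_fun setT tau -> measurable_fun setT j -> (forall p, (0 <= j p)%R) ->
  (forall x, ~ S1 x -> forall y, j (x, y) = 0%R) ->
  (forall x, S1 x -> forall G : R -> \bar R, measurable_fun setT G -> (forall x, 0 <= G x) ->
    \int[mu]_y (G (tau (x, y)) * (j (x, y))%:E) = \int[mu]_y G y) ->
  cov (fun p => (p.1, tau p)) j (S1 `*` setT).
Proof.
move=> mS1 mt mj j0 jS1 jc; split => //.
- by apply: measurable_fun_pair => //; exact: measurable_fst.
- exact: measurableX.
move=> G mG G0; rewrite [RHS]integral_mkcond.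
have mS : measurable (S1 `*` [set: measurableTypeR R]) by exact: measurableX.
rewrite /area/= (@fubini_tonelli1 _ _ _ _ _ mu mu)/=; last 2 first.
- apply: emeasurable_funM; last exact/measurable_EFinP.
  apply: (measurableT_comp mG).
  by apply: measurable_fun_pair => //; exact: measurable_fst.
- by move=> p; rewrite mule_ge0// lee_fin.
rewrite [RHS](@fubini_tonelli1 _ _ _ _ _ mu mu)/=; last 2 first.
- exact: measurable_patch.
- by move=> p; apply: erestrict_ge0.
apply: eq_integral => x _; rewrite /fubini_F.
have [S1x|S1x] := pselect (S1 x).
  rewrite /= (jc x S1x (fun y => G (x, y)))//; last exact: measurable_fun_pair2.
  apply: eq_integral => y _; rewrite /patch mem_set//.
transitivity (\int[mu]_(y in setT) (cst 0%E y)).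
  by apply: eq_integral => y _; rewrite /= jS1// mule0.
by apply: eq_integral => y _; rewrite /patch memNset// => -[].
Qed.

Lemma cov_slice_x (tau j : T2 -> R) (S1 : set (measurableTypeR R)) : measurable S1 ->
  measurable_fun setT tau -> measurable_fun setT j -> (forall p, (0 <= j p)%R) ->
  (forall y, forall G : R -> \bar R, measurable_fun setT G -> (forall x, 0 <= G x) ->
    \int[mu]_x (G (tau (x, y)) * (j (x, y))%:E) = \int[mu]_(x in S1) G x) ->
  cov (fun p => (tau p, p.2)) j (S1 `*` setT).
Proof.
move=> mS1 mt mj j0 jc; split => //.
- by apply: measurable_fun_pair => //; exact: measurable_snd.
- exact: measurableX.
move=> G mG G0; rewrite [RHS]integral_mkcond.
have mS : measurable (S1 `*` [set: measurableTypeR R]) by exact: measurableX.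
rewrite /area/= (@fubini_tonelli2 _ _ _ _ _ mu mu)/=; last 2 first.
- apply: emeasurable_funM; last exact/measurable_EFinP.
  apply: (measurableT_comp mG).
  by apply: measurable_fun_pair => //; exact: measurable_snd.
- by move=> p; rewrite mule_ge0// lee_fin.
rewrite [RHS](@fubini_tonelli2 _ _ _ _ _ mu mu)/=; last 2 first.
- exact: measurable_patch.
- by move=> p; apply: erestrict_ge0.
apply: eq_integral => y _; rewrite /fubini_G.
rewrite /= (jc y (fun x => G (x, y)))//; last exact: measurable_fun_pair1.
rewrite integral_mkcond; apply: eq_integral => x _; rewrite /patch.
have [S1x|S1x] := pselect (S1 x); first by rewrite !mem_set.
by rewrite !memNset// => -[].
Qed.

(** Positive and negative parts are transported separately, so no integrability is assumed. *)
Lemma cov_int T J S (F : T2 -> R) : cov T J S -> measurable_fun setT F ->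
  \int[area]_p (F (T p) * J p)%:E = \int[area]_(p in S) (F p)%:E.
Proof.
move=> [a1 a2 a3 a4 a5] mF.
rewrite [LHS]integralE [RHS]integralE; congr (_ - _).
  rewrite -a5//; last by apply: measurable_funepos; exact/measurable_EFinP.
  apply: eq_integral => p _; rewrite !funeposE -!EFin_max -EFinM.
  by rewrite maxr_pMl// mul0r.
rewrite -a5//; last by apply: measurable_funeneg; exact/measurable_EFinP.
apply: eq_integral => p _; rewrite !funenegE -!EFinN -!EFin_max -EFinM.
by rewrite maxr_pMl// mul0r mulNr.
Qed.

Lemma cov_integrable T J S (F : T2 -> R) : cov T J S -> measurable_fun setT F ->
  area.-integrable setT (fun p => (F (T p) * J p)%:E) <->
  area.-integrable S (fun p => (F p)%:E).
Proof.
move=> [a1 a2 a3 a4 a5] mF.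
have H : \int[area]_p `|(F (T p) * J p)%:E| = \int[area]_(p in S) `|(F p)%:E|.
  rewrite -a5//; last by do 2 apply: measurableT_comp => //.
  by apply: eq_integral => p _; rewrite /= normrM (ger0_norm (a3 p)).
split => /integrableP[m1 m2]; apply/integrableP; split.
- by apply: measurable_funTS; exact/measurable_EFinP.
- by rewrite -H.
- apply/measurable_EFinP; apply: measurable_funM => //.
  exact: (measurableT_comp mF).
- by rewrite H.
Qed.

End PlaneChangeOfVariables.

(** * Affine maps, inversion and linear fractional maps *)

Section PlaneMaps.
Context {R : realType}.
Local Notation C := R[i].
Local Notation mu := (@lebesgue_measure R).
Local Notation T2 := (measurableTypeR R * measurableTypeR R)%type.
Local Notation H := (@half_plane R).
Implicit Types (A B : C).

Let mfst : measurable_fun setT (fst : T2 -> measurableTypeR R).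
Proof. exact: measurable_fst. Qed.
Let msnd : measurable_fun setT (snd : T2 -> measurableTypeR R).
Proof. exact: measurable_snd. Qed.

Lemma cov_affine_x (a b e : R) : a != 0 ->
  cov (fun p : T2 => (a * p.1 + b * p.2 + e, p.2)) (fun=> `|a|) setT.
Proof.
move=> a0.
have mt : measurable_fun setT (fun p : T2 => a * p.1 + b * p.2 + e).
  apply: measurable_funD => //; apply: measurable_funD; exact: measurable_funM.
apply: (cov_ext (cov_slice_x (tau := fun p => a * p.1 + b * p.2 + e)
  (S1 := setT) measurableT mt (j := fun=> `|a|) _ _ _)) => //.
- move=> y G mG G0; rewrite -(@cov1_affine _ a (b * y + e) a0 G)//.
  by apply: eq_integral => x _; rewrite /= addrA.
- exact: measurable_fun_pair.
- by rewrite setXTT.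
Qed.

Lemma cov_affine_y (a b e : R) : a != 0 ->
  cov (fun p : T2 => (p.1, a * p.2 + b * p.1 + e)) (fun=> `|a|) setT.
Proof.
move=> a0.
have mt : measurable_fun setT (fun p : T2 => a * p.2 + b * p.1 + e).
  apply: measurable_funD => //; apply: measurable_funD; exact: measurable_funM.
apply: (cov_ext (cov_slice_y (tau := fun p => a * p.2 + b * p.1 + e)
  (S1 := setT) measurableT mt (j := fun=> `|a|) _ _ _ _)) => //.
- by move=> x [].
- move=> x _ G mG G0; rewrite -(@cov1_affine _ a (b * x + e) a0 G)//.
  by apply: eq_integral => y _; rewrite /= addrA.
- exact: measurable_fun_pair.
- by rewrite setXTT.
Qed.

Lemma measurable_affine A B : measurable_fun setT (fun p : T2 => pl (A * cplx p + B) : T2).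
Proof.
apply: measurable_pl; apply: cmeasD; last exact: cmeas_cst.
by apply: cmeasM; [exact: cmeas_cst|exact: cmeas_cplx].
Qed.

(** If Re A != 0, multiplication by A factors into a horizontal and a vertical shear, with
    determinants Re A and |A|^2 / Re A; B goes into their translations. *)
Let cov_affine0 A B : complex.Re A != 0 ->
  cov (fun p : T2 => pl (A * cplx p + B)) (fun=> modulus A ^+ 2) setT.
Proof.
case: A B => a b [e d] /= a0.
have n0 : a ^+ 2 + b ^+ 2 != 0.
  by rewrite gt_eqF// ltr_wpDr ?sqr_ge0// exprn_even_gt0.
have n1 : (a ^+ 2 + b ^+ 2) / a != 0 by rewrite mulf_neq0 ?invr_eq0.
apply: (cov_ext (cov_comp (cov_affine_x (- b) e a0)
  (cov_affine_y (b / a) (d - b / a * e) n1) _)) => //.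
- by move=> p [].
- exact: measurable_affine.
- move=> p; rewrite -normrM divfK// sqr_modulus/=.
  by rewrite ger0_norm// addr_ge0 ?sqr_ge0.
- move=> p _; rewrite /pl /cplx/=; congr (_, _); first by ring.
  by field.
Qed.

Lemma cov_affine A B : A != 0 ->
  cov (fun p : T2 => pl (A * cplx p + B)) (fun=> modulus A ^+ 2) setT.
Proof.
move=> A0; have [ReA|] := eqVneq (complex.Re A) 0; last exact: cov_affine0.
(* When Re A = 0, both D = 1 + i and A / D have a nonzero real part, and A is their product. *)
pose D : C := 1 +i* 1.
have D0 : D != 0 by rewrite eq_complex/= oner_eq0.
have iD : complex.Re (A / D) != 0.
  move: A0 ReA; case: A => a b; rewrite eq_complex/= => /nandP[|] h a0.
    by rewrite a0 eqxx in h.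
  by rewrite a0 mul0r sub0r expr1n mulrN opprK mulf_neq0.
apply: (cov_ext (cov_comp (cov_affine0 (A := D) 0 _) (cov_affine0 B iD) _)) => //.
- by rewrite /D/= oner_eq0.
- by move=> p [].
- exact: measurable_affine.
- by move=> p; rewrite -exprMn -modulusM divfK.
- by move=> p _; rewrite plK addr0 mulrA divfK.
Qed.

Lemma measurable_gt0_fst : measurable_fun setT (fun p : T2 => 0 < p.1).
Proof. exact: measurable_fun_ltr. Qed.

(** With the slope t = y / x, inversion becomes x -> 1 / (x (1 + t^2)) and t -> - t, so that each
    step moves a single coordinate. *)
Lemma cov_inversion : cov (fun p : T2 => pl (cplx p)^-1)
  (fun p => if 0 < p.1 then (modulus (cplx p) ^+ 4)^-1 else 0) H.
Proof.
have mV := @measurable_fun_inv R.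
have mif (f : T2 -> R) : measurable_fun setT f ->
    measurable_fun setT (fun p : T2 => if 0 < p.1 then f p else 0).
  by move=> mf; apply: measurable_fun_ifT => //; exact: measurable_gt0_fst.
have HE : H = (`]0, +oo[%classic `*` setT) :> set T2.
  apply/seteqP; split => p; rewrite /half_plane/=.
    by move=> p0; split => //; rewrite in_itv/= p0.
  by move=> []; rewrite in_itv/= andbT.
have c1 : cov (fun p : T2 => (p.1, p.2 / p.1)) (fun p => if 0 < p.1 then p.1^-1 else 0) H.
  rewrite HE; apply: cov_slice_y => //.
  - by apply: measurable_funM => //; exact: (measurableT_comp mV).
  - by apply: mif; exact: (measurableT_comp mV).
  - by move=> p; case: ifPn => // /ltW; rewrite invr_ge0.
  - by move=> x/=; rewrite in_itv/= andbT => /negP/negbTE ->.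
  - move=> x /=; rewrite in_itv/= andbT => x0 G mG G0.
    have xV : x^-1 != 0 by rewrite invr_eq0 gt_eqF.
    rewrite -(@cov1_affine _ _ 0 xV G)//; apply: eq_integral => y _.
    by rewrite x0 addr0 mulrC gtr0_norm ?invr_gt0// [x^-1 * y]mulrC.
have ct (t : R) : 0 < 1 + t ^+ 2 by rewrite ltr_pwDl// sqr_ge0.
have c2 : cov (fun p : T2 => ((p.1 * (1 + p.2 ^+ 2))^-1, p.2))
    (fun p => if 0 < p.1 then (p.1 ^+ 2 * (1 + p.2 ^+ 2))^-1 else 0) H.
  rewrite HE; apply: cov_slice_x => //.
  - apply: (measurableT_comp mV); apply: measurable_funM => //.
    by apply: measurable_funD => //; exact: measurable_funX.
  - apply: mif; apply: (measurableT_comp mV); apply: measurable_funM => //.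
      exact: measurable_funX.
    by apply: measurable_funD => //; exact: measurable_funX.
  - by move=> p; case: ifPn => // /ltW ?; rewrite invr_ge0 mulr_ge0 ?sqr_ge0// ltW.
  - move=> t G mG G0; set c := 1 + t ^+ 2; have c0 : 0 < c := ct t.
    have cV : c^-1 != 0 by rewrite invr_eq0 gt_eqF.
    have mcG : measurable_fun setT (fun v : R => (G (c^-1 * v)%R * (c^-1)%:E)%E).
      apply: emeasurable_funM => //; apply: (measurableT_comp mG).
      exact: measurable_funM.
    transitivity (\int[mu]_(v in `]0%R, +oo[) (G (c^-1 * v)%R * (c^-1)%:E))%E.
      rewrite -cov1_inv//; last by move=> v; rewrite mule_ge0// lee_fin invr_ge0 ltW.
      apply: eq_integral => x _; rewrite /= -/c -muleA -EFinM invfM [c^-1 * _]mulrC.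
      congr (_ * _%:E)%E; case: ifPn => _; last by rewrite mulr0.
      by rewrite invfM mulrC.
    rewrite [RHS]integral_mkcond -[RHS](@cov1_affine _ _ 0 cV)//; last 2 first.
    - exact: measurable_patch.
    - by move=> x; apply: erestrict_ge0.
    rewrite integral_mkcond; apply: eq_integral => v _; rewrite /patch addr0.
    rewrite gtr0_norm ?invr_gt0// !mem_setE !in_itv/= !andbT pmulr_rgt0 ?invr_gt0//.
    by case: ifPn => // _; rewrite mul0e.
have c3 : cov (fun p : T2 => (p.1, - p.1 * p.2)) (fun p => if 0 < p.1 then p.1 else 0) H.
  rewrite HE; apply: cov_slice_y => //.
  - by apply: measurable_funM => //; exact: measurableT_comp.
  - exact: mif.
  - by move=> p; case: ifPn => // /ltW.
  - by move=> x/=; rewrite in_itv/= andbT => /negP/negbTE ->.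
  - move=> x /=; rewrite in_itv/= andbT => x0 G mG G0.
    have xN : - x != 0 by rewrite oppr_eq0 gt_eqF.
    rewrite -(@cov1_affine _ _ 0 xN G)//; apply: eq_integral => y _.
    by rewrite x0 addr0 normrN gtr0_norm.
apply: (cov_ext (cov_comp (cov_comp c1 c2 _) c3 _)) => //.
- by move=> p /negP; rewrite /half_plane/= => /negbTE ->.
- by move=> p /negP; rewrite /half_plane/= => /negbTE ->.
- by apply: measurable_pl; apply: cmeasV; exact: cmeas_cplx.
- case=> x y /=; have [x0|x0] := ltP 0 x; last by rewrite !mulr0.
  rewrite invr_gt0 mulr_gt0// -[4%N]/(2 * 2)%N exprM sqr_modulus/=.
  have n0 : x ^+ 2 + y ^+ 2 != 0 by rewrite gt_eqF// ltr_wpDr ?sqr_ge0// exprn_gt0.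
  by field; rewrite n0 gt_eqF.
- case=> x y /=; have [x0|x0] := ltP 0 x; last by rewrite !mulr0 eqxx.
  move=> _; rewrite /pl/=.
  have n0 : x ^+ 2 + y ^+ 2 != 0 by rewrite gt_eqF// ltr_wpDr ?sqr_ge0// exprn_gt0.
  by congr (_, _); field; rewrite n0 gt_eqF.
Qed.

Lemma Re_inv_gt0 (z : C) : (0 < complex.Re z^-1) = (0 < complex.Re z).
Proof.
case: z => x y /=; have [->|x0] := eqVneq x 0; first by rewrite mul0r.
have n0 : 0 < x ^+ 2 + y ^+ 2 by rewrite ltr_wpDr ?sqr_ge0// exprn_even_gt0.
by rewrite pmulr_lgt0 ?invr_gt0.
Qed.

Lemma measurable_Re_gt (r : R) (F : T2 -> C) : cmeas F ->
  measurable [set p | r < complex.Re (F p)].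
Proof.
move=> [F1 F2]; rewrite (_ : [set p | _] = (fun p => r < complex.Re (F p)) @^-1` [set true]).
  rewrite -[X in measurable X]setTI.
  suff : measurable_fun setT (fun p => r < complex.Re (F p)) by apply.
  exact: measurable_fun_ltr.
by apply/seteqP; split.
Qed.

(** The composite of a translation by [kappa], inversion and an affine map. Since Re kappa >= 0, the
    translate of the half plane stays where [cov_inversion] applies. The image is described through
    (q - delta) / A = 1 / (z + kappa). *)
Theorem cov_mobius (A kappa delta : C) : A != 0 -> 0 <= complex.Re kappa ->
  cov (fun p : T2 => pl (delta + A / (cplx p + kappa)))
    (fun p => if 0 < p.1 then modulus A ^+ 2 / modulus (cplx p + kappa) ^+ 4 else 0)
    [set q | 0 < complex.Re ((cplx q - delta) / A) /\
             complex.Re kappa < complex.Re (A / (cplx q - delta))].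
Proof.
move=> A0 k0.
have one0 : (1 : C) != 0 by rewrite oner_eq0.
have Hm := @measurable_half_plane R.
pose V1 : set T2 := [set q | complex.Re kappa < complex.Re (cplx q)].
have mV1 : measurable V1 by apply: measurable_Re_gt; exact: cmeas_cplx.
have e1 p : V1 (pl (1 * cplx p + kappa)) <-> H p.
  by rewrite /V1 /mkset plK mul1r cReD/= ltrDr.
have c1 := cov_restrict (cov_affine kappa one0) Hm mV1 (fun p _ => e1 p).
pose V2 : set T2 := [set q | complex.Re kappa < complex.Re (cplx q)^-1].
have mV2 : measurable V2 by apply: measurable_Re_gt; apply: cmeasV; exact: cmeas_cplx.
have e2 p : V2 (pl (cplx p)^-1) <-> V1 p by rewrite /V2 /V1 /mkset plK invrK.
have c2 := cov_restrict cov_inversion mV1 mV2 (fun p _ => e2 p).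
pose S2 : set T2 := H `&` V2.
have mS2 : measurable S2 by exact: measurableI.
pose V3 : set T2 := [set q | 0 < complex.Re ((cplx q - delta) / A)] `&`
   [set q | complex.Re kappa < complex.Re (A / (cplx q - delta))].
have mB : cmeas (fun q : T2 => cplx q - delta).
  by apply: cmeasD; [exact: cmeas_cplx|exact: cmeas_cst].
have mV3 : measurable V3.
  apply: measurableI; apply: measurable_Re_gt.
    by apply: cmeasM => //; exact: cmeas_cst.
  by apply: cmeasM; [exact: cmeas_cst|exact: cmeasV].
have e3 p : V3 (pl (A * cplx p + delta)) <-> S2 p.
  rewrite /V3 /S2 /V2 /half_plane /setI /mkset plK addrK mulrAC divff// mul1r.
  by rewrite invfM mulrA divff// mul1r.
have c3 := cov_restrict (cov_affine delta A0) mS2 mV3 (fun p _ => e3 p).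
apply: (cov_ext (cov_comp (cov_comp c1 c2 _) c3 _)) => //.
- by move=> p nV1; rewrite memNset// => V1p; apply: nV1; split.
- by move=> p nS2; rewrite memNset// .
- apply: measurable_pl; apply: cmeasD; first exact: cmeas_cst.
  apply: cmeasM; first exact: cmeas_cst.
  by apply: cmeasV; apply: cmeasD; [exact: cmeas_cplx|exact: cmeas_cst].
- move=> p.
  have -> : (p \in H) = (0 < p.1) by apply/idP/idP; rewrite inE.
  have [p0|p0] := ltP 0 p.1; last by rewrite !mulr0.
  have v1 : V1 (pl (1 * cplx p + kappa)) by apply/e1.
  have v2 : S2 (pl (cplx (pl (1 * cplx p + kappa)))^-1).
    split; last exact/e2.
    change (0 < complex.Re (cplx (pl (1 * cplx p + kappa)))^-1).
    by rewrite Re_inv_gt0 plK mul1r cReD ltr_wpDr.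
  have r : 0 < (pl (1 * cplx p + kappa)).1.
    by change (0 < complex.Re (1 * cplx p + kappa)); rewrite mul1r cReD ltr_wpDr.
  by rewrite (mem_set v1) (mem_set v2) r plK mul1r modulus1 expr1n mulr1.
- by move=> p _; rewrite !plK mul1r addrC.
- by apply/seteqP; split => q; rewrite /V3/=; tauto.
Qed.

End PlaneMaps.

(** * The weighted Bergman space and its reproducing kernel *)

Section LocallyOpen.
Context {R : realType}.
Local Notation C := R[i].
Local Notation T2 := (measurableTypeR R * measurableTypeR R)%type.
Local Notation H := (@half_plane R).

(** U is the union of the countably many squares with rational centres and radii 1 / (n + 1) that it
    contains. *)
Lemma measurable_locally_open (U : set T2) :
  (forall p : T2, U p -> exists2 d : R, 0 < d & forall q : T2,
     `|q.1 - p.1| < d -> `|q.2 - p.2| < d -> U q) -> measurable U.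
Proof.
move=> oU.
pose sq (i : (rat * rat) * nat) : set T2 :=
  `](ratr i.1.1 - i.2.+1%:R^-1), (ratr i.1.1 + i.2.+1%:R^-1)[%classic `*`
  `](ratr i.1.2 - i.2.+1%:R^-1), (ratr i.1.2 + i.2.+1%:R^-1)[%classic.
have msq i : measurable (sq i) by exact: measurableX.
rewrite (_ : U = \bigcup_(i : (rat * rat) * nat)
   (if pselect (sq i `<=` U) then sq i else set0)).
  apply: countable_bigcupT_measurable => // i.
  by case: pselect => _ /=; [exact: msq|exact: measurable0].
apply/seteqP; split => [p Up|p [i _]]; last by case: pselect => // h /h.
have [d d0 Hd] := oU p Up.
have d20 : 0 < d / 2 by rewrite divr_gt0.
have [N _ /(_ N (leqnn N)) /= Nd] := near_infty_natSinv_lt (PosNum d20).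
set e : R := N.+1%:R^-1 in Nd.
have e0 : 0 < e by rewrite invr_gt0.
have [q1 /[!in_itv]/= /andP[a1 a2]] := @rat_in_itvoo R (p.1 - e) (p.1 + e) (ltac:(lra)).
have [q2 /[!in_itv]/= /andP[a3 a4]] := @rat_in_itvoo R (p.2 - e) (p.2 + e) (ltac:(lra)).
have sqU : sq ((q1, q2), N) `<=` U.
  move=> q []; rewrite /sq/= !in_itv/= -/e => /andP[b1 b2] /andP[b3 b4].
  by apply: Hd; rewrite ltr_norml; apply/andP; split;
    clear - Nd a1 a2 a3 a4 b1 b2 b3 b4; lra.
exists ((q1, q2), N) => //; rewrite (_ : is_left _ = true); last by case: pselect.
by split; rewrite /= in_itv/= -/e; apply/andP; split; clear - a1 a2 a3 a4; lra.
Qed.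

(** A differential gives a local Lipschitz bound, so the superlevel sets are open inside the half
    plane, and u is 0 outside. *)
Lemma measurable_half_plane_fun (u : T2 -> R) :
  (forall p, ~ H p -> u p = 0) ->
  (forall p, H p -> exists fx fy, tdiff (fun x y => u (x, y)) p.1 p.2 fx fy) ->
  measurable_fun setT u.
Proof.
move=> u0 du _; apply: (measurability _ (RGenOInfty.measurableE R)) => //.
move=> _ [_ [r ->] <-]; rewrite setTI.
rewrite -[X in measurable X]setIT -(setUv H) setIUr; apply: measurableU.
  apply: measurable_locally_open => p [/=]; rewrite in_itv/= andbT => rp Hp.
  have [fx [fy D]] := du p Hp; have [K [d [K0 d0 HK]]] := tdiff_lip D.
  (* If both coordinates move by less than e, u moves by less than 2 K e = (u p - r) / 2. *)
  pose e := (u p - r) / (4 * K).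
  have e0 : 0 < e by rewrite divr_gt0 ?subr_gt0// mulr_gt0.
  exists (Num.min (Num.min d e) p.1); first by rewrite !lt_min d0 e0.
  move=> q; rewrite !lt_min => /andP[/andP[q1 q2] q3] /andP[/andP[q4 q5] _].
  split; last first.
    by rewrite /half_plane/=; move: q3; rewrite ltr_norml => /andP[+ _]; clear; lra.
  rewrite /= in_itv/= andbT.
  have := HK _ _ q1 q4; rewrite -!surjective_pairing.
  have : K * (`|q.1 - p.1| + `|q.2 - p.2|) < K * (e + e) by rewrite ltr_pM2l// ltrD.
  have -> : K * (e + e) = (u p - r) / 2 by rewrite /e; field; rewrite gt_eqF.
  move=> h1 h2; have := le_lt_trans h2 h1; rewrite ltr_norml => /andP[+ _].
  clear - rp; lra.
have [r0|r0] := ltP r 0.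
  rewrite (_ : _ `&` _ = ~` H); first exact: measurableC measurable_half_plane.
  apply/seteqP; split => [p []//|p nH]; split => //.
  by rewrite /= in_itv/= andbT u0.
rewrite (_ : _ `&` _ = set0)//; apply/seteqP; split => // p [/= + /u0 up].
by rewrite in_itv/= andbT up ltNge r0.
Qed.

End LocallyOpen.

(** * Differentiation rules over a field *)

Section FieldDerivable.
Variable K : numFieldType.
Implicit Types f g : K^o -> K^o.

Lemma fderivable_comp f g (z : K) : derivable g z 1 -> derivable f (g z) 1 ->
  derivable (fun x => f (g x)) z 1.
Proof.
move=> /derivable1_diffP dg /derivable1_diffP df.
by apply/derivable1_diffP; exact: differentiable_comp.
Qed.

Lemma fderivable_near f g (z : K) (e : K) : 0 < e ->
  (forall x, `|x - z| < e -> f x = g x) ->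
  derivable f z 1 -> derivable g z 1.
Proof.
move=> e0 fg; apply: near_eq_derivable.
exists e => // x /=; rewrite distrC => h; exact: fg.
Qed.

Lemma fderivableD f g (z : K) : derivable f z 1 -> derivable g z 1 ->
  derivable (fun x => f x + g x : K^o) z 1.
Proof. exact: derivableD. Qed.

Lemma fderivableM f g (z : K) : derivable f z 1 -> derivable g z 1 ->
  derivable (fun x => f x * g x : K^o) z 1.
Proof. exact: derivableM. Qed.

Lemma fderivableV f (z : K) : f z != 0 -> derivable f z 1 ->
  derivable (fun x => (f x)^-1 : K^o) z 1.
Proof. exact: derivableV. Qed.

Lemma fderivable_id (z : K) : derivable (fun x : K^o => x : K^o) z 1.
Proof. exact: derivable_id. Qed.

Lemma fderivable_cst (c z : K) : derivable (fun x : K^o => c : K^o) z 1.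
Proof. exact: derivable_cst. Qed.

Lemma fderivableX f n (z : K) : derivable f z 1 ->
  derivable (fun x => f x ^+ n : K^o) z 1.
Proof.
move=> df; elim: n => [|n IH]; first exact: fderivable_cst.
rewrite (_ : (fun x => _) = fun x => f x * f x ^+ n); first exact: fderivableM.
by apply/funext => x; rewrite exprS.
Qed.
End FieldDerivable.

Section ComplexDerivable.
Context {R : realType}.
Local Notation C := R[i].
(** Complex differentiability, hiding the passage to [C^o] on which the difference quotient
    lives. *)
Definition cder (f : C -> C) (z : C) := @derivable C C^o C^o f z 1.
Implicit Types f g : C -> C.

Lemma cder_comp f g (z : C) : cder g z -> cder f (g z) -> cder (fun x => f (g x)) z.
Proof. exact: (@fderivable_comp C). Qed.

Lemma cder_near f g (z : C) (e : R) : 0 < e ->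
  (forall x, modulus (x - z) < e -> f x = g x) -> cder f z -> cder g z.
Proof.
move=> e0 fg; apply: (@fderivable_near C f g z e%:C); first by rewrite ltcR.
by move=> x; rewrite normC_modulus ltcR; exact: fg.
Qed.

Lemma cderD f g (z : C) : cder f z -> cder g z -> cder (fun x => f x + g x) z.
Proof. exact: (@fderivableD C). Qed.

Lemma cderM f g (z : C) : cder f z -> cder g z -> cder (fun x => f x * g x) z.
Proof. exact: (@fderivableM C). Qed.

Lemma cderV f (z : C) : f z != 0 -> cder f z -> cder (fun x => (f x)^-1) z.
Proof. exact: (@fderivableV C). Qed.

Lemma cder_id (z : C) : cder (fun x => x) z.
Proof. exact: (@fderivable_id C). Qed.

Lemma cder_cst (c z : C) : cder (fun x => c) z.
Proof. exact: (@fderivable_cst C). Qed.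

Lemma cderX f n (z : C) : cder f z -> cder (fun x => f x ^+ n) z.
Proof. exact: (@fderivableX C). Qed.

Lemma cder_tdiff f (z : C) : cder f z -> exists D : C,
  tdiff (fun a b => complex.Re (f (a +i* b))) (complex.Re z) (complex.Im z)
    (complex.Re D) (- complex.Im D) /\
  tdiff (fun a b => complex.Im (f (a +i* b))) (complex.Re z) (complex.Im z)
    (complex.Im D) (complex.Re D).
Proof. exact: derivable_tdiff. Qed.

Lemma cmeas_cder f : (forall z, 0 < complex.Re z -> cder f z) ->
  (forall z, complex.Re z <= 0 -> f z = 0) ->
  cmeas (fun p : (measurableTypeR R * measurableTypeR R)%type => f (cplx p)).
Proof.
move=> df f0; split; apply: measurable_half_plane_fun.
- by move=> p /negP; rewrite -leNgt => p0; rewrite f0.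
- by move=> p Hp; have [D [D1 D2]] := cder_tdiff (df (cplx p) Hp); do 2 eexists; exact: D1.
- by move=> p /negP; rewrite -leNgt => p0; rewrite f0.
- by move=> p Hp; have [D [D1 D2]] := cder_tdiff (df (cplx p) Hp); do 2 eexists; exact: D2.
Qed.

Lemma extE (h : Cplus R -> C) (z : Cplus R) : ext h (val z) = h z.
Proof. by rewrite /ext valK. Qed.

Lemma ext_out (h : Cplus R -> C) z : complex.Re z <= 0 -> ext h z = 0.
Proof. by move=> z0; rewrite /ext insubF// ltNge z0. Qed.

Lemma ext_in (h : Cplus R -> C) z (z0 : 0 < complex.Re z) :
  ext h z = h (exist _ z z0).
Proof. by rewrite -extE. Qed.

Lemma analytic_cder (h : Cplus R -> C) : analytic h ->
  forall z, 0 < complex.Re z -> cder (ext h) z.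
Proof. by move=> ah z z0; exact: (ah (exist _ z z0)). Qed.

Lemma cmeas_ext (h : Cplus R -> C) : analytic h ->
  cmeas (fun p : (measurableTypeR R * measurableTypeR R)%type => ext h (cplx p)).
Proof.
by move=> ah; apply: cmeas_cder; [exact: analytic_cder|exact: ext_out].
Qed.

(** The disc of radius Re z around z stays in the half plane, so a formula on all of C may replace
    [ext h]. *)
Lemma analytic_of_cder (h : Cplus R -> C) (f : C -> C) :
  (forall z : Cplus R, cder f (val z)) -> (forall z, f (val z) = h z) -> analytic h.
Proof.
move=> df fh z; have z0 : 0 < complex.Re (val z) by case: (z).
apply: (@cder_near f _ _ (complex.Re (val z))) => // x xz.
have x0 : 0 < complex.Re x.
  have := le_lt_trans (modulus_Re (x - val z)) xz.
  by rewrite ltr_norml cReD cReN => /andP[+ _]; clear; lra.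
by rewrite (ext_in h x0) -fh.
Qed.

End ComplexDerivable.

Lemma fubini_abs d1 d2 (T1 : measurableType d1) (T2 : measurableType d2) (R : realType)
    (m1 : {sigma_finite_measure set T1 -> \bar R})
    (m2 : {sigma_finite_measure set T2 -> \bar R}) (f : T1 * T2 -> \bar R) :
  measurable_fun setT f -> (\int[m1]_x \int[m2]_y `|f (x, y)| < +oo)%E ->
  (\int[m1]_x \int[m2]_y f (x, y) = \int[m2]_y \int[m1]_x f (x, y))%E.
Proof. by move=> mf fi; apply: Fubini; apply/integrable12ltyP. Qed.

(** * Exchange of integrals for the area measure *)

Section FubiniArea.
Context {R : realType}.
Local Notation mu := (@lebesgue_measure R).
Local Notation T2 := (measurableTypeR R * measurableTypeR R)%type.

Let area_sigma_finite : sigma_finite setT (@area R).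
Proof.
have /sigma_finiteP[F [TF ndF Foo]] := sigma_finiteT mu.
exists (fun n => F n `*` F n).
  rewrite -setXTT TF predeqE => -[x y]; split.
    move=> [/= [n _ Fnx] [k _ Gky]]; exists (maxn n k) => //; split.
    - by move: x Fnx; exact/subsetPset/ndF/leq_maxl.
    - by move: y Gky; exact/subsetPset/ndF/leq_maxr.
  by move=> [n _ []/= ? ?]; split; exists n.
move=> k; have [mF Fy] := Foo k; split; first exact: measurableX.
have -> : @area R (F k `*` F k) = (mu (F k) * mu (F k))%E by exact: product_measure1E.
by rewrite lte_mul_pinfty// ge0_fin_numE.
Qed.

(** [area] carries only the structure of a measure, whereas Fubini's theorem asks for a sigma-finite
    one. *)
Let areaS : {sigma_finite_measure set T2 -> \bar R} :=
  HB.pack (Measure.sort (@area R)) (Measure_isSigmaFinite.Build _ _ _ (@area R) area_sigma_finite).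

Lemma fubini_line_area (f : measurableTypeR R * T2 -> \bar R) :
  measurable_fun setT f -> (\int[mu]_x \int[@area R]_y `|f (x, y)| < +oo)%E ->
  (\int[mu]_x \int[@area R]_y f (x, y) = \int[@area R]_y \int[mu]_x f (x, y))%E.
Proof. exact: (@fubini_abs _ _ _ _ R mu areaS f). Qed.

Lemma fubini_area (f : T2 * T2 -> \bar R) :
  measurable_fun setT f -> (\int[@area R]_x \int[@area R]_y `|f (x, y)| < +oo)%E ->
  (\int[@area R]_x \int[@area R]_y f (x, y) = \int[@area R]_y \int[@area R]_x f (x, y))%E.
Proof. exact: (@fubini_abs _ _ _ _ R areaS areaS f). Qed.

Lemma tonelli_area (f : T2 * T2 -> \bar R) :
  measurable_fun setT f -> (forall x, 0 <= f x)%E ->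
  (\int[@area R]_x \int[@area R]_y f (x, y) = \int[@area R]_y \int[@area R]_x f (x, y))%E.
Proof. by move=> mf f0; exact: (@fubini_tonelli _ _ _ _ R areaS areaS f mf f0). Qed.

Lemma measurable_area_section1 (f : T2 * T2 -> \bar R) :
  measurable_fun setT f -> (forall x, 0 <= f x)%E ->
  measurable_fun setT (fun x => \int[@area R]_y f (x, y))%E.
Proof. by move=> mf f0; apply: (@measurable_fun_fubini_tonelli_F _ _ _ _ R areaS f). Qed.

Lemma measurable_area_section2 (f : T2 * T2 -> \bar R) :
  measurable_fun setT f -> (forall x, 0 <= f x)%E ->
  measurable_fun setT (fun y => \int[@area R]_x f (x, y))%E.
Proof. by move=> mf f0; apply: (@measurable_fun_fubini_tonelli_G _ _ _ _ R areaS f). Qed.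

End FubiniArea.

(** * Mean value over the disc for a radial weight *)

Section Reproducing.
Context {R : realType}.
Local Notation C := R[i].
Local Notation mu := (@lebesgue_measure R).
Local Notation T2 := (measurableTypeR R * measurableTypeR R)%type.
Local Notation H := (@half_plane R).
Implicit Types (z w : C).

Lemma cRe_scale (x : R) z : complex.Re (x%:C * z) = x * complex.Re z.
Proof. by rewrite cReM/= mul0r subr0. Qed.

Lemma cIm_scale (x : R) z : complex.Im (x%:C * z) = x * complex.Im z.
Proof. by rewrite cImM/= mul0r addr0. Qed.

Lemma mulJ z : z * z^*%C = (modulus z ^+ 2)%:C.
Proof.
rewrite sqr_modulus; case: z => a b; apply/eqP; rewrite eq_complex/=.
by apply/andP; split; apply/eqP; ring.
Qed.

Lemma conjV z : (z^-1)^*%C = ((modulus z ^+ 2)^-1)%:C * z.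
Proof.
have [->|z0] := eqVneq z 0; first by rewrite invr0 conjc0 mulr0.
have zJ : z^*%C != 0 by rewrite conjc_eq0.
have m0 : (modulus z ^+ 2)%:C != 0 by rewrite -mulJ mulf_neq0.
rewrite conjc_inv; apply: (mulfI zJ); rewrite divff// mulrCA.
by rewrite [z^*%C * z]mulrC mulJ fmorphV mulVf.
Qed.

Definition sqn (p : T2) : R := p.1 ^+ 2 + p.2 ^+ 2.

Lemma sqnE p : sqn p = modulus (cplx p) ^+ 2.
Proof. by rewrite sqr_modulus. Qed.

(** The weight of the Bergman space of the unit disc. It is radial, which allows averaging over
    rotations. *)
Definition disk_weight (l : nat) (p : T2) : R :=
  if sqn p < 1 then (1 - sqn p) ^+ l else 0.

Let mfst : measurable_fun setT (fst : T2 -> measurableTypeR R).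
Proof. exact: measurable_fst. Qed.
Let msnd : measurable_fun setT (snd : T2 -> measurableTypeR R).
Proof. exact: measurable_snd. Qed.

Lemma measurable_sqn : measurable_fun setT sqn.
Proof. by apply: measurable_funD; exact: measurable_funX. Qed.

Lemma measurable_disk_weight l : measurable_fun setT (disk_weight l).
Proof.
apply: measurable_fun_ifT => //.
  by apply: measurable_fun_ltr => //; exact: measurable_sqn.
apply: measurable_funX; apply: measurable_funB => //; exact: measurable_sqn.
Qed.

Lemma disk_weight_ge0 l p : 0 <= disk_weight l p.
Proof. by rewrite /disk_weight; case: ifPn => // h; rewrite exprn_ge0// subr_ge0 ltW. Qed.

(** Its value is pi / (l + 1), but only positivity and finiteness matter below. *)
Definition disk_mass (l : nat) : R := fine (\int[@area R]_p (disk_weight l p)%:E)%E.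

Lemma area_rect (a b c d : R) : a <= b -> c <= d ->
  @area R (`[a, b]%classic `*` `[c, d]%classic) = ((b - a) * (d - c))%:E.
Proof.
move=> ab cd; transitivity (mu `[a, b]%classic * mu `[c, d]%classic)%E.
  exact: product_measure1E.
have lI (x y : R) : x <= y -> mu `[x, y]%classic = (y - x)%:E.
  move=> xy; rewrite lebesgue_measure_itv/= lte_fin; case: ltP => // yx.
  by have -> : x = y; [lra|rewrite subrr].
by rewrite (lI _ _ ab) (lI _ _ cd) EFinM.
Qed.

(** The weight is at least 2^(-l) on the square [0, 1/4]^2, and at most the indicator of
    [-1, 1]^2. *)
Lemma disk_mass_bounds l : (0 < \int[@area R]_p (disk_weight l p)%:E < +oo)%E.
Proof.
have mW := measurable_disk_weight l.
apply/andP; split.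
  have q0 : 0 <= (1/4 : R) by lra.
  apply: (@lt_le_trans _ _ (\int[@area R]_(p in `[0%R, (1/4)%R]%classic `*` `[0%R, (1/4)%R]%classic)
     ((1/2) ^+ l)%:E)%E).
    rewrite integral_cst//=; last exact: measurableX.
    rewrite [X in (_ * X)%E](_ : _ = ((1/4 - 0) * (1/4 - 0))%:E); last exact: area_rect.
    by rewrite -EFinM lte_fin mulr_gt0// ?exprn_gt0//; lra.
  rewrite integral_mkcond; apply: ge0_le_integral => //.
  - by move=> p _; apply: erestrict_ge0 => q _; rewrite lee_fin exprn_ge0//; lra.
  - apply: measurable_patch => //; exact: measurableX.
  - by apply/measurable_EFinP.
  move=> p _; rewrite /patch; case: ifPn; last by rewrite lee_fin disk_weight_ge0.
  rewrite inE => -[]; rewrite /= !in_itv/= => /andP[a1 a2] /andP[b1 b2].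
  have s1 : sqn p <= 1/2.
    have e1 : p.1 ^+ 2 <= (1/4) ^+ 2 by rewrite ler_pXn2r.
    have e2 : p.2 ^+ 2 <= (1/4) ^+ 2 by rewrite ler_pXn2r.
    by move: e1 e2; rewrite /sqn !expr2; clear; lra.
  rewrite lee_fin /disk_weight ifT; last by clear - s1; lra.
  by rewrite lerXn2r// ?nnegrE; clear - s1; lra.
apply: (@le_lt_trans _ _ (\int[@area R]_(p in `[(-1)%R, 1%R]%classic `*` `[(-1)%R, 1%R]%classic)
     (cst 1%E p))%E).
  rewrite [leRHS]integral_mkcond; apply: ge0_le_integral => //.
  - by move=> p _; rewrite lee_fin disk_weight_ge0.
  - by apply/measurable_EFinP.
  - apply: measurable_patch => //; exact: measurableX.
  move=> p _; rewrite /patch /disk_weight; case: ifPn => s1; last first.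
    by case: ifPn.
  rewrite mem_set.
    by rewrite lee_fin exprn_ile1// ?subr_ge0 ?(ltW s1)// lerBlDr lerDl addr_ge0// sqr_ge0.
  have n1 (x : R) : x ^+ 2 < 1 -> -1 <= x <= 1.
    by rewrite -[X in _ < X](expr1n _ 2) -[x ^+ 2]real_normK ?num_real// ltr_pXn2r//
      ?nnegrE// ltr_norml => /andP[/ltW -> /ltW ->].
  by split; rewrite /= in_itv/=; apply: n1; rewrite (le_lt_trans _ s1)// /sqn ?lerDl ?lerDr sqr_ge0.
rewrite integral_cst//=; last exact: measurableX.
rewrite [X in (_ * X)%E](_ : _ = ((1 - -1) * (1 - -1))%:E); first by rewrite mul1e ltey.
by apply: area_rect; lra.
Qed.

Lemma disk_massE l : (\int[@area R]_p (disk_weight l p)%:E = (disk_mass l)%:E)%E.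
Proof.
have /andP[h0 hy] := disk_mass_bounds l.
by rewrite /disk_mass fineK// ge0_fin_numE// ltW.
Qed.

Lemma disk_mass_gt0 l : 0 < disk_mass l.
Proof. by have /andP[+ _] := disk_mass_bounds l; rewrite disk_massE lte_fin. Qed.

Lemma cplx_rot t (p : T2) : cplx (rot t p) = (cos t +i* sin t) * cplx p.
Proof.
by apply/eqP; rewrite eq_complex/=; apply/andP; split; apply/eqP; ring.
Qed.

Lemma sqn_rot t (p : T2) : sqn (rot t p) = sqn p.
Proof. exact: rot_norm. Qed.

Lemma cov_rot t : cov (rot t : T2 -> T2) (fun=> 1) setT.
Proof.
have m1 : modulus (cos t +i* sin t) ^+ 2 = 1 by rewrite sqr_modulus/= cos2Dsin2.
have c0 : cos t +i* sin t != 0 by rewrite -modulus_eq0 -sqrf_eq0 m1 oner_eq0.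
have rE p : pl ((cos t +i* sin t) * cplx p + 0) = rot t p.
  by rewrite addr0 -cplx_rot cplxK.
apply: (cov_ext (cov_affine 0 c0) _ _ _ (erefl _)) => //.
have := measurable_affine (cos t +i* sin t) 0; congr measurable_fun.
by apply/funext => p; rewrite rE.
Qed.

Let measurable_rot : measurable_fun setT (fun x : measurableTypeR R * T2 => rot x.1 x.2 : T2).
Proof.
have m1 := @measurable_fst _ _ (measurableTypeR R) T2.
have m2 := @measurable_snd _ _ (measurableTypeR R) T2.
have mc : measurable_fun setT (fun x : measurableTypeR R * T2 => cos x.1).
  apply: (measurableT_comp _ m1); apply: continuous_measurable_fun; exact: continuous_cos.
have ms : measurable_fun setT (fun x : measurableTypeR R * T2 => sin x.1).
  apply: (measurableT_comp _ m1); apply: continuous_measurable_fun; exact: continuous_sin.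
have m21 : measurable_fun setT (fun x : measurableTypeR R * T2 => x.2.1).
  exact: (measurableT_comp mfst m2).
have m22 : measurable_fun setT (fun x : measurableTypeR R * T2 => x.2.2).
  exact: (measurableT_comp msnd m2).
apply: measurable_fun_pair.
  by apply: measurable_funB; exact: measurable_funM.
by apply: measurable_funD; exact: measurable_funM.
Qed.

(* Averaging over the rotations replaces the function by its mean value. *)
Theorem disk_mean_value l (f : C -> C) : (forall z, modulus z < 1 -> cder f z) ->
  cmeas (fun p : T2 => f (cplx p)) ->
  (@area R).-integrable setT (fun p => (disk_weight l p * complex.Re (f (cplx p)))%:E) ->
  (\int[@area R]_p (disk_weight l p * complex.Re (f (cplx p)))%:E =
   (disk_mass l * complex.Re (f 0))%:E)%E.
Proof.
move=> df mf iPsi.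
pose Psi p := disk_weight l p * complex.Re (f (cplx p)).
have mPsi : measurable_fun setT Psi.
  by apply: measurable_funM; [exact: measurable_disk_weight|exact: mf.1].
have pi20 : (0 : R) < pi *+ 2 by rewrite mulrn_wgt0// pi_gt0.
pose I1 : set (measurableTypeR R) := `[0, (pi *+ 2)]%classic.
have mI1 : measurable I1 by exact: measurable_itv.
have muI1 : mu I1 = (pi *+ 2)%:E.
  by rewrite /I1 lebesgue_measure_itv/= lte_fin pi20 oppr0 adde0.
have int1 : (\int[mu]_x (\1_I1 x)%:E = (pi *+ 2)%:E)%E.
  by transitivity (mu I1); [rewrite integral_indic// setIT|exact: muI1].
(* Integrated over p first, [F] gives 2 pi times the integral of [Psi], by rotation invariance of
   the area; over t first, it gives the mean value on each circle. *)
pose F (x : measurableTypeR R * T2) := (\1_I1 x.1 * Psi (rot x.1 x.2))%:E.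
have mF : measurable_fun setT F.
  apply/measurable_EFinP; apply: measurable_funM.
    by apply: (measurableT_comp (measurable_indic _)) => //; exact: measurable_fst.
  exact: (measurableT_comp mPsi).
have rPsi t : (@area R).-integrable setT (fun p => (Psi (rot t p))%:E).
  have := (cov_integrable (cov_rot t) mPsi).2 iPsi.
  by apply: eq_integrable => // p _; rewrite mulr1.
have intr t : (\int[@area R]_p (Psi (rot t p))%:E = \int[@area R]_p (Psi p)%:E)%E.
  by rewrite -(cov_int (cov_rot t) mPsi); under [RHS]eq_integral do rewrite mulr1.
have iF : (\int[mu]_t \int[@area R]_p `|F (t, p)| < +oo)%E.
  have -> : (\int[mu]_t \int[@area R]_p `|F (t, p)| =
    \int[mu]_t ((\1_I1 t)%:E * (\int[@area R]_p `|(Psi p)%:E|)))%E.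
    apply: eq_integral => t _.
    transitivity (\int[@area R]_p ((\1_I1 t)%:E * `|(Psi (rot t p))%:E|))%E.
      by apply: eq_integral => p _; rewrite /F/= normrM ger0_norm// EFinM.
    rewrite ge0_integralZl//; last first.
      apply: measurableT_comp => //; exact: (measurable_int _ (rPsi t)).
    congr (_ * _)%E.
    have [_ _ _ _ ct] := cov_rot t.
    rewrite -[RHS]ct//; last by do 2 apply: measurableT_comp => //.
    by apply: eq_integral => p _; rewrite mule1.
  rewrite ge0_integralZr//; last first.
  - by apply: integral_ge0.
  - exact/measurable_EFinP.
  rewrite [X in (X * _)%E](_ : _ = (pi *+ 2)%:E)//.
  by have /integrableP[_ h] := iPsi; rewrite lte_mul_pinfty// lee_fin ltW.
have PE := fineK (integrable_fin_num measurableT iPsi).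
have := fubini_line_area mF iF.
have -> : (\int[mu]_t \int[@area R]_p F (t, p) =
    (pi *+ 2)%:E * (fine (\int[@area R]_p (Psi p)%:E))%:E)%E.
  rewrite -int1 -[RHS]integralZr//; last first.
    apply/integrableP; split; first exact/measurable_EFinP.
    under eq_integral do rewrite gee0_abs ?lee_fin//.
    by rewrite [X in (X < _)%E](_ : _ = (pi *+ 2)%:E)// ltey.
  apply: eq_integral => t _; rewrite PE -(intr t).
  by rewrite -[RHS]integralZl.
have -> : (\int[@area R]_p \int[mu]_t F (t, p) =
  \int[@area R]_p ((pi *+ 2 * complex.Re (f 0))%:E * (disk_weight l p)%:E))%E.
  apply: eq_integral => p _.
  transitivity (\int[mu]_(t in I1) (Psi (rot t p))%:E)%E.
    rewrite [RHS]integral_mkcond; apply: eq_integral => t _.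
    by rewrite /F/= /patch indicE; case: ifPn; rewrite ?mul1r ?mul0r.
  under eq_integral do rewrite /Psi /disk_weight sqn_rot EFinM.
  rewrite /disk_weight; case: ifPn => p1; last first.
    by under eq_integral do rewrite mul0e; rewrite integral0 mule0.
  have [it mt] := mean_value df p1.
  rewrite integralZl//; rewrite muleC; congr (_ * _)%E.
  rewrite [pi *+ 2 * _]mulrC -mt /Rintegral fineK//.
  exact: integrable_fin_num.
rewrite integralZl//; last first.
  apply/integrableP; split; first by apply/measurable_EFinP; exact: measurable_disk_weight.
  under eq_integral do rewrite gee0_abs ?lee_fin ?disk_weight_ge0//.
  by rewrite disk_massE ltey.
rewrite disk_massE -PE -!EFinM => -[e]; congr EFin.
by apply: (mulfI (lt0r_neq0 pi20)); rewrite e; ring.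
Qed.

End Reproducing.

(** * The Cayley transform and the reproducing property *)

Section ReproducingKernel.
Context {R : realType}.
Local Notation C := R[i].
Local Notation T2 := (measurableTypeR R * measurableTypeR R)%type.
Local Notation H := (@half_plane R).
Implicit Types (z w : C).

Lemma disk_half_plane z : modulus z ^+ 2 < 1 ->
  0 < complex.Re (1 - z) /\ 1 / 2 < complex.Re (1 - z)^-1.
Proof.
rewrite sqr_modulus; case: z => x y /= h.
have x1 : 0 < 1 - x.
  rewrite subr_gt0; have : x ^+ 2 < 1 by rewrite (le_lt_trans _ h)// lerDl sqr_ge0.
  rewrite -[X in _ < X](expr1n _ 2) -[x ^+ 2]real_normK ?num_real// ltr_pXn2r ?nnegrE//.
  by rewrite ltr_norml => /andP[].
split => //.
have n0 : 0 < (1 - x) ^+ 2 + (0 - y) ^+ 2 by rewrite ltr_wpDr ?sqr_ge0// exprn_gt0.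
rewrite ltr_pdivlMr//; move: h; rewrite !expr2; clear; lra.
Qed.

Lemma cRe_eq0 z : 0 < complex.Re z -> z != 0.
Proof. by move=> h; apply: contraTneq h => ->; rewrite ltxx. Qed.

(** For a = Re w and t = z + conj w, the point 1 - 2 a / t = (z - w) / (z + conj w) is the Cayley
    transform of z that takes w to 0. *)
Lemma cayley_sqn (a x : R) (w t : C) : complex.Re t = x + a -> t != 0 ->
  1 - modulus (1 + (- (2 * a))%:C / t) ^+ 2 = 4 * a * x / modulus t ^+ 2.
Proof.
rewrite !sqr_modulus; case: t => X Y /= -> t0.
have n0 : (x + a) ^+ 2 + Y ^+ 2 != 0.
  apply: contra t0 => /eqP/eqP; rewrite paddr_eq0 ?sqr_ge0// !sqrf_eq0 => /andP[/eqP -> /eqP ->].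
  by rewrite eq_complex/= eqxx.
by field.
Qed.

(** What remains of [disk_mass] times (2 a)^(l+2) / ((4 a)^l 4 a^2) for a = Re w: the powers of a
    cancel, so the constant does not depend on w. *)
Definition kernel_mass (l : nat) : R := disk_mass l / 2 ^+ l.

Lemma kernel_mass_gt0 l : 0 < kernel_mass l.
Proof. by rewrite divr_gt0 ?disk_mass_gt0// exprn_gt0. Qed.

Section with_point.
Variables (l : nat) (w : C).
Hypothesis w0 : 0 < complex.Re w.
Local Notation a := (complex.Re w).
Local Notation A := ((- (2 * a))%:C).

Let A0 : A != 0.
Proof. by rewrite fmorph_eq0 oppr_eq0 mulf_neq0 ?gt_eqF. Qed.

Let ReJ : complex.Re w^*%C = a. Proof. by case: (w). Qed.

Let cayley_cov := @cov_mobius R A w^*%C 1 A0 (ltac:(rewrite ReJ; exact: ltW)).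

Lemma cayley_weight p : 0 < p.1 ->
  disk_weight l (pl (1 + A / (cplx p + w^*%C))) =
  (4 * a * p.1 / modulus (cplx p + w^*%C) ^+ 2) ^+ l.
Proof.
move=> p0; set t := cplx p + w^*%C.
have tE : complex.Re t = p.1 + a by rewrite cReD ReJ.
have t0 : t != 0 by apply: cRe_eq0; rewrite tE addr_gt0.
have h := cayley_sqn w tE t0.
have n0 : 0 < modulus t ^+ 2 by rewrite exprn_gt0// modulus_gt0.
rewrite /disk_weight sqnE plK h ifT// -subr_gt0 h divr_gt0// mulr_gt0// mulr_gt0//.
Qed.

(** The image in [cov_mobius] is known only through inequalities. It contains the disc, off which
    the weight vanishes, so the integral over it is the one over the plane. *)
Let disk_image q : sqn q < 1 ->
  0 < complex.Re ((cplx q - 1) / A) /\ complex.Re w^*%C < complex.Re (A / (cplx q - 1)).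
Proof.
rewrite sqnE => /disk_half_plane[h1 h2].
have e1 : (cplx q - 1) / A = ((2 * a)^-1)%:C * (1 - cplx q).
  by rewrite rmorphN invrN mulrN -mulNr opprB mulrC fmorphV.
have e2 : A / (cplx q - 1) = (2 * a)%:C * (1 - cplx q)^-1.
  by rewrite rmorphN -[cplx q - 1]opprB invrN mulrNN.
rewrite e1 e2 !cRe_scale ReJ; split; first by rewrite mulr_gt0// invr_gt0 mulr_gt0.
have := ltr_pM2l (_ : 0 < 2 * a) (1/2) (complex.Re (1 - cplx q)^-1).
rewrite mulr_gt0// h2 => /(_ isT); apply: le_lt_trans.
by rewrite le_eqVlt; apply/orP; left; apply/eqP; field.
Qed.

(** This is pi times the squared norm of the kernel at w, and what puts the kernels into the Bergman
    space. *)
Lemma integral_disk_weight : (\int[area]_(p in H)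
   (p.1 ^+ l * modulus (((cplx p + w^*%C) ^+ (l + 2))^-1) ^+ 2)%:E =
   (disk_mass l / ((4 * a) ^+ l * (4 * a ^+ 2)))%:E)%E.
Proof.
set K := (4 * a) ^+ l * (4 * a ^+ 2).
have K0 : 0 < K by rewrite !mulr_gt0 ?exprn_gt0// mulr_gt0.
have [mT mJ J0 mS HT] := cayley_cov.
have mW : measurable_fun setT (fun q : T2 => (disk_weight l q / K)%:E).
  by apply/measurable_EFinP; apply: measurable_funM => //; exact: measurable_disk_weight.
have W0 q : (0 <= (disk_weight l q / K)%:E)%E.
  by rewrite lee_fin divr_ge0 ?disk_weight_ge0// ltW.
rewrite [LHS]integral_mkcond.
transitivity (\int[area]_q ((disk_weight l q / K)%:E))%E; last first.
  under eq_integral do rewrite EFinM.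
  rewrite ge0_integralZr//; last first.
  - by rewrite lee_fin invr_ge0 ltW.
  - by move=> q _; rewrite lee_fin disk_weight_ge0.
  - by apply/measurable_EFinP; exact: measurable_disk_weight.
  by rewrite disk_massE EFinM.
transitivity (\int[area]_(q in [set q : T2 | (0 < complex.Re ((cplx q - 1) / A))%R /\
     (complex.Re w^*%C < complex.Re (A / (cplx q - 1)))%R]) ((disk_weight l q / K)%:E))%E.
  rewrite -HT//; apply: eq_integral => p _.
  rewrite /patch; have -> : (p \in H) = (0 < p.1) by apply/idP/idP; rewrite inE.
  case: ifPn => p0; last by rewrite mule0.
  rewrite cayley_weight//; set t := cplx p + w^*%C.
  have t0 : t != 0 by apply: cRe_eq0; rewrite cReD ReJ addr_gt0.
  have n0 : modulus t ^+ 2 != 0 by rewrite expf_neq0// modulus_eq0.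
  rewrite -EFinM; congr EFin.
  rewrite modulusV modulusX modulus_real normrN.
  rewrite (ger0_norm (_ : 0 <= 2 * a)); last by rewrite mulr_ge0// ltW.
  rewrite exprVn exprAC (_ : modulus t ^+ 4 = (modulus t ^+ 2) ^+ 2); last by rewrite -exprM.
  move: (modulus t ^+ 2) n0 => n n0; rewrite /K !exprMn exprVn exprD.
  have : n ^+ l != 0 by rewrite expf_neq0.
  have : a ^+ l != 0 by rewrite expf_neq0// gt_eqF.
  have : (4 : R) ^+ l != 0 by rewrite expf_neq0.
  move: (n ^+ l) (a ^+ l) (4 ^+ l) => N N' N'' N0 N1 N2.
  by field; rewrite n0 N0 N1 N2 gt_eqF.
rewrite integral_mkcond; apply: eq_integral => q _; rewrite /patch; case: ifPn => // /negP.
rewrite inE => nS; congr EFin.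
rewrite /disk_weight ifF ?mul0r//; apply/negP => q1; apply: nS; exact: disk_image.
Qed.

Theorem reproducing_Re (h : C -> C) : (forall z, 0 < complex.Re z -> cder h z) ->
  cmeas (fun p : T2 => h (cplx p)) ->
  let Phi p := (p.1 ^+ l)%:C * (h (cplx p) * (((cplx p + w^*%C) ^+ (l + 2))^-1)^*%C) in
  (@area R).-integrable H (fun p => (complex.Re (Phi p))%:E) ->
  (\int[area]_(p in H) (complex.Re (Phi p))%:E =
    (kernel_mass l * complex.Re (h w))%:E)%E.
Proof.
move=> dh mh Phi iPhi.
set K := (4 * a) ^+ l * (4 * a ^+ 2).
have K0 : 0 < K by rewrite !mulr_gt0 ?exprn_gt0// mulr_gt0.
(* [M] is the inverse Cayley transform, with M 0 = w. For t = z + conj w, conj(t^(-m)) = t^m /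
   |t|^(2 m): the antianalytic kernel becomes the analytic factor t^m of [phi], and the powers of
   |t| go into the weight and the Jacobian. *)
pose M z := (2 * a)%:C / (1 - z) - w^*%C.
pose phi z := h (M z) * (M z + w^*%C) ^+ (l + 2).
have dphi z : modulus z < 1 -> cder phi z.
  move=> z1; have [h1 h2] : 0 < complex.Re (1 - z) /\ 1 / 2 < complex.Re (1 - z)^-1.
    by apply: disk_half_plane; rewrite exprn_ilt1// ?modulus_ge0.
  have dM : cder M z.
    apply: cderD; last exact: cder_cst.
    apply: cderM; first exact: cder_cst.
    apply: cderV; first exact: cRe_eq0.
    rewrite (_ : (fun x => 1 - x) = fun x => 1 + (-1) * x).
      by apply: cderD; [exact: cder_cst|apply: cderM; [exact: cder_cst|exact: cder_id]].
    by apply/funext => x; rewrite mulN1r.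
  apply: cderM.
    have hM := @cder_comp R h M z dM; apply: hM; apply: dh.
    rewrite /M cReD cReN ReJ cRe_scale subr_gt0.
    have : (2 * a) * (1/2) < (2 * a) * complex.Re (1 - z)^-1.
      by rewrite ltr_pM2l// mulr_gt0.
    apply: le_lt_trans.
    by rewrite le_eqVlt; apply/orP; left; apply/eqP; field.
  have hM := @cderD R M (fun=> w^*%C) z dM (@cder_cst R _ _).
  exact: (@cderX R (fun x => M x + w^*%C) (l + 2) z hM).
have mM : cmeas (fun q : T2 => M (cplx q)).
  apply: cmeasD; last exact: cmeas_cst.
  apply: cmeasM; first exact: cmeas_cst.
  apply: cmeasV; apply: cmeasD; first exact: cmeas_cst.
  by apply: cmeasN; exact: cmeas_cplx.
have mphi : cmeas (fun q : T2 => phi (cplx q)).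
  apply: cmeasM.
    have := cmeas_comp mh (measurable_pl mM).
    by congr cmeas; apply/funext => q; rewrite plK.
  by apply: cmeasX; apply: cmeasD => //; exact: cmeas_cst.
pose Psi q := disk_weight l q * complex.Re (phi (cplx q)).
have mPsi : measurable_fun setT Psi.
  by apply: measurable_funM; [exact: measurable_disk_weight|exact: mphi.1].
have PsiE p : Psi (pl (1 + A / (cplx p + w^*%C))) *
    (if 0 < p.1 then modulus A ^+ 2 / modulus (cplx p + w^*%C) ^+ 4 else 0) =
    K * ((fun p => complex.Re (Phi p)) \_ H) p.
  rewrite /patch; have -> : (p \in H) = (0 < p.1) by apply/idP/idP; rewrite inE.
  case: ifPn => p0; last by rewrite !mulr0.
  set t := cplx p + w^*%C.
  have t0 : t != 0 by apply: cRe_eq0; rewrite cReD ReJ addr_gt0.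
  have n0 : modulus t ^+ 2 != 0 by rewrite expf_neq0// modulus_eq0.
  rewrite /Psi cayley_weight// plK -/t.
  have -> : phi (1 + A / t) = h (cplx p) * t ^+ (l + 2).
    have ME : M (1 + A / t) = cplx p.
      rewrite /M opprD addrA subrr add0r rmorphN mulNr opprK.
      rewrite invfM mulrA divff ?mul1r ?invrK ?addrK//.
      by rewrite fmorph_eq0 mulf_neq0 ?gt_eqF.
    by rewrite /phi ME.
  have -> : complex.Re (Phi p) = p.1 ^+ l *
      ((modulus (t ^+ (l + 2)) ^+ 2)^-1 * complex.Re (h (cplx p) * t ^+ (l + 2))).
    have -> : Phi p = (p.1 ^+ l)%:C * (((modulus (t ^+ (l + 2)) ^+ 2)^-1)%:C *
        (h (cplx p) * t ^+ (l + 2))).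
      by congr (_ * _); rewrite [RHS]mulrCA -conjV.
    by rewrite !cRe_scale.
  rewrite modulusX modulus_real normrN.
  rewrite (ger0_norm (_ : 0 <= 2 * a)); last by rewrite mulr_ge0// ltW.
  set re := complex.Re (h _ * _).
  rewrite exprAC (_ : modulus t ^+ 4 = (modulus t ^+ 2) ^+ 2); last by rewrite -exprM.
  move: (modulus t ^+ 2) n0 => n n0; rewrite /K !exprMn exprVn exprD.
  have : n ^+ l != 0 by rewrite expf_neq0.
  move: (n ^+ l) => N N0.
  by field; rewrite n0 N0.
have PsiEE p : (Psi (pl (1 + A / (cplx p + w^*%C))) *
    (if 0 < p.1 then modulus A ^+ 2 / modulus (cplx p + w^*%C) ^+ 4 else 0))%:E =
    (K%:E * ((fun p => (complex.Re (Phi p))%:E) \_ H) p)%E.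
  by rewrite PsiE EFinM; congr (_ * _)%E; rewrite /patch; case: ifPn.
have iPhiT : (@area R).-integrable setT ((fun p => (complex.Re (Phi p))%:E) \_ H).
  by apply/integrable_restrict => //; rewrite ?setTI//; exact: measurable_half_plane.
have iS := (cov_integrable cayley_cov mPsi).1.
set S := (X in _ -> _.-integrable X _) in iS.
have [_ _ _ mS _] := cayley_cov; rewrite -/S in mS.
have PS p : (fun p => (Psi p)%:E) p = ((fun p => (Psi p)%:E) \_ S) p.
  rewrite /patch; case: ifPn => // /negP; rewrite inE => nS.
  rewrite /Psi /disk_weight ifF ?mul0r//; apply/negP => p1; apply: nS.
  exact: disk_image.
have iPsi : (@area R).-integrable setT (fun p => (Psi p)%:E).
  have iPS : (@area R).-integrable S (fun p => (Psi p)%:E).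
    apply: iS; have := integrableZl measurableT K iPhiT.
    by apply: eq_integrable => // p _; rewrite PsiEE.
  have : (@area R).-integrable setT ((fun p => (Psi p)%:E) \_ S).
    by apply/integrable_restrict; rewrite ?setTI.
  by apply: eq_integrable => // p _; rewrite -PS.
have := disk_mean_value dphi mphi iPsi.
have -> : (\int[area]_p (Psi p)%:E = K%:E * \int[area]_(p in H) (complex.Re (Phi p))%:E)%E.
  transitivity (\int[area]_(p in S) (Psi p)%:E)%E.
    by rewrite [RHS]integral_mkcond; apply: eq_integral => p _; rewrite PS.
  rewrite -(cov_int cayley_cov mPsi) [in RHS]integral_mkcond -integralZl//.
  by apply: eq_integral => p _; rewrite PsiEE.
have -> : complex.Re (phi 0) = (2 * a) ^+ (l + 2) * complex.Re (h w).
  have M0 : M 0 + w^*%C = (2 * a)%:C by rewrite /M subrK subr0 divr1.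
  have M1 : M 0 = w.
    rewrite /M subr0 divr1; case: (w) => x y; apply/eqP; rewrite eq_complex/=.
    by apply/andP; split; apply/eqP; ring.
  by rewrite /phi M0 M1 mulrC -rmorphXn cRe_scale.
have PE := fineK (integrable_fin_num (measurable_half_plane) iPhi).
rewrite -PE -EFinM => -[e]; congr EFin.
apply: (mulfI (lt0r_neq0 K0)); rewrite e /kernel_mass /K !exprMn exprD.
have -> : (4 : R) ^+ l = 2 ^+ l * 2 ^+ l by rewrite -exprMn -natrM.
have : (2 : R) ^+ l != 0 by rewrite expf_neq0.
rewrite [a ^+ (l + 2)]exprD; move: (2 ^+ l) => N N0; field.
exact: N0.
Qed.

End with_point.
End ReproducingKernel.

(** * The inner product of the Bergman space *)

Section InnerProduct.
Context {R : realType}.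
Local Notation C := R[i].
Local Notation T2 := (measurableTypeR R * measurableTypeR R)%type.
Local Notation H := (@half_plane R).
Implicit Types (F G : T2 -> C).

Lemma conjM (z w : C) : (z * w)^*%C = z^*%C * w^*%C.
Proof. exact: rmorphM. Qed.

Lemma conjD (z w : C) : (z + w)^*%C = z^*%C + w^*%C.
Proof. exact: rmorphD. Qed.

Lemma conj_re (x : R) : (x%:C)^*%C = x%:C.
Proof. by rewrite /= oppr0. Qed.

Let mH : measurable (H : set T2) := @measurable_half_plane R.

Definition cintegrable F :=
  (@area R).-integrable H (fun p => (complex.Re (F p))%:E) /\
  (@area R).-integrable H (fun p => (complex.Im (F p))%:E).

Definition cint F : C :=
  Rintegral (@area R) H (fun p => complex.Re (F p)) +i*
  Rintegral (@area R) H (fun p => complex.Im (F p)).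

Lemma cintegrable_le F (u : T2 -> R) : cmeas F -> measurable_fun setT u ->
  (forall p, H p -> modulus (F p) <= u p) ->
  (\int[area]_(p in H) (u p)%:E < +oo)%E -> cintegrable F.
Proof.
move=> [mF1 mF2] mu Fu iu.
have u0 p : H p -> 0 <= u p by move=> /Fu; apply: le_trans; exact: modulus_ge0.
have iuH : (@area R).-integrable H (fun p => (u p)%:E).
  apply/integrableP; split; first by apply: measurable_funTS; exact/measurable_EFinP.
  under eq_integral => p pH.
    rewrite gee0_abs ?lee_fin ?u0//; last by move: pH; rewrite inE.
    over.
  exact: iu.
split.
  apply: (le_integrable mH _ _ iuH).
    by apply: measurable_funTS; exact/measurable_EFinP.
  move=> p pH; rewrite /= lee_fin (ger0_norm (u0 _ pH)).
  exact: le_trans (modulus_Re _) (Fu _ pH).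
apply: (le_integrable mH _ _ iuH).
  by apply: measurable_funTS; exact/measurable_EFinP.
move=> p pH; rewrite /= lee_fin (ger0_norm (u0 _ pH)).
exact: le_trans (modulus_Im _) (Fu _ pH).
Qed.

Lemma eq_cint F G : (forall p, H p -> F p = G p) -> cint F = cint G.
Proof.
move=> FG; rewrite /cint; congr (_ +i* _); apply: eq_Rintegral => p;
  by rewrite inE => /FG ->.
Qed.

Lemma cintD F G : cintegrable F -> cintegrable G ->
  cint (fun p => F p + G p) = cint F + cint G.
Proof.
move=> [F1 F2] [G1 G2]; rewrite /cint.
rewrite (_ : (fun p => complex.Re (F p + G p)) = fun p => complex.Re (F p) + complex.Re (G p)).
  rewrite (_ : (fun p => complex.Im (F p + G p)) = fun p => complex.Im (F p) + complex.Im (G p)).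
    by rewrite !RintegralD.
  by apply/funext => p; rewrite cImD.
by apply/funext => p; rewrite cReD.
Qed.

Lemma cintZ a F : cintegrable F -> cint (fun p => a * F p) = a * cint F.
Proof.
move=> [F1 F2]; rewrite /cint.
have Z (x : R) (u : T2 -> R) : (@area R).-integrable H (fun p => (u p)%:E) ->
    (@area R).-integrable H (fun p => (x * u p)%:E).
  move=> iu; have := integrableZl mH x iu.
  by apply: eq_integrable => // p _; rewrite EFinM.
rewrite (_ : (fun p => complex.Re (a * F p)) = fun p =>
    complex.Re a * complex.Re (F p) - complex.Im a * complex.Im (F p)); last first.
  by apply/funext => p; rewrite cReM.
rewrite (_ : (fun p => complex.Im (a * F p)) = fun p =>
    complex.Re a * complex.Im (F p) + complex.Im a * complex.Re (F p)); last first.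
  by apply/funext => p; rewrite cImM.
rewrite RintegralB ?RintegralD//; try exact: Z.
by rewrite !RintegralZl//; case: (a).
Qed.

Lemma cintegrableZ a F : cintegrable F -> cintegrable (fun p => a * F p).
Proof.
move=> [F1 F2].
have Z (x : R) (u : T2 -> R) : (@area R).-integrable H (fun p => (u p)%:E) ->
    (@area R).-integrable H (fun p => (x * u p)%:E).
  move=> iu; have := integrableZl mH x iu.
  by apply: eq_integrable => // p _; rewrite EFinM.
split.
  have := integrableB mH (Z (complex.Re a) _ F1) (Z (complex.Im a) _ F2).
  by apply: eq_integrable => // p _; rewrite cReM EFinB.
have := integrableD mH (Z (complex.Re a) _ F2) (Z (complex.Im a) _ F1).
by apply: eq_integrable => // p _; rewrite cImM EFinD.
Qed.

Lemma cintJ F : cintegrable F -> cint (fun p => (F p)^*%C) = (cint F)^*%C.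
Proof.
move=> [F1 F2]; rewrite /cint; apply/eqP; rewrite eq_complex; apply/andP; split; apply/eqP.
  by apply: eq_Rintegral => p _; case: (F p).
rewrite /= -[RHS]mulN1r -RintegralZl//.
by apply: eq_Rintegral => p _; rewrite mulN1r; case: (F p).
Qed.

Lemma cint_real (u : T2 -> R) : cint (fun p => (u p)%:C) = (Rintegral (@area R) H u)%:C.
Proof.
rewrite /cint; apply/eqP; rewrite eq_complex/= eqxx/=; apply/eqP.
rewrite /Rintegral (_ : (\int[_]_(_ in _) _)%E = 0%E)//.
exact: integral0.
Qed.

Variable l : nat.
Implicit Types (h k d : Cplus R -> C).

Definition weighted_sq h (p : T2) : R := p.1 ^+ l * modulus (ext h (cplx p)) ^+ 2.

Definition pairing h k (p : T2) : C :=
  (p.1 ^+ l)%:C * (ext h (cplx p) * (ext k (cplx p))^*%C).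

Lemma innerE h k : inner l h k = (pi^-1)%:C * cint (pairing h k).
Proof.
rewrite /inner/=; apply/eqP; rewrite eq_complex/=.
by apply/andP; split; apply/eqP; rewrite mul0r ?addr0 ?subr0.
Qed.

Lemma measurable_weighted_sq h : analytic h -> measurable_fun setT (weighted_sq h).
Proof.
move=> ah; apply: measurable_funM.
  by apply: measurable_funX; exact: measurable_fst.
by apply: measurable_funX; apply: measurable_modulus; exact: cmeas_ext.
Qed.

Lemma weighted_sq_ge0 h p : H p -> 0 <= weighted_sq h p.
Proof. by move=> p0; rewrite mulr_ge0 ?exprn_ge0 ?(ltW p0)// modulus_ge0. Qed.

Lemma bergmanP h : bergman l h <->
  analytic h /\ (\int[area]_(p in H) (weighted_sq h p)%:E < +oo)%E.
Proof.
have i0 : (0 <= \int[area]_(p in H) (weighted_sq h p)%:E)%E.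
  by apply: integral_ge0 => p p0; rewrite lee_fin weighted_sq_ge0.
have p0 : 0 < (pi : R)^-1 by rewrite invr_gt0 pi_gt0.
rewrite /bergman/=; split=> -[ah hoo]; split => //; move: hoo; rewrite /sqnorm -/(weighted_sq h).
  case: (\int[_]_(_ in _) _)%E i0 => //= [r _ _|_]; first by rewrite ltey.
  by rewrite gt0_muley// lte_fin.
by move=> hoo; rewrite lte_mul_pinfty// lee_fin ltW.
Qed.

Lemma cmeas_pairing h k : analytic h -> analytic k -> cmeas (pairing h k).
Proof.
move=> ah ak; apply: cmeasM.
  by apply: cmeas_real; apply: measurable_funX; exact: measurable_fst.
by apply: cmeasM; [exact: cmeas_ext|apply: cmeasJ; exact: cmeas_ext].
Qed.

Lemma integral_lin_lty (u v : T2 -> R) (a b : R) : 0 <= a -> 0 <= b ->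
  measurable_fun setT u -> measurable_fun setT v ->
  (forall p, H p -> 0 <= u p) -> (forall p, H p -> 0 <= v p) ->
  (\int[area]_(p in H) (u p)%:E < +oo)%E -> (\int[area]_(p in H) (v p)%:E < +oo)%E ->
  (\int[area]_(p in H) (a * u p + b * v p)%:E < +oo)%E.
Proof.
move=> a0 b0 mu mv u0 v0 iu iv.
under eq_integral do rewrite EFinD !EFinM.
have mE (f : T2 -> R) : measurable_fun setT f -> measurable_fun (H : set T2) (fun p => (f p)%:E).
  by move=> mf; apply: measurable_funTS; exact/measurable_EFinP.
rewrite ge0_integralD//; last 4 first.
- by move=> p pH; rewrite mule_ge0// lee_fin// u0.
- by apply: emeasurable_funM => //; exact: mE.
- by move=> p pH; rewrite mule_ge0// lee_fin// v0.
- by apply: emeasurable_funM => //; exact: mE.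
rewrite !ge0_integralZl//; try (by exact: mE); try by move=> p pH; rewrite lee_fin ?u0 ?v0.
by rewrite lte_add_pinfty// lte_mul_pinfty// lee_fin.
Qed.

Lemma cintegrable_pairing h k : bergman l h -> bergman l k -> cintegrable (pairing h k).
Proof.
move=> /bergmanP[ah ih] /bergmanP[ak ik].
have mh := measurable_weighted_sq ah; have mk := measurable_weighted_sq ak.
apply: (@cintegrable_le _ (fun p => 1 * weighted_sq h p + 1 * weighted_sq k p)).
- exact: cmeas_pairing.
- by apply: measurable_funD; apply: measurable_funM.
- move=> p p0; rewrite /pairing !mul1r !modulusM modulusJ modulus_real.
  rewrite (ger0_norm (exprn_ge0 _ (ltW p0))) /weighted_sq -mulrDr ler_wpM2l//.
    by rewrite exprn_ge0// ltW.
  have a0 := modulus_ge0 (ext h (cplx p)); have b0 := modulus_ge0 (ext k (cplx p)).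
  move: (modulus _) (modulus _) a0 b0 => x y x0 y0.
  have := sqr_ge0 (x - y); have := sqr_ge0 x; have := sqr_ge0 y.
  by rewrite sqrrB; clear; lra.
- by apply: integral_lin_lty => // p p0; exact: weighted_sq_ge0.
Qed.

Lemma analytic_lin (a : C) h k : analytic h -> analytic k ->
  analytic (fun z => a * h z + k z).
Proof.
move=> ah ak; apply: (@analytic_of_cder R _ (fun z => a * ext h z + ext k z)).
  move=> z; apply: cderD; last exact: ak.
  by apply: cderM; [exact: cder_cst|exact: ah].
by move=> z; rewrite !extE.
Qed.

Lemma ext_lin (a : C) h k (z : C) : ext (fun z => a * h z + k z) z = a * ext h z + ext k z.
Proof.
have [z0|z0] := ltP 0 (complex.Re z); first by rewrite !ext_in.
by rewrite !ext_out// mulr0 addr0.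
Qed.

Lemma bergman_lin (a : C) h k : bergman l h -> bergman l k ->
  bergman l (fun z => a * h z + k z).
Proof.
move=> /bergmanP[ah ih] /bergmanP[ak ik]; apply/bergmanP; split; first exact: analytic_lin.
have mh := measurable_weighted_sq ah; have mk := measurable_weighted_sq ak.
apply: (@le_lt_trans _ _ (\int[area]_(p in H)
   ((2 * modulus a ^+ 2) * weighted_sq h p + 2 * weighted_sq k p)%:E)%E).
  apply: ge0_le_integral => //.
  - by move=> p p0; rewrite lee_fin weighted_sq_ge0.
  - apply: measurable_funTS; apply/measurable_EFinP; apply: measurable_weighted_sq.
    exact: analytic_lin.
  - apply: measurable_funTS; apply/measurable_EFinP.
    by apply: measurable_funD; apply: measurable_funM.
  move=> p p0; rewrite lee_fin /weighted_sq ext_lin !sqr_modulus.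
  rewrite !cReD !cImD !cReM !cImM mulrCA [2 * (_ * _)]mulrCA -mulrDr ler_wpM2l//.
    by rewrite exprn_ge0// ltW.
  case: a (ext h _) (ext k _) => [a b] [x y] [u v] /=.
  rewrite -subr_ge0; have := sqr_ge0 ((a * x - b * y) - u); have := sqr_ge0 ((a * y + b * x) - v).
  move=> h1 h2; have := addr_ge0 h1 h2; congr (0 <= _); ring.
apply: integral_lin_lty => //.
- by rewrite mulr_ge0// sqr_ge0.
- by move=> p p0; exact: weighted_sq_ge0.
- by move=> p p0; exact: weighted_sq_ge0.
Qed.

Lemma bergman0 : bergman l (fun=> 0 : C).
Proof.
apply/bergmanP; split.
  by apply: (@analytic_of_cder R _ (fun=> 0)) => // z; exact: cder_cst.
rewrite (eq_integral (cst 0%E)) ?integral0// => p _.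
by rewrite /weighted_sq /ext; case: insub => [z|] /=; rewrite modulus0 expr0n/= mulr0.
Qed.

Lemma inner_lin (a : C) h k d : bergman l h -> bergman l k -> bergman l d ->
  inner l (fun z => a * h z + k z) d = a * inner l h d + inner l k d.
Proof.
move=> bh bk bd; have ih := cintegrable_pairing bh bd; have ik := cintegrable_pairing bk bd.
have E : cint (pairing (fun z => a * h z + k z) d) = a * cint (pairing h d) + cint (pairing k d).
  rewrite -(cintZ a ih) -(cintD (cintegrableZ a ih) ik).
  by apply: eq_cint => p _; rewrite /pairing ext_lin; ring.
by rewrite !innerE E; ring.
Qed.

Lemma inner_conj h k : bergman l h -> bergman l k -> inner l k h = (inner l h k)^*%C.
Proof.
move=> bh bk; rewrite !innerE conjM conj_re -cintJ; last exact: cintegrable_pairing.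
congr (_ * _); apply: eq_cint => p _.
by rewrite /pairing !conjM conj_re conjcK [X in _ * X]mulrC.
Qed.

Lemma fine_sqnorm_ge0 h : 0 <= fine (sqnorm l h).
Proof.
apply: fine_ge0; rewrite mule_ge0//; first by rewrite lee_fin invr_ge0 pi_ge0.
by apply: integral_ge0 => p p0; rewrite lee_fin weighted_sq_ge0.
Qed.

Lemma bnorm_sqr h : bnorm l h ^+ 2 = pi^-1 * Rintegral (@area R) H (weighted_sq h).
Proof.
rewrite /bnorm sqr_sqrtr ?fine_sqnorm_ge0// /sqnorm -/(weighted_sq h).
have pn0 : (pi : R)^-1 != 0 by rewrite invr_eq0 gt_eqF// pi_gt0.
have : (0 <= \int[area]_(p in H) (weighted_sq h p)%:E)%E.
  by apply: integral_ge0 => p p0; rewrite lee_fin weighted_sq_ge0.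
rewrite /Rintegral; case: (\int[_]_(_ in _) _)%E => //= _.
(* The case of an infinite integral, where [fine] sends both sides to 0. *)
by rewrite gt0_muley ?mulr0// lte_fin invr_gt0 pi_gt0.
Qed.

Lemma bnorm_ge0 h : 0 <= bnorm l h.
Proof. exact: sqrtr_ge0. Qed.

Lemma inner_self h : inner l h h = (bnorm l h ^+ 2)%:C.
Proof.
rewrite innerE bnorm_sqr (eq_cint (G := fun p => (weighted_sq h p)%:C)).
  by rewrite cint_real rmorphM.
by move=> p _; rewrite /pairing mulJ -rmorphM.
Qed.

Lemma inner_linr (a : C) h k d : bergman l h -> bergman l k -> bergman l d ->
  inner l d (fun z => a * h z + k z) = a^*%C * inner l d h + inner l d k.
Proof.
move=> bh bk bd; rewrite (inner_conj (bergman_lin a bh bk) bd) inner_lin//.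
by rewrite conjD conjM -!inner_conj.
Qed.

Lemma bnorm_lin_sqr (a : C) h k : bergman l h -> bergman l k ->
  bnorm l (fun z => a * h z + k z) ^+ 2 =
  modulus a ^+ 2 * bnorm l h ^+ 2 + 2 * complex.Re (a * inner l h k) + bnorm l k ^+ 2.
Proof.
move=> bh bk; have bl := bergman_lin a bh bk.
have : ((bnorm l (fun z => a * h z + k z) ^+ 2)%:C : C) =
    (modulus a ^+ 2 * bnorm l h ^+ 2 + 2 * complex.Re (a * inner l h k) + bnorm l k ^+ 2)%:C.
  rewrite -inner_self inner_lin// !inner_linr// !inner_self mulrDr mulrA mulJ -rmorphM.
  rewrite (inner_conj bh bk); move: (a) (inner l h k) => [u v] [x y].
  by apply/eqP; rewrite eq_complex/=; apply/andP; split; apply/eqP; ring.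
by case.
Qed.

Lemma cauchy_schwarz h k : bergman l h -> bergman l k ->
  modulus (inner l h k) <= bnorm l h * bnorm l k.
Proof.
move=> bh bk; rewrite -ler_sqr ?nnegrE ?modulus_ge0 ?mulr_ge0 ?bnorm_ge0// exprMn.
set r := modulus _ ^+ 2; set n := bnorm l h ^+ 2; set q := bnorm l k ^+ 2.
have n0 : 0 <= n by exact: sqr_ge0.
have r0 : 0 <= r by exact: sqr_ge0.
(* The squared norm of k - t conj(<h, k>) h, a real polynomial in t. *)
have key (t : R) : 0 <= t ^+ 2 * r * n - 2 * t * r + q.
  have := bnorm_lin_sqr ((- t)%:C * (inner l h k)^*%C) bh bk; rewrite -/n -/q => e.
  have := sqr_ge0 (bnorm l (fun z => (- t)%:C * (inner l h k)^*%C * h z + k z)).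
  rewrite e modulusM modulus_real modulusJ exprMn normrN real_normK ?num_real// -/r.
  rewrite -mulrA [(_)^*%C * _]mulrC mulJ -/r cRe_scale /=.
  by congr (0 <= _); ring.
have [nz|nz] := eqVneq n 0.
  have [->|rz] := eqVneq r 0; first by rewrite nz mul0r.
  (* If h has norm 0 the polynomial is affine in t, and its value here is - 1. *)
  have := key ((q + 1) / (2 * r)); rewrite nz mulr0 add0r.
  have -> : 2 * ((q + 1) / (2 * r)) * r = q + 1 by field.
  by rewrite opprD addrAC addNr add0r oppr_ge0 ler10.
have := key n^-1.
have -> : n^-1 ^+ 2 * r * n - 2 * n^-1 * r + q = (n * q - r) / n by field.
by rewrite pmulr_lge0 ?invr_gt0 ?lt_neqAle ?n0 1?eq_sym ?nz// subr_ge0.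
Qed.

End InnerProduct.

(** * Kernels, uniqueness of adjoint values, point evaluations *)

Section Kernel.
Context {R : realType} (l : nat).
Local Notation C := R[i].
Local Notation T2 := (measurableTypeR R * measurableTypeR R)%type.
Local Notation H := (@half_plane R).
Implicit Types (h k d : Cplus R -> C) (A : operator R).

Definition kernel (w : C) : Cplus R -> C := fun z => ((val z + w^*%C) ^+ (l + 2))^-1.

(** The kernels are left unnormalised; this is the factor that [reproducing] collects instead. *)
Definition kernel_const : R := pi^-1 * kernel_mass l.

Lemma kernel_const_gt0 : 0 < kernel_const.
Proof. by rewrite mulr_gt0 ?invr_gt0 ?pi_gt0// kernel_mass_gt0. Qed.

Lemma cReJ (z : C) : complex.Re z^*%C = complex.Re z.
Proof. by case: z. Qed.

Lemma kernel_arg (w z : C) : 0 < complex.Re w -> 0 < complex.Re z -> z + w^*%C != 0.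
Proof. by move=> w0 z0; apply: cRe_eq0; rewrite cReD cReJ addr_gt0. Qed.

Lemma ext_kernel (w z : C) : 0 < complex.Re z ->
  ext (kernel w) z = ((z + w^*%C) ^+ (l + 2))^-1.
Proof. by move=> z0; rewrite ext_in. Qed.

Lemma cder_affine (a b z : C) : cder (fun x => a * x + b) z.
Proof.
apply: cderD; last exact: cder_cst.
by apply: cderM; [exact: cder_cst|exact: cder_id].
Qed.

Lemma analytic_kernel (w : C) : 0 < complex.Re w -> analytic (kernel w).
Proof.
move=> w0; apply: (@analytic_of_cder R _ (fun z => ((z + w^*%C) ^+ (l + 2))^-1)) => //.
move=> [z z0]; apply: cderV; first by rewrite expf_neq0// kernel_arg.
apply: cderX; apply: cderD; [exact: cder_id|exact: cder_cst].
Qed.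

Lemma bergman_kernel (w : C) : 0 < complex.Re w -> bergman l (kernel w).
Proof.
move=> w0; apply/bergmanP; split; first exact: analytic_kernel.
under eq_integral => p pH.
  rewrite /weighted_sq ext_kernel; last by move: pH; rewrite inE.
  over.
by rewrite (integral_disk_weight l w0) ltey.
Qed.

Lemma reproducing_Re_inner h (w : C) : bergman l h -> 0 < complex.Re w ->
  complex.Re (inner l h (kernel w)) = kernel_const * complex.Re (ext h w).
Proof.
move=> bh w0; have bk := bergman_kernel w0.
have /bergmanP[ah _] := bh.
have [i1 _] := cintegrable_pairing bh bk.
have mH := @measurable_half_plane R.
rewrite innerE cRe_scale /kernel_const -mulrA; congr (_ * _).
have E p : H p -> pairing l h (kernel w) p =
    (p.1 ^+ l)%:C * (ext h (cplx p) * (((cplx p + w^*%C) ^+ (l + 2))^-1)^*%C).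
  by move=> p0; rewrite /pairing ext_kernel.
have := reproducing_Re w0 (analytic_cder ah) (cmeas_ext ah).
move=> /(_ l) /= rR.
rewrite /cint/= /Rintegral.
pose Phi (p : T2) : C := (p.1 ^+ l)%:C *
  (ext h (cplx p) * (((cplx p + w^*%C) ^+ (l + 2))^-1)^*%C).
transitivity (fine (\int[area]_(p in H) (complex.Re (Phi p))%:E)).
  by congr fine; apply: eq_integral => p; rewrite inE => p0; rewrite E.
by rewrite rR//; apply: eq_integrable i1 => // p; rewrite inE => p0; rewrite E.
Qed.

(** The imaginary part comes from the real part for - i h. *)
Lemma reproducing h (w : C) : bergman l h -> 0 < complex.Re w ->
  inner l h (kernel w) = kernel_const%:C * ext h w.
Proof.
move=> bh w0; have bk := bergman_kernel w0.
have e1 := reproducing_Re_inner bh w0.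
have b0 := @bergman0 R l.
have bi : bergman l (fun z => - 'i * h z + 0) by apply: bergman_lin.
have := reproducing_Re_inner bi w0.
have i0 : inner l (fun=> 0) (kernel w) = 0.
  by have := inner_lin (-1) b0 b0 bk; rewrite [-1 * inner _ _ _]mulN1r addNr mulr0 addr0.
rewrite (inner_lin (- 'i) bh b0 bk) (ext_lin (- 'i) h (fun=> 0)) i0.
have -> : ext (fun=> 0 : C) w = 0 by rewrite ext_in.
rewrite !addr0 => e2; apply/eqP; rewrite eq_complex cRe_scale cIm_scale e1 eqxx andTb.
have Ri (z : C) : complex.Re (- 'i * z) = complex.Im z.
  by case: z => x y /=; ring.
by rewrite -!Ri e2.
Qed.

(** By Cauchy-Schwarz, d is orthogonal to the whole space, in particular to every kernel, and so
    vanishes at every point. *)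
Lemma inner_dense_eq0 A d : densely_defined l A -> dom A `<=` bergman l ->
  bergman l d -> (forall h, dom A h -> inner l h d = 0) -> d = fun=> 0.
Proof.
move=> dA sA bd Ad.
have hd h : bergman l h -> inner l h d = 0.
  move=> bh; apply/eqP; rewrite -modulus_eq0 eq_le modulus_ge0 andbT.
  apply/ler_addgt0Pr => e e0; rewrite add0r.
  have n0 : 0 < bnorm l d + 1 by rewrite ltr_wpDl// bnorm_ge0.
  have [k Ak hk] := dA h bh (e / (bnorm l d + 1)) (divr_gt0 e0 n0).
  have bk := sA _ Ak.
  have E : (fun z => h z - k z) = (fun z => (-1) * k z + h z).
    by apply/funext => z; rewrite mulN1r addrC.
  have -> : inner l h d = inner l (fun z => (-1) * k z + h z) d.
    by rewrite (inner_lin (-1) bk bh bd) (Ad _ Ak) mulr0 add0r.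
  apply: (le_trans (cauchy_schwarz (bergman_lin (-1) bk bh) bd)).
  rewrite -E; apply: (@le_trans _ _ (e / (bnorm l d + 1) * bnorm l d)).
    by rewrite ler_wpM2r ?bnorm_ge0// ltW.
  by rewrite mulrAC ler_pdivrMr// ler_wpM2l ?(ltW e0)// lerDl.
apply/funext => w; have w0 : 0 < complex.Re (val w) by case: (w).
have bk := bergman_kernel w0.
have := reproducing bd w0; rewrite (inner_conj bk bd) hd// conjc0 extE => /esym/eqP.
rewrite mulf_eq0 => /orP[|/eqP//].
by rewrite (fmorph_eq0 (real_complex R)) gt_eqF// kernel_const_gt0.
Qed.

Lemma adjoint_value_unique A k k1 k2 : densely_defined l A -> dom A `<=` bergman l ->
  adjoint_value l A k k1 -> adjoint_value l A k k2 -> k1 = k2.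
Proof.
move=> dA sA [b1 h1] [b2 h2].
have bl := bergman_lin (-1) b2 b1.
have := @inner_dense_eq0 A _ dA sA bl.
have hz h : dom A h -> inner l h (fun z => -1 * k2 z + k1 z) = 0.
  move=> Ah; rewrite (inner_linr (-1) b2 b1 (sA _ Ah)) -h1// -h2//.
  have -> : (-1 : C)^*%C = -1 by rewrite -(rmorphN1 (real_complex R)) conj_re.
  by rewrite mulN1r addNr.
move=> /(_ hz) e; apply/funext => z; have := congr1 (fun f => f z) e.
by rewrite mulN1r addrC => /eqP; rewrite subr_eq0 => /eqP.
Qed.

Lemma adjointE A k k' : densely_defined l A -> dom A `<=` bergman l ->
  adjoint_value l A k k' -> adjoint l A k = k'.
Proof.
move=> dA sA ak; apply: (adjoint_value_unique dA sA _ ak).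
rewrite /adjoint/=; exact: xgetPex (ex_intro _ _ ak).
Qed.

Lemma densely_defined_full A : bergman l `<=` dom A -> densely_defined l A.
Proof.
move=> sA h bh e e0; exists h; first exact: sA.
have -> : (fun z => h z - h z) = (fun=> 0) by apply/funext => z; rewrite subrr.
rewrite /bnorm /sqnorm (eq_integral (cst 0%E)) ?integral0 ?mule0 ?sqrtr0// => p _.
rewrite (_ : ext _ _ = 0) ?modulus0 ?expr0n ?mulr0//.
by rewrite /ext; case: insub.
Qed.

Lemma point_evaluation h (w : C) : bergman l h -> 0 < complex.Re w ->
  kernel_const * modulus (ext h w) <= bnorm l h * bnorm l (kernel w).
Proof.
move=> bh w0; have := cauchy_schwarz bh (bergman_kernel w0).
by rewrite reproducing// modulusM modulus_real gtr0_norm// kernel_const_gt0.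
Qed.

End Kernel.

(** * Conjugations *)

Section Transform.
Context {R : realType} (l : nat).
Local Notation C := R[i].
Local Notation T2 := (measurableTypeR R * measurableTypeR R)%type.
Local Notation H := (@half_plane R).
Implicit Types (h k d : Cplus R -> C).

Let mH : measurable (H : set T2) := @measurable_half_plane R.

Lemma cint_cov (T : T2 -> T2) (J : T2 -> R) (F : T2 -> C) : cov T J H ->
  (forall p, ~ H p -> J p = 0) -> cmeas F ->
  cint (fun p => (J p)%:C * F (T p)) = cint F.
Proof.
move=> cT J0 [mF1 mF2].
have key (u : T2 -> R) : measurable_fun setT u ->
    Rintegral (@area R) H (fun p => J p * u (T p)) = Rintegral (@area R) H u.
  move=> mu; rewrite /Rintegral -(cov_int cT mu); congr fine.
  rewrite integral_mkcond; apply: eq_integral => p _; rewrite /patch.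
  case: ifPn => [_|/negP]; first by rewrite mulrC.
  by rewrite inE => /J0 ->; rewrite mulr0.
rewrite /cint -(key _ mF1) -(key _ mF2).
by congr (_ +i* _); apply: eq_Rintegral => p _; rewrite ?cRe_scale ?cIm_scale.
Qed.

Variables (tau phi : C -> C) (J : T2 -> R).
Hypothesis ctau : cov (fun p => pl (tau (cplx p))) J H.
Hypothesis J_out : forall p, ~ H p -> J p = 0.
Hypothesis weight : forall p, H p ->
  p.1 ^+ l * modulus (phi (cplx p)) ^+ 2 = complex.Re (tau (cplx p)) ^+ l * J p.

(* [e] is the identity or the conjugation, for the linear and the antilinear transforms. *)
Variable e : C -> C.
Hypothesis modulus_e : forall z, modulus (e z) = modulus z.

(** The common form of [Cstar] and of the scalings. The hypothesis [weight] balances |phi|^2 against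
    the Jacobian, which makes every such map isometric. *)
Definition transform h : Cplus R -> C := fun z => phi (val z) * e (ext h (tau (val z))).

Lemma ext_transform h (z : C) : 0 < complex.Re z ->
  ext (transform h) z = phi z * e (ext h (tau z)).
Proof. by move=> z0; rewrite ext_in. Qed.

Lemma integral_weighted_sq_transform h : analytic h ->
  (\int[area]_(p in H) (weighted_sq l (transform h) p)%:E =
   \int[area]_(p in H) (weighted_sq l h p)%:E)%E.
Proof.
move=> ah; rewrite -(cov_int ctau (measurable_weighted_sq l ah)) [LHS]integral_mkcond.
apply: eq_integral => p _; rewrite /patch.
case: ifPn => [|/negP]; rewrite inE => pH; last by rewrite J_out// mulr0.
rewrite /weighted_sq ext_transform// modulusM modulus_e exprMn mulrA weight// plK.
by congr EFin; rewrite mulrAC.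
Qed.

Lemma bergman_transform h : bergman l h -> analytic (transform h) ->
  bergman l (transform h).
Proof.
move=> /bergmanP[ah ih] at'; apply/bergmanP; split => //.
by rewrite integral_weighted_sq_transform.
Qed.

Lemma inner_transform h k : analytic h -> analytic k -> e = id ->
  inner l (transform h) (transform k) = inner l h k.
Proof.
move=> ah ak eE; rewrite !innerE; congr (_ * _).
rewrite -(cint_cov ctau J_out (cmeas_pairing l ah ak)); apply: eq_cint => p pH.
rewrite /pairing !ext_transform// eE conjM mulrACA mulJ !mulrA plK -!rmorphM weight//.
by congr (_ * _ * _); rewrite mulrC.
Qed.

End Transform.

Section Conjugation.
Context {R : realType} (l : nat).
Local Notation C := R[i].
Local Notation T2 := (measurableTypeR R * measurableTypeR R)%type.
Local Notation H := (@half_plane R).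
Implicit Types (h k d : Cplus R -> C).

Lemma conj_inv (z : C) : (z^-1)^*%C = (z^*%C)^-1.
Proof. exact: (fmorphV (@conjc R)). Qed.

(** The difference quotient at z with increment h is the conjugate of that of f at conj z with
    increment conj h. *)
Lemma cder_conj (f : C -> C) (z : C) : cder f z^*%C ->
  cder (fun x => (f x^*%C)^*%C) z.
Proof.
move=> /cvg_ex[/= L fL]; apply/cvg_ex; exists L^*%C.
apply/(@cvgrPdist_lt C C^o) => e e0; have := fL.
move=> /(@cvgrPdist_lt C C^o) /(_ e e0) [d /= d0 dH].
exists d => //= h hd h0.
have hJ : `|h^*%C| = `|h| by rewrite !normC_modulus modulusJ.
have := dH h^*%C; rewrite /= !sub0r !normrN hJ in hd * => /(_ hd) H0.
have hJ0 : h^*%C != 0 by rewrite -normr_eq0 hJ normr_eq0.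
move: (H0 hJ0); rewrite normC_modulus -modulusJ -normC_modulus.
congr (_ < _); congr (`|_|).
rewrite !(rmorphB, rmorphD, rmorphM)/=.
have -> : (1 -i* 0 : C) = 1 by rewrite oppr0.
have -> : (h^*%C^-1)^*%C = h^-1 by rewrite conj_inv conjcK.
by rewrite mulr1; congr (_ - _ * ((f (_ + _))^*%C - _)); exact: mulr1.
Qed.

Lemma conjX (z : C) n : (z ^+ n)^*%C = z^*%C ^+ n.
Proof. exact: rmorphXn. Qed.

Lemma transform_Cstar h :
  Cstar l h = transform (fun z => (z^*%C)^-1) (fun z => (z ^+ (l + 2))^-1) (@conjc R) h.
Proof. by []. Qed.

Lemma cov_reflection : cov (fun p : T2 => pl ((cplx p)^*%C)) (fun=> 1) setT.
Proof.
have n1 : (-1 : R) != 0 by rewrite oppr_eq0 oner_eq0.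
have := cov_affine_y 0 0 n1; rewrite normrN1; congr cov.
by apply/funext => p; rewrite /pl/= mul0r !addr0 mulN1r.
Qed.

Lemma cov_Cstar : cov (fun p : T2 => pl ((cplx p)^*%C)^-1)
  (fun p => if 0 < p.1 then (modulus (cplx p) ^+ 4)^-1 else 0) H.
Proof.
have mH := @measurable_half_plane R.
have ReJH p : H (pl (cplx p)^*%C) <-> H p by rewrite /half_plane.
have cr := cov_restrict cov_reflection mH mH (fun p _ => ReJH p).
rewrite setTI in cr.
have cr0 p : ~ H p -> (if p \in H then 1 else 0 : R) = 0.
  by move=> np; rewrite ifN// notin_setE.
have cc := cov_comp cov_inversion cr cr0.
apply: (cov_ext cc) => //.
- by have [+ _ _ _ _] := cc; congr measurable_fun; apply/funext => p; rewrite plK conj_inv.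
- move=> p; case: (ltP 0 p.1) => p0; last by rewrite mulr0.
  rewrite ifT ?mul1r//; apply/mem_set.
  by rewrite /half_plane/mkset -[X in 0 < X]/(complex.Re (cplx p)^-1) Re_inv_gt0.
- by move=> p _; rewrite plK conj_inv.
Qed.

Let Cstar_out (p : T2) : ~ H p -> (if 0 < p.1 then (modulus (cplx p) ^+ 4)^-1 else 0 : R) = 0.
Proof. by move=> np; rewrite ifN//; apply/negP. Qed.

Lemma Re_inv (z : C) : complex.Re z^-1 = complex.Re z / modulus z ^+ 2.
Proof. by rewrite sqr_modulus; case: z. Qed.

Let Cstar_weight (p : T2) : H p ->
  p.1 ^+ l * modulus ((cplx p ^+ (l + 2))^-1) ^+ 2 =
  complex.Re ((cplx p)^*%C)^-1 ^+ l * (if 0 < p.1 then (modulus (cplx p) ^+ 4)^-1 else 0).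
Proof.
move=> pH; have p0 : 0 < p.1 by [].
have z0 : cplx p != 0 by apply: cRe_eq0.
have n0 : modulus (cplx p) ^+ 2 != 0 by rewrite expf_neq0// modulus_eq0.
rewrite p0 Re_inv cReJ modulusJ modulusV modulusX exprVn exprAC.
rewrite (_ : modulus (cplx p) ^+ 4 = (modulus (cplx p) ^+ 2) ^+ 2); last by rewrite -exprM.
rewrite [complex.Re _]/(p.1).
move: (modulus (cplx p) ^+ 2) n0 => n n0; rewrite exprMn exprVn exprD.
have : n ^+ l != 0 by rewrite expf_neq0.
move: (n ^+ l) => N N0.
by field; rewrite n0 N0.
Qed.

Lemma analytic_Cstar h : analytic h -> analytic (Cstar l h).
Proof.
move=> ah; apply: (@analytic_of_cder R _
    (fun z => (z ^+ (l + 2))^-1 * (ext h (((z^-1)^*)%C))^*%C)); last first.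
  by move=> z; rewrite conj_inv.
move=> [z z0]; have zn : z != 0 by exact: cRe_eq0.
apply: cderM.
  by apply: cderV; [rewrite expf_neq0|apply: cderX; exact: cder_id].
apply: (@cder_comp R (fun x => (ext h x^*%C)^*%C) (fun x => x^-1)).
  by apply: cderV => //; exact: cder_id.
by apply: cder_conj; apply: analytic_cder; rewrite // cReJ Re_inv_gt0.
Qed.

Lemma bergman_Cstar h : bergman l h -> bergman l (Cstar l h).
Proof.
move=> bh; rewrite transform_Cstar.
apply: (bergman_transform cov_Cstar Cstar_out Cstar_weight) => //.
  exact: modulusJ.
by rewrite -transform_Cstar; apply: analytic_Cstar; case: bh.
Qed.

Lemma CstarE h z :
  Cstar l h z = (val z ^+ (l + 2))^-1 * (ext h ((val z)^*%C)^-1)^*%C.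
Proof. by []. Qed.

Lemma CstarK h : Cstar l (Cstar l h) = h.
Proof.
apply/funext => z; have z0 : 0 < complex.Re (val z) by case: (z).
have zn := cRe_eq0 z0.
rewrite CstarE ext_in; first by rewrite Re_inv_gt0 cReJ.
move=> z1; rewrite CstarE/= conjM conjcK conj_inv conjX conj_inv conjcK invrK extE exprVn invrK.
by rewrite mulKf// expf_neq0.
Qed.

(** Both [Ubc] and its inverse are of this form. *)
Definition scaling (beta : C) (a e : R) h : Cplus R -> C :=
  fun z => beta * ext h (a%:C * val z + 'i * e%:C).

Section scaling.
Variables (beta : C) (a e : R).
Hypotheses (a0 : 0 < a) (beta_a : modulus beta ^+ 2 = a ^+ (l + 2)).
Local Notation tau := (fun z : C => a%:C * z + 'i * e%:C).

Lemma Re_scaling (z : C) : complex.Re (tau z) = a * complex.Re z.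
Proof. by rewrite cReD cRe_scale/= mul0r mulr0 subrr addr0. Qed.

Lemma cov_scaling : cov (fun p : T2 => pl (tau (cplx p)))
  (fun p => if 0 < p.1 then a ^+ 2 else 0) H.
Proof.
have mH := @measurable_half_plane R.
have aC : a%:C != 0 :> C by rewrite fmorph_eq0 gt_eqF.
have ReH p : H (pl (tau (cplx p))) <-> H p.
  by rewrite /half_plane/mkset -[X in 0 < X]/(complex.Re (tau (cplx p))) Re_scaling pmulr_rgt0.
have := cov_restrict (cov_affine ('i * e%:C) aC) mH mH (fun p _ => ReH p).
rewrite setTI modulus_real (ger0_norm (ltW a0)); congr cov.
apply/funext => p; rewrite (_ : (p \in H) = (0 < p.1))//.
by apply/idP/idP; rewrite inE.
Qed.

Let scaling_out (p : T2) : ~ H p -> (if 0 < p.1 then a ^+ 2 else 0) = 0.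
Proof. by move=> np; rewrite ifN//; apply/negP. Qed.

Let scaling_in (z : C) : 0 < complex.Re z -> 0 < complex.Re (tau z).
Proof. by move=> z0; rewrite Re_scaling mulr_gt0. Qed.

Let scaling_weight (p : T2) : H p -> p.1 ^+ l * modulus beta ^+ 2 =
  complex.Re (tau (cplx p)) ^+ l * (if 0 < p.1 then a ^+ 2 else 0).
Proof.
move=> pH; have p0 : 0 < p.1 by [].
by rewrite p0 Re_scaling beta_a exprMn exprD mulrCA mulrA.
Qed.

Lemma bergman_scaling h : bergman l h -> bergman l (scaling beta a e h).
Proof.
move=> bh; apply: (bergman_transform (e := id) (phi := fun=> beta)
   cov_scaling scaling_out scaling_weight) => //.
apply: (@analytic_of_cder R _ (fun z => beta * ext h (tau z))) => // z.
apply: cderM; first exact: cder_cst.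
apply: (@cder_comp R (ext h) tau); first exact: cder_affine.
by apply: analytic_cder; [case: bh|apply: scaling_in; case: z].
Qed.

Lemma inner_scaling h k : bergman l h -> bergman l k ->
  inner l (scaling beta a e h) (scaling beta a e k) = inner l h k.
Proof.
move=> bh bk.
have [[ah _] [ak _]] := (bh, bk).
exact: (inner_transform (e := id) (phi := fun=> beta) cov_scaling scaling_out scaling_weight).
Qed.
End scaling.

Variables (b : C) (c : R).
Hypothesis b0 : b != 0.
Local Notation s := (scale l b).

Lemma scale_gt0 : 0 < s.
Proof. by rewrite powR_gt0// modulus_gt0. Qed.

(** The isometry condition of [scaling], and the origin of the exponent 2 / (l + 2). *)
Lemma scaleX : modulus b ^+ 2 = s ^+ (l + 2).
Proof.
rewrite /scale -[RHS]powR_mulrn ?powR_ge0// -powRrM divfK ?pnatr_eq0 ?addn2//.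
by rewrite powR_mulrn ?modulus_ge0.
Qed.

Definition Ubc_inv : (Cplus R -> C) -> (Cplus R -> C) := scaling b^-1 s^-1 (- c / s).

Lemma Ubc_scaling h : Ubc l b c h = scaling b s c h.
Proof. by []. Qed.

Let s1 : 0 < s^-1. Proof. by rewrite invr_gt0 scale_gt0. Qed.
Let bs1 : modulus b^-1 ^+ 2 = s^-1 ^+ (l + 2).
Proof. by rewrite modulusV !exprVn scaleX. Qed.

Lemma UbcK h : Ubc_inv (Ubc l b c h) = h.
Proof.
apply/funext => z; have z0 : 0 < complex.Re (val z) by case: (z).
have sn : s%:C != 0 :> C by rewrite fmorph_eq0 gt_eqF// scale_gt0.
rewrite /Ubc_inv /scaling ext_in; first by rewrite Re_scaling mulr_gt0.
move=> z1; rewrite /= mulKf//.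
have -> : s%:C * (s^-1%:C * val z + 'i * (- c / s)%:C) + 'i * c%:C = val z.
  by rewrite rmorphM rmorphN fmorphV; field.
by rewrite extE.
Qed.

Lemma Ubc_invK h : Ubc l b c (Ubc_inv h) = h.
Proof.
apply/funext => z; have z0 : 0 < complex.Re (val z) by case: (z).
have sn : s%:C != 0 :> C by rewrite fmorph_eq0 gt_eqF// scale_gt0.
rewrite Ubc_scaling /Ubc_inv /scaling ext_in; first by rewrite Re_scaling mulr_gt0 ?scale_gt0.
move=> z1; rewrite /= mulVKf//.
have -> : s^-1%:C * (s%:C * val z + 'i * c%:C) + 'i * (- c / s)%:C = val z.
  by rewrite rmorphM rmorphN fmorphV; field.
by rewrite extE.
Qed.

Lemma bergman_Ubc h : bergman l h -> bergman l (Ubc l b c h).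
Proof. by move=> bh; apply: bergman_scaling => //; [exact: scale_gt0|exact: scaleX]. Qed.

Lemma bergman_Ubc_inv h : bergman l h -> bergman l (Ubc_inv h).
Proof. exact: bergman_scaling. Qed.

Lemma adjoint_Ubc_value h : bergman l h -> adjoint_value l (Ubc l b c) h (Ubc_inv h).
Proof.
move=> bh; split; first exact: bergman_Ubc_inv.
move=> k bk; rewrite -{1}(Ubc_invK h) !Ubc_scaling inner_scaling ?scale_gt0 ?scaleX//.
exact: bergman_Ubc_inv.
Qed.

Lemma adjoint_Ubc h : bergman l h -> adjoint l (Ubc l b c) h = Ubc_inv h.
Proof.
move=> bh; apply: adjointE; last exact: adjoint_Ubc_value.
- exact: densely_defined_full.
- by [].
Qed.

(** [conj_bc] as a plain function, free of domains and of the choice made in [adjoint]; the two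
    agree on the Bergman space. *)
Definition conjugation h : Cplus R -> C := Ubc l b c (Cstar l (Ubc_inv h)).

Lemma dom_conj_bc h : dom (conj_bc l b c) h <-> bergman l h.
Proof.
rewrite /conj_bc /op_comp /=; split=> [[[[bh _] _] _]//|bh]; split.
  split; last by rewrite [xget _ _](adjoint_Ubc bh); exact: bergman_Ubc_inv.
  by split => //; exists (Ubc_inv h); exact: adjoint_Ubc_value.
rewrite [xget _ _](adjoint_Ubc bh); exact: (bergman_Cstar (bergman_Ubc_inv bh)).
Qed.

Lemma conj_bcE h : bergman l h -> conj_bc l b c h = conjugation h.
Proof. by move=> bh; rewrite /conjugation -adjoint_Ubc. Qed.

Lemma bergman_conjugation h : bergman l h -> bergman l (conjugation h).
Proof. by move=> bh; apply: bergman_Ubc; apply: bergman_Cstar; exact: bergman_Ubc_inv. Qed.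

Lemma conjugationK h : conjugation (conjugation h) = h.
Proof. by rewrite /conjugation UbcK CstarK Ubc_invK. Qed.

(** The point map behind the conjugation: z -> 1 / conj z, carried over by z -> s z + ic. *)
Definition rho (z : C) : C := s^-1%:C * ((s%:C * z + 'i * c%:C)^*%C)^-1 - 'i * (c / s)%:C.

Lemma conjugationE h (z : Cplus R) : conjugation h z =
  b / b^*%C * ((s%:C * val z + 'i * c%:C) ^+ (l + 2))^-1 * (ext h (rho (val z)))^*%C.
Proof.
have z0 : 0 < complex.Re (val z) by case: (z).
have z1 : 0 < complex.Re (s%:C * val z + 'i * c%:C) by rewrite Re_scaling mulr_gt0 ?scale_gt0.
rewrite /conjugation Ubc_scaling /scaling ext_in CstarE/=.
rewrite ext_in; first by rewrite Re_inv_gt0 cReJ.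
move=> z2; rewrite /Ubc_inv /scaling [\val _]/= conjM conj_inv !mulrA; congr (_ * _).
  by rewrite mulrAC.
congr ((ext h _)^*%C); rewrite /rho; congr (_ + _).
by rewrite mulNr rmorphN mulrN.
Qed.

End Conjugation.

(** * Weighted composition operators *)

Section SchurIntegral.
Context {R : realType}.
Local Notation C := R[i].
Local Notation mu := (@lebesgue_measure R).
Local Notation T2 := (measurableTypeR R * measurableTypeR R)%type.
Local Notation H := (@half_plane R).

Lemma measurable_sqrt : measurable_fun setT (@Num.sqrt R).
Proof. by apply: continuous_measurable_fun; exact: sqrt_continuous. Qed.

Lemma cvg_sqrt_pinfty : (@Num.sqrt R) x @[x --> +oo] --> +oo.
Proof.
apply/cvgryPge => A; exists (A ^+ 2); split; first exact: num_real.
move=> x Ax; rewrite (le_trans (ler_norm A))// -sqrtr_sqr ler_wsqrtr//.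
exact: ltW.
Qed.

Lemma integral_inv_sqrt3 :
  (\int[mu]_(x in `[1%R, +oo[) ((x * Num.sqrt x)^-1)%:E = 2%:E)%E.
Proof.
have dF (x : R) : 1 <= x ->
    is_derive x (1 : R) (fun x : R => - (2 / Num.sqrt x)) (x * Num.sqrt x)^-1.
  move=> x1; have x0 : 0 < x by rewrite (lt_le_trans _ x1).
  have s0 : Num.sqrt x != 0 by rewrite gt_eqF// sqrtr_gt0.
  have [d1 d2] := is_derive1_sqrt x0.
  have -> : (x * Num.sqrt x)^-1 = - (2 * (- (Num.sqrt x) ^- 2 * (2 * Num.sqrt x)^-1)).
    rewrite sqr_sqrtr ?ltW//; field.
    by rewrite s0 gt_eqF.
  apply: is_deriveN; apply: is_deriveZ; split; first exact: derivableV.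
  by rewrite deriveV// d2.
rewrite (@ge0_continuous_FTC2y _ _ (fun x => - (2 / Num.sqrt x)) _ 0%R).
- by rewrite sqrtr1 divr1 -EFinB opprK add0r.
- by move=> x x1; rewrite invr_ge0 mulr_ge0 ?sqrtr_ge0// (le_trans _ x1).
- apply: continuous_in_subspaceT => x /[!inE]/=; rewrite in_itv/= andbT => x1.
  have x0 : 0 < x by rewrite (lt_le_trans _ x1).
  apply: cvgV; first by rewrite mulf_neq0 ?gt_eqF// sqrtr_gt0.
  by apply: cvgM; [exact: cvg_id|exact: sqrt_continuous].
- rewrite -oppr0; apply: cvgN; rewrite -(mulr0 2); apply: cvgMr.
  apply/gtr0_cvgV0; last exact: cvg_sqrt_pinfty.
  by exists 0; split => // x x0; rewrite sqrtr_gt0.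
- by move=> x x1; have [] := dF x (ltW x1).
- apply: cvg_at_right_filter.
  have [d _] := dF _ (lexx 1).
  have /differentiable_continuous : differentiable (fun x : R => - (2 / Num.sqrt x)) (1 : R).
    exact/derivable1_diffP.
  exact.
- move=> x; rewrite in_itv/= andbT => x1.
  by rewrite derive1E; have [_ ->] := dF x (ltW x1).
Qed.

(** Compared with 1 on [-1, 1] and with y^(-2) on the two tails. *)
Lemma integral_inv_oneDsqr_lty :
  (\int[mu]_y ((1 + y ^+ 2)^-1)%:E < +oo)%E.
Proof.
pose q (y : R) := (1 + y ^+ 2)^-1.
pose v := (fun y : measurableTypeR R => (y ^- 2)%:E) \_ `[1, +oo[%classic.
have mq (n : nat) : measurable_fun setT (fun y : R => (y ^- n)%:E).
  by apply/measurable_EFinP; apply: (measurableT_comp measurable_fun_inv); exact: measurable_funX.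
have mv : measurable_fun setT v by exact: measurable_patch.
have v0 y : (0 <= v y)%E.
  by apply: erestrict_ge0 => x _; rewrite lee_fin invr_ge0 sqr_ge0.
have iv : (\int[mu]_y v y = 1%:E)%E.
  by have := @integral_inv_sqr R 1 ltr01; rewrite invr1 integral_mkcond.
have ivN : (\int[mu]_y v (- y)%R = 1%:E)%E.
  have n1 : (-1 : R) != 0 by rewrite oppr_eq0 oner_eq0.
  rewrite -iv -[RHS](cov1_affine 0 n1)//; apply: eq_integral => y _.
  by rewrite mulN1r addr0 normrN1 mule1.
pose w := (fun _ : measurableTypeR R => 1%:E : \bar R) \_ `[(-1), 1]%classic.
have mw : measurable_fun setT w by apply: measurable_patch.
have w0 (y : measurableTypeR R) : (0 <= w y)%E by apply: erestrict_ge0.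
have iw : (\int[mu]_y w y < +oo)%E.
  by rewrite -integral_mkcond integral_cst//= lebesgue_measure_itv/= lte_fin mul1e; case: ifP; rewrite ltey.
apply: (@le_lt_trans _ _ (\int[mu]_y (w y + (v y + v (- y)%R)))%E).
  apply: ge0_le_integral => //.
  - by move=> y _; rewrite lee_fin invr_ge0 addr_ge0// sqr_ge0.
  - apply/measurable_EFinP; apply: (measurableT_comp measurable_fun_inv).
    by apply: measurable_funD => //; exact: measurable_funX.
  - apply: emeasurable_funD => //; apply: emeasurable_funD => //.
    by apply: (measurableT_comp mv).
  move=> y _; have [y1|y1] := leP `|y| 1.
    rewrite /w patchE mem_set; last by move: y1; rewrite ler_norml /= in_itv.
    rewrite (@le_trans _ _ 1%:E)//; last by rewrite leeDl// adde_ge0.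
    by rewrite lee_fin invf_le1 ?lerDl ?sqr_ge0// ltr_pwDl ?sqr_ge0.
  have h : (1 + y ^+ 2)^-1 <= y ^- 2.
    have y20 : 0 < y ^+ 2 by rewrite -real_normK ?num_real// exprn_gt0// (lt_trans _ y1).
    by rewrite lef_pV2 ?posrE ?lerDr// addr_gt0.
  rewrite -[leLHS]add0e leeD//.
  move: y1; rewrite lter_normr => /orP[y1|y1].
    rewrite -[leLHS]adde0 leeD// /v patchE mem_set ?lee_fin//.
    by rewrite /= in_itv/= andbT ltW.
  rewrite -[leLHS]add0e leeD// /v patchE mem_set ?sqrrN ?lee_fin//.
  by rewrite /= in_itv/= andbT ltW.
rewrite ge0_integralD//; last 2 first.
- by move=> y _; rewrite adde_ge0.
- by apply: emeasurable_funD => //; apply: (measurableT_comp mv).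
rewrite ge0_integralD//; last by apply: (measurableT_comp mv).
by rewrite iv ivN lte_add_pinfty// -EFinD ltey.
Qed.

(** On ]0, 1] the substitution x -> 1 / x turns the singularity x^(-1/2) into a tail, so that
    x^(-3/2) on [1, +oo[ dominates both halves. *)
Lemma integral_inv_sqrt_lty :
  (\int[mu]_(x in `]0%R, +oo[) ((Num.sqrt x * (x + 1))^-1)%:E < +oo)%E.
Proof.
pose q (x : R) := (Num.sqrt x * (x + 1))^-1.
have mq : measurable_fun setT (fun x : R => (q x)%:E).
  apply/measurable_EFinP; apply: (measurableT_comp measurable_fun_inv).
  apply: measurable_funM; first exact: measurable_sqrt.
  exact: measurable_funD.
pose r (x : R) := (x * Num.sqrt x)^-1.
pose v := (fun x : measurableTypeR R => (r x)%:E) \_ `[1, +oo[%classic.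
have mv : measurable_fun setT v.
  apply: measurable_patch => //; apply/measurable_EFinP.
  apply: (measurableT_comp measurable_fun_inv); apply: measurable_funM => //.
  exact: measurable_sqrt.
have v0 y : (0 <= v y)%E.
  apply: erestrict_ge0 => x; rewrite /= in_itv/= andbT => x1.
  by rewrite lee_fin invr_ge0 mulr_ge0 ?sqrtr_ge0// (le_trans _ x1).
have iv : (\int[mu]_y v y = 2%:E)%E by rewrite -integral_mkcond integral_inv_sqrt3.
pose G (x : R) : \bar R := if x <= 1 then `|q x|%:E else 0%E.
have mle : measurable_fun setT (fun x : R => x <= 1) by exact: measurable_fun_ler.
have mG : measurable_fun setT G.
  apply: measurable_fun_ifT => //.
  by apply/measurable_EFinP; apply: measurableT_comp => //; apply/measurable_EFinP.
have G0 x : (0 <= G x)%E by rewrite /G; case: ifP => // _; rewrite lee_fin.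
have iG : (\int[mu]_(x in `]0%R, +oo[) G x < +oo)%E.
  rewrite -cov1_inv// (@le_lt_trans _ _ (\int[mu]_y v y)%E)//; last by rewrite iv ltey.
  apply: ge0_le_integral => //.
  - by move=> x _; rewrite mule_ge0// lee_fin; case: ifP => // x0; rewrite invr_ge0 sqr_ge0.
  - apply: emeasurable_funM.
      by apply: (measurableT_comp mG); exact: measurable_fun_inv.
    apply/measurable_EFinP; apply: measurable_fun_ifT => //.
      exact: measurable_fun_ltr.
    by apply: (measurableT_comp measurable_fun_inv); exact: measurable_funX.
  move=> u _; case: ifPn => u0; last by rewrite mule0.
  rewrite /G; case: ifPn => u1; last by rewrite mul0e.
  have u1' : 1 <= u by rewrite -(invr1 R) lef_pV2 ?posrE in u1.
  rewrite /v patchE mem_set; last by rewrite /= in_itv/= u1'.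
  have s0 : 0 < Num.sqrt u by rewrite sqrtr_gt0.
  rewrite -EFinM lee_fin /q sqrtrV ?(ltW u0)// ger0_norm.
    have uE : u = Num.sqrt u * Num.sqrt u by rewrite -expr2 sqr_sqrtr ?ltW.
    have -> : ((Num.sqrt u)^-1 * (u^-1 + 1))^-1 / u ^+ 2 = Num.sqrt u * (u * (1 + u))^-1.
      by field; rewrite !gt_eqF// addr_gt0.
    have -> : r u = Num.sqrt u * (u * u)^-1.
      rewrite /r [in RHS](_ : u * u = u * Num.sqrt u * Num.sqrt u).
        by field; rewrite !gt_eqF.
      by rewrite -mulrA -uE.
    rewrite ler_wpM2l ?(ltW s0)// lef_pV2 ?posrE ?mulr_gt0 ?addr_gt0//.
    by rewrite ler_wpM2l ?(ltW u0)// lerDr.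
  by rewrite invr_ge0 mulr_ge0 ?invr_ge0 ?ltW// addr_gt0 ?invr_gt0.
apply: (@le_lt_trans _ _ (\int[mu]_(x in `]0%R, +oo[) (G x + v x))%E).
  apply: ge0_le_integral => //.
  - move=> x; rewrite /= in_itv/= andbT => x0.
    by rewrite lee_fin invr_ge0 mulr_ge0 ?sqrtr_ge0// addr_ge0 ?ltW.
  - exact: measurable_funTS.
  - by apply: measurable_funTS; exact: emeasurable_funD.
  move=> x; rewrite /= in_itv/= andbT => x0.
  rewrite /G; case: ifPn => x1; first by rewrite -[leLHS]adde0 leeD// lee_fin ler_norm.
  rewrite add0e /v patchE mem_set; last by rewrite /= in_itv/= andbT ltW// ltNge.
  have s0 : 0 < Num.sqrt x by rewrite sqrtr_gt0.
  rewrite lee_fin lef_pV2 ?posrE ?mulr_gt0 ?addr_gt0//.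
  by rewrite mulrC ler_wpM2l ?(ltW s0)// lerDl.
rewrite ge0_integralD//; last 2 first.
- exact: measurable_funTS.
- exact: measurable_funTS.
rewrite lte_add_pinfty//; apply: (@le_lt_trans _ _ (\int[mu]_y v y)%E).
  exact: ge0_subset_integral.
by rewrite iv ltey.
Qed.

(** [schur_kernel] for l = 0 and w = 1, to which the general one is reduced. *)
Definition schur_weight (p : T2) : R := (Num.sqrt p.1)^-1 * ((p.1 + 1) ^+ 2 + p.2 ^+ 2)^-1.

Lemma schur_weight_ge0 p : 0 <= schur_weight p.
Proof. by rewrite mulr_ge0 ?invr_ge0 ?sqrtr_ge0 ?addr_ge0 ?sqr_ge0. Qed.

Lemma measurable_schur_weight : measurable_fun setT schur_weight.
Proof.
have mfst : measurable_fun setT (fst : T2 -> measurableTypeR R) by exact: measurable_fst.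
have msnd : measurable_fun setT (snd : T2 -> measurableTypeR R) by exact: measurable_snd.
apply: measurable_funM; apply: (measurableT_comp measurable_fun_inv).
  exact: (measurableT_comp measurable_sqrt).
by apply: measurable_funD; apply: measurable_funX => //; exact: measurable_funD.
Qed.

(** Integrating in y first, with y = (x + 1) v, leaves a multiple of 1 / (sqrt x (x + 1)). *)
Lemma schur_weight_lty : (\int[area]_(p in H) (schur_weight p)%:E < +oo)%E.
Proof.
have mH := @measurable_half_plane R.
have mW : measurable_fun setT (fun p : T2 => (schur_weight p)%:E).
  by apply/measurable_EFinP; exact: measurable_schur_weight.
rewrite integral_mkcond /area/= (@fubini_tonelli1 _ _ _ _ _ mu mu)/=; last 2 first.
- exact: measurable_patch.
- by move=> p; apply: erestrict_ge0 => q _; rewrite lee_fin schur_weight_ge0.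
have mI : measurable_fun setT (fun y : R => ((1 + y ^+ 2)^-1)%:E).
  apply/measurable_EFinP; apply: (measurableT_comp measurable_fun_inv).
  by apply: measurable_funD => //; exact: measurable_funX.
have I0 (y : R) : (0 <= ((1 + y ^+ 2)^-1)%:E)%E.
  by rewrite lee_fin invr_ge0 addr_ge0// sqr_ge0.
set I := (\int[mu]_y ((1 + y ^+ 2)^-1)%:E)%E.
have Ige0 : (0 <= I)%E by exact: integral_ge0.
have Ioo : (I < +oo)%E := integral_inv_oneDsqr_lty.
pose u (x : R) := (Num.sqrt x * (x + 1))^-1.
have mu' : measurable_fun setT (fun x : R => (u x)%:E).
  apply/measurable_EFinP; apply: (measurableT_comp measurable_fun_inv).
  by apply: measurable_funM; [exact: measurable_sqrt|exact: measurable_funD].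
set E := (X in (\int[mu]_x X x)%E).
have -> : E = ((fun x : measurableTypeR R => (u x)%:E * I) \_ `]0%R, +oo[%classic)%E.
  apply/funext => x; rewrite /E /fubini_F [RHS]patchE mem_setE in_itv/= andbT.
  case: ifPn => x0; last first.
    rewrite (eq_integral (cst 0%E)) ?integral0// => y _.
    by rewrite patchE memNset// /half_plane/=; exact/negP.
  have x1 : 0 < x + 1 by rewrite addr_gt0.
  have s0 : 0 < Num.sqrt x by rewrite sqrtr_gt0.
  have a0 : (x + 1)^-1 != 0 by rewrite invr_eq0 gt_eqF.
  rewrite /I -(cov1_affine 0 a0 mI I0) -ge0_integralZl//; last 3 first.
  - apply: emeasurable_funM; last exact: measurable_cst.
    apply: (measurableT_comp mI); apply: measurable_funD => //; exact: measurable_funM.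
  - by move=> y _; rewrite mule_ge0// lee_fin.
  - by rewrite lee_fin invr_ge0 mulr_ge0// ltW.
  apply: eq_integral => y _; rewrite patchE mem_set// /schur_weight/= -!EFinM; congr EFin.
  rewrite gtr0_norm ?invr_gt0// addr0 /u.
  have n0 : (x + 1) ^+ 2 + y ^+ 2 != 0 by rewrite gt_eqF// ltr_wpDr ?sqr_ge0// exprn_gt0.
  field; rewrite n0 !gt_eqF//.
rewrite -integral_mkcond ge0_integralZr//; last 2 first.
- exact: measurable_funTS.
- move=> x; rewrite /= in_itv/= andbT => x0.
  by rewrite lee_fin invr_ge0 mulr_ge0 ?sqrtr_ge0// addr_ge0 ?ltW.
have := integral_inv_sqrt_lty; rewrite -/u.
case: (I) Ige0 Ioo => // r r0 _ h; rewrite muleC lte_mul_pinfty//.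
Qed.

Definition schur_const : R := fine (\int[area]_(p in H) (schur_weight p)%:E)%E.

Lemma schur_const_ge0 : 0 <= schur_const.
Proof.
by apply: fine_ge0; apply: integral_ge0 => p _; rewrite lee_fin schur_weight_ge0.
Qed.

(** The integrand of Schur's test: the modulus of the kernel at w, the weight x^l, and the test
    function x^(-1/2). *)
Definition schur_kernel (l : nat) (w : C) (p : T2) : R :=
  p.1 ^+ l / (Num.sqrt p.1 * modulus (cplx p + w^*%C) ^+ (l + 2)).

Lemma schur_kernel_ge0 l w (p : T2) : H p -> 0 <= schur_kernel l w p.
Proof.
move=> p0; rewrite divr_ge0// ?mulr_ge0 ?sqrtr_ge0 ?exprn_ge0 ?modulus_ge0//.
exact: ltW.
Qed.

Lemma measurable_schur_kernel l w : measurable_fun setT (schur_kernel l w).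
Proof.
have mfst : measurable_fun setT (fst : T2 -> measurableTypeR R) by exact: measurable_fst.
apply: measurable_funM; first exact: measurable_funX.
apply: (measurableT_comp measurable_fun_inv); apply: measurable_funM.
  exact: (measurableT_comp measurable_sqrt).
apply: measurable_funX; apply: measurable_modulus.
by apply: cmeasD; [exact: cmeas_cplx|exact: cmeas_cst].
Qed.

(* Rescaling by Re w reduces to w = 1. *)
Lemma schur_kernel_le l (w : C) : 0 < complex.Re w ->
  (\int[area]_(p in H) (schur_kernel l w p)%:E <=
   (schur_const / Num.sqrt (complex.Re w))%:E)%E.
Proof.
move=> w0; set a := complex.Re w.
have mH := @measurable_half_plane R.
have aC : a%:C != 0 :> C by rewrite fmorph_eq0 gt_eqF.
have sa : 0 < Num.sqrt a by rewrite sqrtr_gt0.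
have mS : measurable_fun setT (fun p : T2 => (schur_kernel 0 w p)%:E).
  by apply/measurable_EFinP; exact: measurable_schur_kernel.
(* The power l is disposed of by x <= |z + conj w|. *)
have lep p : H p -> schur_kernel l w p <= schur_kernel 0 w p.
  move=> p0; rewrite /schur_kernel expr0 div1r add0n exprD mulrCA.
  set t := cplx p + w^*%C.
  have Ret : complex.Re t = p.1 + a by rewrite cReD cReJ.
  have t0 : 0 < modulus t by rewrite modulus_gt0; apply: cRe_eq0; rewrite Ret addr_gt0.
  have pt : p.1 <= modulus t.
    apply: le_trans (modulus_Re t); rewrite Ret (le_trans _ (ler_norm _))//.
    by rewrite lerDl ltW.
  have sp : 0 < Num.sqrt p.1 by rewrite sqrtr_gt0.
  rewrite ler_pdivrMr; last by rewrite !mulr_gt0 ?exprn_gt0.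
  rewrite [leRHS]mulrC mulfK; last by rewrite gt_eqF// mulr_gt0 ?exprn_gt0.
  by rewrite lerXn2r// ?nnegrE ltW.
apply: (@le_trans _ _ (\int[area]_(p in H) (schur_kernel 0 w p)%:E)%E).
  apply: ge0_le_integral => //.
  - by move=> p p0; rewrite lee_fin schur_kernel_ge0.
  - by apply: measurable_funTS; apply/measurable_EFinP; exact: measurable_schur_kernel.
  - exact: measurable_funTS.
pose G := (fun p : T2 => (schur_kernel 0 w p)%:E) \_ H.
have mG : measurable_fun setT G by exact: measurable_patch.
have G0 p : (0 <= G p)%E by apply: erestrict_ge0 => q q0; rewrite lee_fin schur_kernel_ge0.
have [_ _ _ _ HT] := cov_scaling (complex.Im w) w0.
have -> : (\int[area]_(p in H) (schur_kernel 0 w p)%:E = \int[area]_(p in H) G p)%E.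
  by apply: eq_integral => p pH; rewrite /G patchE pH.
rewrite -HT//.
have -> : ((schur_const / Num.sqrt a)%:E =
    \int[area]_(p in H) ((Num.sqrt a)^-1%:E * (schur_weight p)%:E))%E.
  rewrite ge0_integralZl//; last 2 first.
  - by apply: measurable_funTS; apply/measurable_EFinP; exact: measurable_schur_weight.
  - by move=> p _; rewrite lee_fin schur_weight_ge0.
  rewrite mulrC EFinM /schur_const fineK// ge0_fin_numE ?schur_weight_lty//.
  by apply: integral_ge0 => p _; rewrite lee_fin schur_weight_ge0.
rewrite [leRHS]integral_mkcond le_eqVlt; apply/orP; left; apply/eqP.
apply: eq_integral => p _; rewrite [RHS]patchE.
have -> : (p \in H) = (0 < p.1) by apply/idP/idP; rewrite inE.
case: ifPn => p0; last by rewrite mule0.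
rewrite /G patchE mem_set; last first.
  by rewrite /half_plane/mkset -[X in 0 < X]/(complex.Re (a%:C * cplx p + 'i * (complex.Im w)%:C)) Re_scaling mulr_gt0.
rewrite -!EFinM; congr EFin; rewrite /schur_kernel plK expr0 div1r add0n.
have -> : a%:C * cplx p + 'i * (complex.Im w)%:C + w^*%C = a%:C * (cplx p + 1).
  rewrite /a; case: (w) => x y; apply/eqP; rewrite eq_complex/=.
  by apply/andP; split; apply/eqP; ring.
rewrite modulusM exprMn modulus_real (ger0_norm (ltW w0)).
rewrite [(pl _).1](_ : _ = a * p.1); last exact: Re_scaling.
rewrite sqrtrM ?(ltW w0)// sqr_modulus cReD cImD /= addr0 /schur_weight.
have sp : 0 < Num.sqrt p.1 by rewrite sqrtr_gt0.
have n0 : (p.1 + 1) ^+ 2 + p.2 ^+ 2 != 0.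
  by rewrite gt_eqF// ltr_wpDr ?sqr_ge0// exprn_gt0// addr_gt0.
by field; rewrite n0 !gt_eqF.
Qed.

End SchurIntegral.

Section CFubini.
Context {R : realType}.
Local Notation C := R[i].
Local Notation T2 := (measurableTypeR R * measurableTypeR R)%type.
Local Notation H := (@half_plane R).

(** As Phi vanishes off the half planes, the integrals over them may be taken over whole planes,
    where [fubini_area] applies. *)
Lemma cint_fubini (Phi : T2 * T2 -> C) : cmeas Phi ->
  (forall p q, ~ H p -> Phi (p, q) = 0) -> (forall p q, ~ H q -> Phi (p, q) = 0) ->
  (forall p, H p -> cintegrable (fun q => Phi (p, q))) ->
  (forall q, H q -> cintegrable (fun p => Phi (p, q))) ->
  (\int[area]_p \int[area]_q (modulus (Phi (p, q)))%:E < +oo)%E ->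
  cint (fun p => cint (fun q => Phi (p, q))) = cint (fun q => cint (fun p => Phi (p, q))).
Proof.
move=> [m1 m2] o1 o2 i1 i2 abs.
have mH := @measurable_half_plane R.
have mE (u : T2 * T2 -> R) : measurable_fun setT u -> measurable_fun setT (fun x => (u x)%:E).
  by move=> mu; apply/measurable_EFinP.
have key (u : T2 * T2 -> R) : measurable_fun setT u ->
    (forall x, `|u x| <= modulus (Phi x)) ->
    (forall p, H p -> (@area R).-integrable H (fun q => (u (p, q))%:E)) ->
    (forall q, H q -> (@area R).-integrable H (fun p => (u (p, q))%:E)) ->
    Rintegral (@area R) H (fun p => Rintegral (@area R) H (fun q => u (p, q))) =
    Rintegral (@area R) H (fun q => Rintegral (@area R) H (fun p => u (p, q))).
  move=> mu' ule u1 u2.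
  have u01 p q : ~ H p -> u (p, q) = 0.
    move=> np; apply/eqP; rewrite -normr_le0 (le_trans (ule _))//.
    by rewrite o1// modulus0.
  have u02 p q : ~ H q -> u (p, q) = 0.
    move=> np; apply/eqP; rewrite -normr_le0 (le_trans (ule _))//.
    by rewrite o2// modulus0.
  rewrite /Rintegral; congr fine.
  transitivity (\int[area]_p \int[area]_q (u (p, q))%:E)%E.
    rewrite integral_mkcond; apply: eq_integral => p _; rewrite patchE.
    case: ifPn => [|/negP]; rewrite inE => pH.
      rewrite fineK; last exact: integrable_fin_num (u1 p pH).
      rewrite integral_mkcond; apply: eq_integral => q _; rewrite patchE.
      by case: ifPn => // /negP; rewrite inE => /u02 ->.
    by rewrite integral0_eq// => q _; rewrite u01.
  transitivity (\int[area]_q \int[area]_p (u (p, q))%:E)%E.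
    apply: (fubini_area (mE _ mu')); apply: le_lt_trans abs.
    apply: ge0_le_integral => //.
    - by move=> p _; exact: integral_ge0.
    - apply: (measurable_area_section1 (f := fun x => `|(u x)%:E|%E)) => //.
      by apply: measurableT_comp => //; exact: mE.
    - apply: (measurable_area_section1 (f := fun x => (modulus (Phi x))%:E)).
        by apply: mE; exact: measurable_modulus.
      by move=> x; rewrite lee_fin modulus_ge0.
    move=> p _; apply: ge0_le_integral => //.
    - apply: measurableT_comp => //.
      exact: (measurableT_comp (mE _ mu') (measurable_pair1 p)).
    - apply: (measurableT_comp (f := fun x => (modulus (Phi x))%:E)).
        by apply: mE; exact: measurable_modulus.
      exact: (measurable_pair1 p).
    by move=> q _; rewrite lee_fin ule.
  rewrite [RHS]integral_mkcond; apply: eq_integral => q _; rewrite patchE.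
  case: ifPn => [|/negP]; rewrite inE => qH.
    rewrite fineK; last exact: integrable_fin_num (u2 q qH).
    rewrite [RHS]integral_mkcond; apply: eq_integral => p _; rewrite patchE.
    by case: ifPn => // /negP; rewrite inE => /u01 ->.
  by rewrite integral0_eq// => p _; rewrite u02.
have kR := key (fun x => complex.Re (Phi x)) m1 (fun x => modulus_Re (Phi x))
  (fun p pH => (i1 p pH).1) (fun q qH => (i2 q qH).1).
have kI := key (fun x => complex.Im (Phi x)) m2 (fun x => modulus_Im (Phi x))
  (fun p pH => (i1 p pH).2) (fun q qH => (i2 q qH).2).
apply/eqP; rewrite eq_complex; apply/andP; split; apply/eqP; [exact: kR|exact: kI].
Qed.
End CFubini.

(** * Boundedness and adjoints of weighted composition operators *)

Section WeightedComposition.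
Context {R : realType} (l : nat).
Local Notation C := R[i].
Local Notation T2 := (measurableTypeR R * measurableTypeR R)%type.
Local Notation H := (@half_plane R).
Local Notation Z := (l + 2)%N.
Variables (f : Cplus R -> C) (g : Cplus R -> Cplus R).
Hypotheses (hf : analytic f) (hg : analytic_self g).
Implicit Types (h k : Cplus R -> C).

Let mH : measurable (H : set T2) := @measurable_half_plane R.

Definition wcomp h : Cplus R -> C := fun z => f z * h (g z).

Definition gext : C -> C := ext (fun z => val (g z)).

Lemma Re_gext z : 0 < complex.Re z -> 0 < complex.Re (gext z).
Proof. by move=> z0; rewrite /gext ext_in; case: (g _). Qed.

Lemma ext_wcomp h z : 0 < complex.Re z ->
  ext (wcomp h) z = ext f z * ext h (gext z).
Proof. move=> z0.
by rewrite /gext (ext_in (wcomp h) z0) (ext_in f z0) (ext_in (fun z => val (g z)) z0) /wcomp extE. Qed.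

Lemma analytic_wcomp h : analytic h -> analytic (wcomp h).
Proof.
move=> ah; apply: (@analytic_of_cder R _ (fun z => ext f z * ext h (gext z))); last first.
  by move=> [z z0]; rewrite -ext_wcomp// extE.
move=> [z z0]; apply: cderM; first exact: analytic_cder.
have dg : cder gext z by exact: (analytic_cder hg).
exact: (@cder_comp R (ext h) gext z dg (analytic_cder ah (Re_gext z0))).
Qed.

Let mtau : measurable_fun setT (fun p : T2 => pl (gext (cplx p)) : T2).
Proof. by apply: measurable_pl; exact: (cmeas_ext hg). Qed.

Let mfst : measurable_fun setT (fst : T2 -> measurableTypeR R).
Proof. exact: measurable_fst. Qed.

Let mF : measurable_fun setT (fun p : T2 => modulus (ext f (cplx p)) ^+ 2).
Proof. by apply: measurable_funX; apply: measurable_modulus; exact: cmeas_ext. Qed.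

Let mpow : measurable_fun setT (fun p : T2 => (p.1 ^+ l)%:E).
Proof. by apply/measurable_EFinP; exact: measurable_funX. Qed.

Let pow0 (p : T2) : H p -> 0 <= p.1 ^+ l.
Proof. by move=> p0; rewrite exprn_ge0// ltW. Qed.

(** A Carleson condition: the image under g of |f|^2 x^l dx dy is at most M times x^l dx dy. All
    nonnegative G are allowed because Schur's test applies it to a G that is not the square of an
    analytic function. *)
Definition dominated (M : R) := forall G : T2 -> \bar R,
  measurable_fun setT G -> (forall p, (0 <= G p)%E) ->
  (\int[area]_(p in H) ((p.1 ^+ l * modulus (ext f (cplx p)) ^+ 2)%:E *
      G (pl (gext (cplx p)))) <=
   M%:E * \int[area]_(p in H) ((p.1 ^+ l)%:E * G p))%E.

(** Reduces domination to a pointwise bound of |f|^2 by the Jacobian of g. *)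
Lemma dominated_of_cov (T : T2 -> T2) J S M : cov T J S -> 0 <= M ->
  (forall p, H p -> T p = pl (gext (cplx p))) ->
  (forall p, H p -> p.1 ^+ l * modulus (ext f (cplx p)) ^+ 2 <=
     M * (complex.Re (gext (cplx p)) ^+ l * J p)) -> dominated M.
Proof.
move=> [mT mJ J0 mS HT] M0 TE wM G mG G0.
pose K := (fun q : T2 => (q.1 ^+ l)%:E * G q)%E \_ H.
have mK : measurable_fun setT K by apply: measurable_patch => //; exact: emeasurable_funM.
have K0 p : (0 <= K p)%E by apply: erestrict_ge0 => q q0; rewrite mule_ge0// lee_fin pow0.
have mKT : measurable_fun setT (fun p => K (T p) * (J p)%:E)%E.
  apply: emeasurable_funM; first exact: (measurableT_comp mK).
  exact/measurable_EFinP.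
have KT0 p : (0 <= K (T p) * (J p)%:E)%E by rewrite mule_ge0// lee_fin.
apply: (@le_trans _ _ (\int[area]_(p in H) (M%:E * (K (T p) * (J p)%:E)))%E).
  apply: ge0_le_integral => //.
  - by move=> p p0; rewrite mule_ge0// lee_fin mulr_ge0 ?pow0// sqr_ge0.
  - apply: measurable_funTS; apply: emeasurable_funM; last exact: (measurableT_comp mG).
    by apply/measurable_EFinP; apply: measurable_funM => //; exact: measurable_funX.
  - by apply: measurable_funTS; exact: emeasurable_funM.
  move=> p p0; rewrite TE// /K patchE mem_set; last exact: (Re_gext (z := cplx p)).
  rewrite muleAC muleA -!EFinM lee_wpmul2r// lee_fin.
  exact: wM.
rewrite ge0_integralZl//; last exact: measurable_funTS.
rewrite lee_wpmul2l//; apply: (@le_trans _ _ (\int[area]_p (K (T p) * (J p)%:E))%E).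
  exact: ge0_subset_integral.
rewrite HT// [leRHS]integral_mkcond -/K; exact: ge0_subset_integral.
Qed.

Section bounded.
Variable M : R.
Hypotheses (M0 : 0 <= M) (fgM : dominated M).

Lemma wcomp_integral_le h : analytic h ->
  (\int[area]_(p in H) (weighted_sq l (wcomp h) p)%:E <=
   M%:E * \int[area]_(p in H) (weighted_sq l h p)%:E)%E.
Proof.
move=> ah; pose G (p : T2) := ((modulus (ext h (cplx p)) ^+ 2)%:E).
have mG : measurable_fun setT G.
  by apply/measurable_EFinP; apply: measurable_funX; apply: measurable_modulus; exact: cmeas_ext.
have G0 p : (0 <= G p)%E by rewrite lee_fin sqr_ge0.
have := fgM mG G0; congr (_ <= _ * _)%E.
apply: eq_integral => p; rewrite inE => p0.
have -> : weighted_sq l (wcomp h) p = p.1 ^+ l * modulus (ext f (cplx p)) ^+ 2 *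
    modulus (ext h (gext (cplx p))) ^+ 2 by rewrite /weighted_sq ext_wcomp// modulusM; ring.
by rewrite /G plK.
Qed.

Lemma bergman_wcomp h : bergman l h -> bergman l (wcomp h).
Proof.
move=> /bergmanP[ah ih]; apply/bergmanP; split; first exact: analytic_wcomp.
by apply: (le_lt_trans (wcomp_integral_le ah)); rewrite lte_mul_pinfty// lee_fin.
Qed.

Lemma bnorm_wcomp h : bergman l h -> bnorm l (wcomp h) <= Num.sqrt M * bnorm l h.
Proof.
move=> bh; have /bergmanP[ah ih] := bh.
have /bergmanP[aw iw] := bergman_wcomp bh.
rewrite -ler_sqr ?nnegrE ?mulr_ge0 ?bnorm_ge0 ?sqrtr_ge0// exprMn (sqr_sqrtr M0).
rewrite !bnorm_sqr mulrCA ler_wpM2l ?invr_ge0 ?pi_ge0//.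
have fin k : (\int[area]_(p in H) (weighted_sq l k p)%:E < +oo ->
    \int[area]_(p in H) (weighted_sq l k p)%:E \is a fin_num)%E.
  move=> ik; rewrite ge0_fin_numE//.
  by apply: integral_ge0 => p p0; rewrite lee_fin weighted_sq_ge0.
by rewrite /Rintegral -lee_fin EFinM !fineK ?fin// wcomp_integral_le.
Qed.

End bounded.

Lemma realC_neq0 (x : R) : x != 0 -> x%:C != 0 :> C.
Proof. by rewrite fmorph_eq0. Qed.

Lemma eq_cintegrable (F G : T2 -> C) : (forall p, H p -> F p = G p) ->
  cintegrable F -> cintegrable G.
Proof.
move=> FG [F1 F2]; split; [move: F1|move: F2]; apply: eq_integrable => // p;
  by rewrite inE => /FG ->.
Qed.

Lemma cint_inner h k : cint (pairing l h k) = pi%:C * inner l h k.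
Proof.
by rewrite innerE mulrA -rmorphM mulfV ?mul1r// gt_eqF// pi_gt0.
Qed.

Lemma cintegrableJ (F : T2 -> C) : cintegrable F -> cintegrable (fun p => (F p)^*%C).
Proof.
move=> [j1 j2]; split; first by apply: eq_integrable j1 => // p _; case: (F p).
have := integrableZl mH (-1) j2; apply: eq_integrable => // p _.
by rewrite -EFinM mulN1r; case: (F p).
Qed.

Section adjoint.
Variable M : R.
Hypotheses (M0 : 0 <= M) (fgM : dominated M).
Variables h k : Cplus R -> C.
Hypotheses (bh : bergman l h) (bk : bergman l k).

Let D (z w : C) : C := (gext z + w^*%C) ^+ Z.
Let A (p : T2) : C := (p.1 ^+ l)%:C * (ext f (cplx p) * (ext k (cplx p))^*%C).
Let B (q : T2) : C := (q.1 ^+ l)%:C * ext h (cplx q).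
(** Integrating in q reproduces h at g(p) and leaves the integrand of <W h, k>; integrating in p
    pairs k with W applied to the kernel at q and leaves that of <h, V>. *)
Let Phi (x : T2 * T2) : C := A x.1 * (B x.2 * (D (cplx x.1) (cplx x.2))^-1).

Let ah : analytic h. Proof. by case: bh. Qed.
Let ak : analytic k. Proof. by case: bk. Qed.

Let cmeas_D : cmeas (fun x : T2 * T2 => D (cplx x.1) (cplx x.2)).
Proof.
apply: cmeasX; apply: cmeasD.
  exact: (cmeas_comp (cmeas_ext hg) (measurable_fst : measurable_fun setT (fst : T2 * T2 -> T2))).
apply: cmeasJ.
exact: (cmeas_comp cmeas_cplx (measurable_snd : measurable_fun setT (snd : T2 * T2 -> T2))).
Qed.

Let cmeas_Phi : cmeas Phi.
Proof.
have cA : cmeas A.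
  apply: cmeasM; first by apply: cmeas_real; exact: measurable_funX.
  by apply: cmeasM; [exact: cmeas_ext|apply: cmeasJ; exact: cmeas_ext].
have cB : cmeas B.
  apply: cmeasM; first by apply: cmeas_real; exact: measurable_funX.
  exact: cmeas_ext.
apply: cmeasM.
  exact: (cmeas_comp cA (measurable_fst : measurable_fun setT (fst : T2 * T2 -> T2))).
apply: cmeasM; last exact: cmeasV.
exact: (cmeas_comp cB (measurable_snd : measurable_fun setT (snd : T2 * T2 -> T2))).
Qed.

Let Phi_out1 p q : ~ H p -> Phi (p, q) = 0.
Proof. by move=> /negP; rewrite -leNgt => p0; rewrite /Phi /A/= ext_out// mul0r mulr0 mul0r. Qed.

Let Phi_out2 p q : ~ H q -> Phi (p, q) = 0.
Proof.
by move=> /negP; rewrite -leNgt => q0; rewrite /Phi /B/= (ext_out h)// mulr0 mul0r mulr0.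
Qed.

Let Phi_row p q : H p -> H q ->
  Phi (p, q) = A p * pairing l h (kernel l (gext (cplx p))) q.
Proof.
move=> pH qH; rewrite /Phi /pairing ext_kernel// /B /= -mulrA; congr (_ * (_ * (_ * _))).
by rewrite conj_inv conjX conjD conjcK addrC.
Qed.

Let Phi_col p q : H p -> H q ->
  Phi (p, q) = B q * (pairing l k (wcomp (kernel l (cplx q))) p)^*%C.
Proof.
move=> pH qH; rewrite /Phi /pairing ext_wcomp// ext_kernel ?Re_gext//.
by rewrite conjM conj_re conjM conjcK /A /D /=; ring.
Qed.

(* The two halves of Schur's test with weight (Re w / Re g(z))^(1/2). *)
Let U1 (x : T2 * T2) : R := (x.1.1 ^+ l * modulus (ext f (cplx x.1)) ^+ 2) *
  ((weighted_sq l h x.2 * Num.sqrt x.2.1) *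
   (Num.sqrt (complex.Re (gext (cplx x.1))) * modulus (D (cplx x.1) (cplx x.2)))^-1).
Let U2 (x : T2 * T2) : R := (weighted_sq l k x.1 * Num.sqrt (complex.Re (gext (cplx x.1)))) *
  ((if 0 < x.2.1 then x.2.1 ^+ l else 0) /
   (Num.sqrt x.2.1 * modulus (D (cplx x.1) (cplx x.2)))).

Let weighted_sq_out d (p : T2) : ~ H p -> weighted_sq l d p = 0.
Proof.
by move=> /negP; rewrite -leNgt => p0; rewrite /weighted_sq ext_out// modulus0 expr0n mulr0.
Qed.

Let weighted_sq_ge0' d (p : T2) : 0 <= weighted_sq l d p.
Proof.
by have [pH|pH] := pselect (H p); [exact: weighted_sq_ge0|rewrite weighted_sq_out].
Qed.

Let U1_ge0 x : 0 <= U1 x.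
Proof.
apply: mulr_ge0; last first.
  apply: divr_ge0; apply: mulr_ge0;
    [exact: weighted_sq_ge0'|exact: sqrtr_ge0|exact: sqrtr_ge0|exact: modulus_ge0].
exact: (weighted_sq_ge0' f x.1).
Qed.

Let U2_ge0 x : 0 <= U2 x.
Proof.
apply: mulr_ge0; first by rewrite mulr_ge0 ?weighted_sq_ge0' ?sqrtr_ge0.
rewrite divr_ge0 ?mulr_ge0 ?sqrtr_ge0 ?modulus_ge0//.
by case: ifP => // x0; rewrite exprn_ge0// ltW.
Qed.

Let m1 : measurable_fun setT (fst : T2 * T2 -> T2). Proof. exact: measurable_fst. Qed.
Let m2 : measurable_fun setT (snd : T2 * T2 -> T2). Proof. exact: measurable_snd. Qed.

Let msq (d : Cplus R -> C) : analytic d -> measurable_fun setT (weighted_sq l d).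
Proof. exact: measurable_weighted_sq. Qed.

Let mRe : measurable_fun setT (fun x : T2 * T2 => Num.sqrt (complex.Re (gext (cplx x.1)))).
Proof.
have := measurableT_comp (@measurable_sqrt R) (measurableT_comp (cmeas_ext hg).1 m1).
exact.
Qed.

Let msqrt2 : measurable_fun setT (fun x : T2 * T2 => Num.sqrt x.2.1).
Proof. by have := measurableT_comp (@measurable_sqrt R) (measurableT_comp mfst m2). Qed.

Let mD : measurable_fun setT (fun x : T2 * T2 => modulus (D (cplx x.1) (cplx x.2))).
Proof. exact: measurable_modulus. Qed.

Let measurable_U1 : measurable_fun setT U1.
Proof.
apply: measurable_funM; first exact: (measurableT_comp (msq hf) m1).
apply: measurable_funM.
  by apply: measurable_funM => //; exact: (measurableT_comp (msq ah) m2).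
by apply: (measurableT_comp (@measurable_fun_inv R)); exact: measurable_funM.
Qed.

Let measurable_U2 : measurable_fun setT U2.
Proof.
apply: measurable_funM.
  by apply: measurable_funM => //; exact: (measurableT_comp (msq ak) m1).
apply: measurable_funM; last first.
  by apply: (measurableT_comp (@measurable_fun_inv R)); exact: measurable_funM.
have mi : measurable_fun setT (fun q : T2 => if 0 < q.1 then q.1 ^+ l else 0).
  by apply: measurable_fun_ifT => //; [exact: measurable_fun_ltr|exact: measurable_funX].
exact: (measurableT_comp mi m2).
Qed.

Let mod_D p q : modulus (D (cplx p) (cplx q)) =
  modulus (cplx q + (gext (cplx p))^*%C) ^+ Z.
Proof.
by rewrite /D modulusX -modulusJ conjD conjcK addrC.
Qed.

Let D_gt0 p q : H p -> H q -> 0 < modulus (D (cplx p) (cplx q)).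
Proof.
move=> pH qH; rewrite modulus_gt0 expf_neq0//; apply: kernel_arg => //.
exact: (Re_gext (z := cplx p)).
Qed.

Let Phi_le p q : modulus (Phi (p, q)) <= U1 (p, q) + U2 (p, q).
Proof.
have [pH|pH] := pselect (H p); last first.
  by rewrite Phi_out1// modulus0 addr_ge0.
have [qH|qH] := pselect (H q); last first.
  by rewrite Phi_out2// modulus0 addr_ge0.
have D0 := D_gt0 pH qH.
have s1 : 0 < Num.sqrt q.1 by rewrite sqrtr_gt0.
have s2 : 0 < Num.sqrt (complex.Re (gext (cplx p))).
  by rewrite sqrtr_gt0; exact: (Re_gext (z := cplx p)).
rewrite /Phi /A /B /U1 /U2 /weighted_sq /= !modulusM modulusV modulusJ !modulus_real.
rewrite !(ger0_norm (pow0 _))// (_ : 0 < q.1 = true)//.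
have := pow0 pH; have := pow0 qH.
move: (modulus (D _ _)) D0 (Num.sqrt q.1) s1 (Num.sqrt _) s2 => d d0 u u0 v v0.
move: (modulus (ext f _)) (modulus_ge0 (ext f (cplx p))) => F F0.
move: (modulus (ext h _)) (modulus_ge0 (ext h (cplx q))) => h' h0.
move: (modulus (ext k _)) (modulus_ge0 (ext k (cplx p))) => k' k0.
move: (p.1 ^+ l) (q.1 ^+ l) => a b b0 a0.
rewrite -subr_ge0.
(* For x = F h' u and y = k' v, the difference is a positive multiple of x^2 + y^2 - x y. *)
have -> : a * F ^+ 2 * (b * h' ^+ 2 * u * (v * d)^-1) + a * k' ^+ 2 * v * (b / (u * d)) -
    a * (F * k') * (b * h' / d) =
    a * b / d * (u * v)^-1 * ((F * h' * u - k' * v) ^+ 2 + F * h' * k' * u * v).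
  by field; rewrite !gt_eqF.
by rewrite mulr_ge0 ?addr_ge0 ?sqr_ge0 ?mulr_ge0 ?invr_ge0 ?mulr_ge0// ltW.
Qed.

(** With q fixed, domination replaces g(p) by a free variable; [schur_kernel_le] then produces 1 /
    sqrt(Re q), which the factor sqrt(Re q) in [U1] cancels. *)
Let iter_U1 : (\int[area]_p \int[area]_q (U1 (p, q))%:E < +oo)%E.
Proof.
have mU : measurable_fun setT (fun x : T2 * T2 => (U1 x)%:E) by exact/measurable_EFinP.
rewrite (tonelli_area mU); last by move=> x; rewrite lee_fin.
have [_ ih] := (bergmanP l h).1 bh.
pose S : \bar R := (\int[area]_(q in H)
    ((M * schur_const)%:E * (weighted_sq l h q)%:E))%E.
apply: (@le_lt_trans _ _ S); rewrite /S; last first.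
  rewrite ge0_integralZl//; last 3 first.
  - by apply: measurable_funTS; apply/measurable_EFinP; exact: msq.
  - by move=> p _; rewrite lee_fin.
  - by rewrite lee_fin mulr_ge0// schur_const_ge0.
  by rewrite lte_mul_pinfty// lee_fin mulr_ge0// schur_const_ge0.
rewrite [leRHS]integral_mkcond; apply: ge0_le_integral => //.
- by move=> q _; apply: integral_ge0 => p _; rewrite lee_fin.
- by apply: (measurable_area_section2 (f := fun x => (U1 x)%:E)) => // x; rewrite lee_fin.
- apply: measurable_patch => //; apply: emeasurable_funM => //.
  by apply/measurable_EFinP; exact: msq.
move=> q _; rewrite patchE; case: ifPn => [|/negP]; rewrite inE => qH; last first.
  by rewrite integral0_eq// => p _; rewrite /U1 weighted_sq_out//= !mul0r mulr0.
have q0 : 0 < Num.sqrt q.1 by rewrite sqrtr_gt0.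
pose G (p : T2) : \bar R := ((weighted_sq l h q * Num.sqrt q.1) *
   (Num.sqrt p.1 * modulus (cplx p + (cplx q)^*%C) ^+ Z)^-1)%:E.
have G0 p : (0 <= G p)%E.
  rewrite lee_fin; apply: divr_ge0; apply: mulr_ge0;
    [exact: weighted_sq_ge0'|exact: sqrtr_ge0|exact: sqrtr_ge0|].
  by rewrite exprn_ge0// modulus_ge0.
have mG : measurable_fun setT G.
  apply/measurable_EFinP; apply: measurable_funM => //.
  apply: (measurableT_comp (@measurable_fun_inv R)); apply: measurable_funM.
    exact: (measurableT_comp (@measurable_sqrt R)).
  apply: measurable_funX; apply: measurable_modulus.
  by apply: cmeasD; [exact: cmeas_cplx|exact: cmeas_cst].
apply: (@le_trans _ _ (\int[area]_(p in H) ((p.1 ^+ l * modulus (ext f (cplx p)) ^+ 2)%:E *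
      G (pl (gext (cplx p)))))%E).
  rewrite [leRHS]integral_mkcond le_eqVlt; apply/orP; left; apply/eqP.
  apply: eq_integral => p _; rewrite patchE; case: ifPn => [|/negP]; rewrite inE => pH.
    by rewrite -EFinM /G plK /U1/= modulusX.
  by rewrite /U1 -[_ * _ ^+ 2]/(weighted_sq l f p) weighted_sq_out// mul0r.
apply: (le_trans (fgM mG G0)).
rewrite EFinM -muleA lee_wpmul2l//.
rewrite (eq_integral (fun p : T2 => (weighted_sq l h q * Num.sqrt q.1)%:E *
   (schur_kernel l (cplx q) p)%:E)%E); last first.
  by move=> p _; rewrite /G /schur_kernel -!EFinM; congr EFin; rewrite mulrCA.
rewrite ge0_integralZl//; last 3 first.
- by apply: measurable_funTS; apply/measurable_EFinP; exact: measurable_schur_kernel.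
- by move=> p pH; rewrite lee_fin schur_kernel_ge0.
- by rewrite lee_fin mulr_ge0// ltW.
apply: (@le_trans _ _ ((weighted_sq l h q * Num.sqrt q.1)%:E *
    (schur_const / Num.sqrt q.1)%:E)%E).
  rewrite lee_wpmul2l//; first by rewrite lee_fin mulr_ge0// ltW.
  exact: (@schur_kernel_le R l (cplx q)).
rewrite -!EFinM lee_fin le_eqVlt; apply/orP; left; apply/eqP.
by field; rewrite gt_eqF.
Qed.

(** Here q is integrated first, against the kernel at g(p); the resulting 1 / sqrt(Re g(p)) cancels
    the factor in [U2]. *)
Let iter_U2 : (\int[area]_p \int[area]_q (U2 (p, q))%:E < +oo)%E.
Proof.
have mU : measurable_fun setT (fun x : T2 * T2 => (U2 x)%:E) by exact/measurable_EFinP.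
have [_ ik] := (bergmanP l k).1 bk.
pose S : \bar R := (\int[area]_(p in H)
    (schur_const%:E * (weighted_sq l k p)%:E))%E.
apply: (@le_lt_trans _ _ S); rewrite /S; last first.
  rewrite ge0_integralZl//; last 3 first.
  - by apply: measurable_funTS; apply/measurable_EFinP; exact: msq.
  - by move=> p _; rewrite lee_fin.
  - by rewrite lee_fin schur_const_ge0.
  by rewrite lte_mul_pinfty// lee_fin schur_const_ge0.
rewrite [leRHS]integral_mkcond; apply: ge0_le_integral => //.
- by move=> q _; apply: integral_ge0 => p _; rewrite lee_fin.
- by apply: (measurable_area_section1 (f := fun x => (U2 x)%:E)) => // x; rewrite lee_fin.
- apply: measurable_patch => //; apply: emeasurable_funM => //.
  by apply/measurable_EFinP; exact: msq.
move=> p _; rewrite patchE; case: ifPn => [|/negP]; rewrite inE => pH; last first.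
  by rewrite integral0_eq// => q _; rewrite /U2 weighted_sq_out//= !mul0r.
have g0 := Re_gext (z := cplx p) pH.
have s0 : 0 < Num.sqrt (complex.Re (gext (cplx p))) by rewrite sqrtr_gt0.
apply: (@le_trans _ _ (\int[area]_(q in H)
   ((weighted_sq l k p * Num.sqrt (complex.Re (gext (cplx p))))%:E *
   (schur_kernel l (gext (cplx p)) q)%:E))%E).
  rewrite [leRHS]integral_mkcond le_eqVlt; apply/orP; left; apply/eqP.
  apply: eq_integral => q _; rewrite patchE; case: ifPn => [|/negP]; rewrite inE => qH.
    by rewrite -EFinM /U2 mod_D /schur_kernel/= (_ : 0 < q.1 = true).
  rewrite /U2/= ifN; first by rewrite mul0r mulr0.
  exact/negP.
rewrite ge0_integralZl//; last 3 first.
- by apply: measurable_funTS; apply/measurable_EFinP; exact: measurable_schur_kernel.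
- by move=> q qH; rewrite lee_fin schur_kernel_ge0.
- by rewrite lee_fin mulr_ge0// ltW.
apply: (@le_trans _ _ ((weighted_sq l k p * Num.sqrt (complex.Re (gext (cplx p))))%:E *
    (schur_const / Num.sqrt (complex.Re (gext (cplx p))))%:E)%E).
  rewrite lee_wpmul2l//; first by rewrite lee_fin mulr_ge0// ltW.
  exact: schur_kernel_le.
rewrite -!EFinM lee_fin le_eqVlt; apply/orP; left; apply/eqP.
by field; rewrite gt_eqF.
Qed.

Let Phi_abs_lty : (\int[area]_p \int[area]_q (modulus (Phi (p, q)))%:E < +oo)%E.
Proof.
have mE (u : T2 * T2 -> R) : measurable_fun setT u -> measurable_fun setT (fun x => (u x)%:E).
  by move=> mu; apply/measurable_EFinP.
have sec (u : T2 * T2 -> R) p : measurable_fun setT u -> measurable_fun setT (fun q => (u (p, q))%:E).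
  by move=> mu; exact: (measurableT_comp (mE _ mu) (measurable_pair1 p)).
have sec1 (u : T2 * T2 -> R) : measurable_fun setT u -> (forall x, 0 <= u x) ->
    measurable_fun setT (fun p => \int[area]_q (u (p, q))%:E)%E.
  move=> mu u0; apply: (measurable_area_section1 (f := fun x => (u x)%:E)); first exact: mE.
  by move=> x; rewrite lee_fin.
apply: (@le_lt_trans _ _ (\int[area]_p (\int[area]_q (U1 (p, q))%:E +
    \int[area]_q (U2 (p, q))%:E))%E).
  apply: ge0_le_integral => //.
  - by move=> p _; apply: integral_ge0 => q _; rewrite lee_fin modulus_ge0.
  - by apply: (sec1 (fun x => modulus (Phi x))); [exact: measurable_modulus|move=> x; exact: modulus_ge0].
  - by apply: emeasurable_funD; exact: sec1.
  move=> p _; rewrite -ge0_integralD//; last 4 first.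
  - by move=> q _; rewrite lee_fin.
  - exact: sec.
  - by move=> q _; rewrite lee_fin.
  - exact: sec.
  apply: ge0_le_integral => //.
  - by move=> q _; rewrite lee_fin modulus_ge0.
  - by apply: (sec (fun x => modulus (Phi x))); exact: measurable_modulus.
  - by apply: emeasurable_funD; exact: sec.
  - by move=> q _; rewrite -EFinD lee_fin Phi_le.
rewrite ge0_integralD//; last 4 first.
- by move=> p _; apply: integral_ge0 => q _; rewrite lee_fin.
- exact: sec1.
- by move=> p _; apply: integral_ge0 => q _; rewrite lee_fin.
- exact: sec1.
by apply: lte_add_pinfty; [exact: iter_U1|exact: iter_U2].
Qed.

(** V plays the role of W^* k. The hypothesis is the conjugate of the conclusion for h a kernel, and
    the exchange of integrals extends it to every h. *)
Theorem inner_wcomp (V : Cplus R -> C) : bergman l V ->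
  (forall w : C, 0 < complex.Re w ->
     inner l k (wcomp (kernel l w)) = (kernel_const l)%:C * ext V w) ->
  inner l (wcomp h) k = inner l h V.
Proof.
move=> bV HV; have bw w : 0 < complex.Re w -> bergman l (wcomp (kernel l w)).
  by move=> w0; apply: (bergman_wcomp M0 fgM); exact: bergman_kernel.
have bWh := bergman_wcomp M0 fgM bh.
have bker (p : T2) : H p -> bergman l (kernel l (gext (cplx p))).
  by move=> pH; apply: bergman_kernel; exact: Re_gext.
have i1 p : H p -> cintegrable (fun q => Phi (p, q)).
  move=> pH; apply: eq_cintegrable (cintegrableZ (A p) (cintegrable_pairing bh (bker p pH))).
  by move=> q qH; rewrite Phi_row.
have i2 q : H q -> cintegrable (fun p => Phi (p, q)).
  move=> qH; have ic := cintegrableJ (cintegrable_pairing bk (bw (cplx q) qH)).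
  apply: eq_cintegrable (cintegrableZ (B q) ic).
  by move=> p pH; rewrite Phi_col.
have FE := cint_fubini cmeas_Phi Phi_out1 Phi_out2 i1 i2 Phi_abs_lty.
(* The factor common to both iterated integrals: pi from passing between [cint] and [inner], the
   other constant from [reproducing]. *)
pose c1 : C := (pi * kernel_const l)%:C.
have c1E : c1 = pi%:C * (kernel_const l)%:C by exact: rmorphM.
have L : cint (fun p => cint (fun q => Phi (p, q))) = c1 * cint (pairing l (wcomp h) k).
  rewrite -(cintZ c1 (cintegrable_pairing bWh bk)).
  apply: eq_cint => p pH.
  transitivity (cint (fun q => A p * pairing l h (kernel l (gext (cplx p))) q)).
    by apply: eq_cint => q qH; exact: Phi_row.
  rewrite (cintZ _ (cintegrable_pairing bh (bker p pH))).
  rewrite (cint_inner h) (reproducing bh (Re_gext (z := cplx p) pH)) c1E /pairing.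
  rewrite (ext_wcomp h (z := cplx p) pH) /A; clear.
  move: (ext f _) (ext h _) (ext k _)^*%C (pi%:C) (p.1 ^+ l)%:C (kernel_const l)%:C.
  by move=> x1 x2 x3 x4 x5 x6; ring.
have L' : cint (fun q => cint (fun p => Phi (p, q))) = c1 * cint (pairing l h V).
  rewrite -(cintZ c1 (cintegrable_pairing bh bV)).
  apply: eq_cint => q qH.
  have ip := cintegrable_pairing bk (bw (cplx q) qH).
  transitivity (cint (fun p => B q * (pairing l k (wcomp (kernel l (cplx q))) p)^*%C)).
    by apply: eq_cint => p pH; exact: Phi_col.
  rewrite (cintZ _ (cintegrableJ ip)).
  rewrite (cintJ ip) (cint_inner k) (HV (cplx q) qH) !conjM !conj_re c1E /pairing /B; clear.
  move: (ext h _) (ext V _)^*%C (pi%:C) (q.1 ^+ l)%:C (kernel_const l)%:C.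
  by move=> x1 x2 x3 x4 x5; ring.
have := etrans (esym L) (etrans FE L'); rewrite !cint_inner => /mulfI e.
apply: (mulfI (realC_neq0 (lt0r_neq0 (pi_gt0 R)))); apply: e.
have p0 := realC_neq0 (lt0r_neq0 (pi_gt0 R)).
have r0 := realC_neq0 (lt0r_neq0 (@kernel_const_gt0 R l)).
by rewrite c1E; exact: mulf_neq0 p0 r0.
Qed.
End adjoint.
End WeightedComposition.

(** * The functional equation *)

Section RootsOfUnityPath.
Context {R : realType}.
Local Notation C := R[i].

Lemma modulus_root (m : nat) (z : C) : (0 < m)%N -> z ^+ m = 1 -> modulus z = 1.
Proof.
move=> m0 zm; apply/eqP; rewrite -(@pexpr_eq1 _ (modulus z) m) ?modulus_ge0//.
by rewrite -modulusX zm modulus1.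
Qed.

(** The powers of z sum to 0, so the m terms 1 - z^i, each of modulus at most m |1 - z|, sum to m.
    Hence |1 - z| >= 1 / m, while Re z = 1 - |1 - z|^2 / 2. *)
Lemma root_of_unity_gap (m : nat) (z : C) : (0 < m)%N -> z ^+ m = 1 -> z != 1 ->
  complex.Re z <= 1 - (m%:R ^+ 2)^-1 / 2.
Proof.
move=> m0 zm z1; have nz := modulus_root m0 zm.
have nzC : `|z| = 1 by rewrite normC_modulus nz.
have S0 : \sum_(i < m) z ^+ i = 0.
  apply: (mulfI (_ : z - 1 != 0)); first by rewrite subr_eq0.
  by rewrite -subrX1 zm subrr mulr0.
have le1 j : `|1 - z ^+ j| <= `|1 - z| * j%:R.
  rewrite -normrN opprB subrX1 normrM distrC ler_wpM2l//.
  apply: (le_trans (ler_norm_sum _ _ _)).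
  rewrite (eq_bigr (fun=> 1)); last by move=> i _; rewrite normrX nzC expr1n.
  by rewrite sumr_const card_ord.
have : `|\sum_(i < m) (1 - z ^+ i)| <= m%:R * (`|1 - z| * m%:R).
  apply: (le_trans (ler_norm_sum _ _ _)).
  apply: (@le_trans _ _ (\sum_(i < m) `|1 - z| * m%:R)).
    apply: ler_sum => i _; apply: (le_trans (le1 i)).
    by rewrite ler_wpM2l// ler_nat ltnW.
  by rewrite sumr_const card_ord mulr_natl.
rewrite sumrB S0 subr0 sumr_const card_ord normr_nat normC_modulus.
have -> : (m%:R : C) = (m%:R : R)%:C by rewrite rmorph_nat.
rewrite -!rmorphM lecR => h.
have mR : 0 < (m%:R : R) by rewrite ltr0n.
have h1 : m%:R^-1 <= modulus (1 - z).
  rewrite -(ler_pM2l mR) mulfV ?gt_eqF// -(ler_pM2l mR) mulr1.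
  by rewrite mulrA [leRHS]mulrAC -mulrA.
have h2 : (m%:R ^+ 2)^-1 <= modulus (1 - z) ^+ 2.
  by rewrite -exprVn lerXn2r// ?nnegrE ?invr_ge0 ?modulus_ge0// ltW.
have h3 : modulus (1 - z) ^+ 2 = 2 - 2 * complex.Re z.
  have : modulus z ^+ 2 = 1 by rewrite nz expr1n.
  rewrite !sqr_modulus cReD cImD cReN cImN /= => e.
  have -> : (1 - complex.Re z) ^+ 2 + (0 - complex.Im z) ^+ 2 =
    complex.Re z ^+ 2 + complex.Im z ^+ 2 + 1 - 2 * complex.Re z by ring.
  by rewrite e; ring.
rewrite h3 in h2; lra.
Qed.

(** If S 1 != 1, then Re S takes the value 1 - m^(-2) / 4, which lies inside the gap left below 1 by
    [root_of_unity_gap]. *)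
Lemma root_path (m : nat) (S : C -> C) : (0 < m)%N ->
  (forall t : R, 0 <= t <= 1 -> cder S t%:C /\ S t%:C ^+ m = 1) -> S 0 = 1 -> S 1 = 1.
Proof.
move=> m0 HS S0; apply/eqP/negP => /negP S1.
pose u (t : R) := complex.Re (S t%:C).
have cu : {within `[0, 1], continuous u}.
  apply: continuous_in_subspaceT => t /[!inE]/= /[!in_itv]/= t01.
  have [D [D1 _]] := cder_tdiff (HS t t01).1.
  have [K [d [K0 d0 HK]]] := tdiff_lip D1.
  apply/cvgrPdist_le => e e0.
  exists (Num.min d (e / K)); first by rewrite /= lt_min d0 divr_gt0.
  move=> s /=; rewrite distrC lt_min => /andP[sd se].
  have := HK s 0 sd; rewrite subrr normr0 => /(_ d0); rewrite addr0 distrC => h.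
  by apply: (le_trans h); rewrite mulrC -ler_pdivlMr// ltW.
have mR : 0 < (m%:R ^+ 2)^-1 :> R by rewrite invr_gt0 exprn_gt0// ltr0n.
have [_ r1] := HS 1 (ltac:(by rewrite ler01 lexx)).
have u1 : u 1 <= 1 - (m%:R ^+ 2)^-1 / 2 := root_of_unity_gap m0 r1 S1.
have u0 : u 0 = 1 by rewrite /u S0.
have [|t t01 ut] := @IVT R u 0 1 (1 - (m%:R ^+ 2)^-1 / 4) ler01 cu.
  rewrite u0 ge_min le_max; apply/andP; split; apply/orP; [right|left].
    by apply: (le_trans u1); clear - mR; lra.
  by clear - mR; lra.
move: t01; rewrite in_itv/= => t01.
have [_ rt] := HS t t01.
have St : S t%:C != 1.
  apply/eqP => e; move: ut; rewrite /u e /=; clear - mR; lra.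
have := root_of_unity_gap m0 rt St; rewrite -/(u t) ut; clear - mR; lra.
Qed.

End RootsOfUnityPath.

(** * Coefficients of linear fractional self-maps of the half plane *)

Section Coefficients.
Context {R : realType}.
Local Notation C := R[i].
Implicit Types delta kappa t : C.

(** For t = X + iY, A = a + ib and delta of real part d, the form is |t|^2 Re (A / t + delta), by
    [Re_mobius]. The two outcomes become the two alternatives of [case_c_coeffs]. *)
Lemma positive_form (d a b k N : R) : 0 <= k -> 0 <= N -> N ^+ 2 = a ^+ 2 + b ^+ 2 ->
  (forall X Y, k < X -> 0 < d * (X ^+ 2 + Y ^+ 2) + a * X + b * Y) ->
  [/\ d = 0, b = 0 & 0 < a] \/ (0 < d /\ N <= 2 * d * k + a).
Proof.
move=> k0 N0 Nab pos; have k1 : k < k + 1 by rewrite ltrDl.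
have [d0|d0|d0] := ltgtP d 0.
(* The term b Y cancels between Y and - Y, and Y is so large that d Y^2 outweighs a X. *)
- exfalso; pose X := k + 1; pose Y := 1 + `|a * X| / - d.
  have dn : 0 < - d by rewrite oppr_gt0.
  have Y1 : 1 <= Y by rewrite lerDl divr_ge0// ltW.
  have := pos X Y k1; have := pos X (- Y) k1; rewrite sqrrN => p1 p2.
  have Y2 : Y <= Y ^+ 2 by rewrite expr2 ler_peMr// (le_trans _ Y1).
  have dY : d * Y = d - `|a * X| by rewrite /Y; field; rewrite lt_eqF.
  have h1 : d * Y ^+ 2 <= d * Y by rewrite ler_nM2l.
  have h2 : d * X ^+ 2 <= 0 by rewrite mulr_le0_ge0 ?sqr_ge0// ltW.
  have h3 := ler_norm (a * X).
  by move: p1 p2 h1 h2 h3; rewrite dY; clear - d0; move: (`|_|) (Y ^+ 2) (X ^+ 2) => n y x; lra.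
- right; split => //; apply/ler_addgt0Pr => e e0.
  (* At Y = - b / (2 d), where the form is least, positivity reads (2 d X + a)^2 > N^2; the value Y
     = 0 fixes the sign of 2 d X + a. Then X tends to k. *)
  pose X := k + e / (2 * d).
  have Xk : k < X by rewrite ltrDl divr_gt0// mulr_gt0.
  have X0 : 0 < X by apply: le_lt_trans Xk.
  have := pos X (- b / (2 * d)) Xk; have := pos X 0 Xk => p1 p2.
  have h1 : 0 < d * X + a.
    by rewrite -(pmulr_rgt0 _ X0); move: p1; congr (0 < _); ring.
  have h2 : 0 < 2 * d * X + a by have := mulr_gt0 d0 X0; clear - h1; lra.
  have -> : 2 * d * k + a + e = 2 * d * X + a by rewrite /X; field; rewrite gt_eqF.
  rewrite -ler_sqr ?nnegrE ?(ltW h2)// Nab -subr_ge0.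
  have : 0 < 4 * d * (d * (X ^+ 2 + (- b / (2 * d)) ^+ 2) + a * X + b * (- b / (2 * d))).
    by rewrite mulr_gt0// mulr_gt0.
  by move=> /ltW; congr (0 <= _); field; rewrite gt_eqF.
- left; rewrite d0 in pos; split => //.
    apply/eqP/negP => /negP b0; have := pos (k + 1) (- (a * (k + 1)) / b) k1.
    by rewrite mul0r add0r mulrC mulrA mulrAC divff// mul1r addrN ltxx.
  have := pos (k + 1) 0 k1; rewrite mul0r add0r mulr0 addr0 pmulr_lgt0//.
  by rewrite ltr_wpDl.
Qed.

Lemma Re_mobius delta (A : C) t : t != 0 ->
  modulus t ^+ 2 * complex.Re (A / t + delta) =
  complex.Re delta * (complex.Re t ^+ 2 + complex.Im t ^+ 2) +
  complex.Re A * complex.Re t + complex.Im A * complex.Im t.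
Proof.
move=> t0; have : modulus t ^+ 2 != 0 by rewrite expf_neq0// modulus_eq0.
rewrite sqr_modulus; case: t A delta t0 => [X Y] [a b] [d e] _ /= n0.
by field.
Qed.

Lemma case_c_coeffs_of_pos delta kappa : 0 <= complex.Re kappa ->
  (forall u, 0 < complex.Re u -> 0 < complex.Re ((1 - delta * kappa) / (u + kappa) + delta)) ->
  case_c_coeffs delta kappa.
Proof.
move=> k0 pos; set A := 1 - delta * kappa in pos.
have N0 := modulus_ge0 A.
have P X Y : complex.Re kappa < X -> 0 < complex.Re delta * (X ^+ 2 + Y ^+ 2) +
    complex.Re A * X + complex.Im A * Y.
  move=> kX; have := pos ((X +i* Y) - kappa); rewrite cReD cReN /= subr_gt0 subrK => /(_ kX) h.
  have t0 : (X +i* Y : C) != 0 by apply: cRe_eq0; exact: le_lt_trans kX.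
  have := Re_mobius delta A t0 => /= <-.
  by rewrite mulr_gt0// exprn_gt0// modulus_gt0.
have AE : complex.Re (delta * kappa) = 1 - complex.Re A /\ complex.Im (delta * kappa) = - complex.Im A.
  by rewrite /A !(cReD, cImD, cReN, cImN) /= sub0r opprK opprB addrC subrK.
have AN : modulus (delta * kappa - 1) = modulus A by rewrite -modulusN opprB.
case: (positive_form k0 N0 (sqr_modulus A) P) => [[d0 b0 a0]|[d0 Nk]].
  left; rewrite AE.1 AE.2 b0 oppr0; split => //.
  by rewrite ltrBlDr ltrDl.
right; split; first by rewrite oppr_lt0.
rewrite AN cReD cReN AE.1 /= subr_ge0 ler_pdivrMr ?mulr_gt0//.
by move: Nk; rewrite -!mulrA; clear; move: (complex.Re A) (modulus A) (complex.Re kappa) => a n k; lra.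
Qed.

(** The inequality is |G'(u)| Re u <= Re G(u) for G(u) = A / (u + kappa) + delta with A = 1 - delta
    kappa, multiplied by |u + kappa|^2. *)
Lemma case_c_schwarz_pick delta kappa : case_c_coeffs delta kappa ->
  0 <= complex.Re kappa /\ (forall u, 0 < complex.Re u ->
    modulus (1 - delta * kappa) * complex.Re u <=
    modulus (u + kappa) ^+ 2 * complex.Re ((1 - delta * kappa) / (u + kappa) + delta)).
Proof.
move=> cc; set A := 1 - delta * kappa.
have AE : complex.Re (delta * kappa) = 1 - complex.Re A /\ complex.Im (delta * kappa) = - complex.Im A.
  by rewrite /A !(cReD, cImD, cReN, cImN) /= sub0r opprK opprB addrC subrK.
have AN : modulus (delta * kappa - 1) = modulus A by rewrite -modulusN opprB.
have Nn := modulus_ge0 A; have N2 := sqr_modulus A.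
have ReAN : `|complex.Re A| <= modulus A := modulus_Re A.
have k0 : 0 <= complex.Re kappa.
  case: cc => [[]//|[d0]]; rewrite AN cReD cReN AE.1 /= subr_ge0; apply: le_trans.
  rewrite divr_ge0//; last by rewrite mulr_ge0// ltW// -oppr_lt0.
  move: ReAN; rewrite ler_norml; clear => /andP[_]; lra.
split => // u u0.
have t0 : u + kappa != 0 by apply: cRe_eq0; rewrite cReD ltr_wpDr.
rewrite Re_mobius// cReD cImD.
case: cc => [[d0]|[]].
  rewrite AE.1 AE.2 => /eqP; rewrite oppr_eq0 => /eqP b0 a1 _.
  have a0 : 0 < complex.Re A by clear - a1; lra.
  have -> : modulus A = complex.Re A.
    apply/eqP; rewrite -(@eqrXn2 _ 2) ?(ltW a0)// N2 b0 expr0n addr0//.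
  rewrite d0 b0 !mul0r add0r addr0 ler_wpM2l ?(ltW a0)//.
  by rewrite lerDl.
rewrite oppr_lt0 AN cReD cReN AE.1 /= subr_ge0 => d0.
rewrite ler_pdivrMr ?mulr_gt0// => hk.
move: (complex.Im u + complex.Im kappa) => Y.
move: N2 Nn hk u0 k0 d0; clear.
move: (modulus A) (complex.Re A) (complex.Im A) (complex.Re u) (complex.Re kappa) (complex.Re delta).
move=> N a b x k d N2 N0 hk x0 k0 d0.
have hk' : N <= 2 * d * k + a by move: hk; rewrite -!mulrA; lra.
rewrite -subr_ge0 -(pmulr_rge0 _ (_ : 0 < 4 * d)); last by rewrite mulr_gt0.
set X := x + k.
(* Once the square in Y is completed, (2 d X + a)^2 - N^2 remains; its two factors are at least 2 d
   x and 2 N. *)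
have -> : 4 * d * (d * (X ^+ 2 + Y ^+ 2) + a * X + b * Y - N * x) =
   (2 * d * Y + b) ^+ 2 + ((2 * d * X + a) ^+ 2 - (a ^+ 2 + b ^+ 2)) - 4 * d * N * x by ring.
rewrite -N2 subr_sqr -addrA addr_ge0 ?sqr_ge0// subr_ge0.
have e1 : 2 * (d * x) <= 2 * d * X + a - N by rewrite /X; clear - hk'; lra.
have e2 : 2 * N <= 2 * d * X + a + N.
  have := mulr_gt0 d0 x0; rewrite /X; clear - hk'; lra.
have := ler_pM _ _ e1 e2; rewrite !mulr_ge0 ?(ltW d0) ?(ltW x0)// => /(_ isT isT).
by apply: le_trans; rewrite le_eqVlt; apply/orP; left; apply/eqP; ring.
Qed.

End Coefficients.

(** * Solution of the equation on the half plane *)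

Section FunctionalEquation.
Context {R : realType}.
Local Notation C := R[i].
Variables (m : nat) (F G : C -> C).
Hypothesis m0 : (0 < m)%N.
Hypothesis HG : forall u, 0 < complex.Re u -> 0 < complex.Re (G u).
Hypothesis dG : forall u, 0 < complex.Re u -> cder G u.
Hypothesis FE : forall u z, 0 < complex.Re u -> 0 < complex.Re z ->
  F u * (1 + u * G z) ^+ m = F z * (1 + z * G u) ^+ m.
Hypothesis F1 : F 1 != 0.

Lemma one_plus_neq0 (u a : C) : 0 < complex.Re u -> 0 < complex.Re a -> 1 + u * a != 0.
Proof.
move=> u0 a0; have un := cRe_eq0 u0.
have -> : 1 + u * a = u * (u^-1 + a) by rewrite mulrDr mulfV.
by rewrite mulf_neq0//; apply: cRe_eq0; rewrite cReD addr_gt0 ?Re_inv_gt0.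
Qed.

Let one0 : 0 < complex.Re (1 : C). Proof. exact: ltr01. Qed.

Let F_neq0 u : 0 < complex.Re u -> F u != 0.
Proof.
move=> u0; have h : F 1 * (1 + 1 * G u) ^+ m != 0.
  by rewrite mulf_neq0 ?expf_neq0 ?one_plus_neq0 ?HG.
by move: h; rewrite -FE//; apply: contraNneq => ->; rewrite mul0r.
Qed.

(** [N u z v] and [N z u v] collect the left and the right factors of the equation over the pairs of
    a triple; multiplying the three equations eliminates F. *)
Let N u z v : C := (1 + u * G z) * (1 + z * G v) * (1 + v * G u).

Let N_neq0 u z v : 0 < complex.Re u -> 0 < complex.Re z -> 0 < complex.Re v -> N u z v != 0.
Proof. by move=> u0 z0 v0; rewrite !mulf_neq0 ?one_plus_neq0 ?HG. Qed.

Let N_pow u z v : 0 < complex.Re u -> 0 < complex.Re z -> 0 < complex.Re v ->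
  N u z v ^+ m = N z u v ^+ m.
Proof.
move=> u0 z0 v0; have h : F u * F z * F v != 0 by rewrite !mulf_neq0 ?F_neq0.
apply: (mulfI h); rewrite /N !exprMn.
move: (FE u0 z0) (FE z0 v0) (FE v0 u0).
move: ((1 + u * G z) ^+ m) ((1 + z * G u) ^+ m) ((1 + z * G v) ^+ m)
  ((1 + v * G z) ^+ m) ((1 + v * G u) ^+ m) ((1 + u * G v) ^+ m) => a a' b b' c c' e1 e2 e3.
have -> : F u * F z * F v * (a * b * c) = (F u * a) * (F z * b) * (F v * c) by ring.
by rewrite e1 e2 e3; ring.
Qed.

Let path (u t : C) : C := (u - 1) * t + 1.

Let Re_path u (t : R) : 0 < complex.Re u -> 0 <= t <= 1 -> 0 < complex.Re (path u t%:C).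
Proof.
move=> u0 /andP[t0 t1]; rewrite /path cReD mulrC cRe_scale cReD cReN /=.
have [->|tn] := eqVneq t 0; first by rewrite mul0r add0r.
have tp : 0 < t by rewrite lt_neqAle eq_sym tn.
have := mulr_gt0 tp u0; lra.
Qed.

Let cder_factor u z (t : R) : 0 < complex.Re z -> 0 <= t <= 1 ->
  cder (fun x => 1 + path u x * G (path z x)) t%:C.
Proof.
move=> z0 t01; apply: cderD; first exact: cder_cst.
apply: cderM; first exact: cder_affine.
by apply: (@cder_comp R G (path z)); [exact: cder_affine|apply: dG; exact: Re_path].
Qed.

(* The quotient of the two sides is a continuous choice of an m-th root of unity
   along the segments from 1, where it is 1. *)
Let N_sym u z v : 0 < complex.Re u -> 0 < complex.Re z -> 0 < complex.Re v ->
  N u z v = N z u v.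
Proof.
move=> u0 z0 v0.
pose S t := N (path u t) (path z t) (path v t) / N (path z t) (path u t) (path v t).
have p1 w : path w 1 = w by rewrite /path mulr1 subrK.
have S1 : S 1 = 1.
  apply: (root_path m0) => [t t01|]; last first.
    have p0 w : path w 0 = 1 by rewrite /path mulr0 add0r.
    by rewrite /S !p0 divff// N_neq0.
  have [u1 z1 v1] := And3 (Re_path u0 t01) (Re_path z0 t01) (Re_path v0 t01).
  split; last by rewrite /S expr_div_n N_pow// divff// expf_neq0// N_neq0.
  have cN a b c : 0 < complex.Re a -> 0 < complex.Re b -> 0 < complex.Re c ->
      cder (fun x => N (path a x) (path b x) (path c x)) t%:C.
    by move=> a0 b0 c0; apply: cderM; [apply: cderM|]; exact: cder_factor.
  by apply: cderM; [exact: cN|apply: cderV; [exact: N_neq0|exact: cN]].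
apply/eqP; rewrite -subr_eq0; apply/eqP; move: S1; rewrite /S !p1 => e.
have n0 := N_neq0 z0 u0 v0.
by apply/eqP; rewrite subr_eq0 -(divfK n0 (N u z v)) e mul1r.
Qed.

Let two0 : 0 < complex.Re (2 : C). Proof. by rewrite -(rmorph_nat (real_complex R)) /= ltr0n. Qed.

(** The coefficients found by expanding N u 1 2 = N 1 u 2, which has degree one in u and in G u. *)
Let p : C := 2 * G 1 - G 2.
Let q : C := G 2 - G 1 + G 1 * G 2.
Let r : C := 1 + 2 * (G 2 - G 1).

Let G_linear u : 0 < complex.Re u -> (r + p * u) * G u = p + q * u.
Proof.
move=> u0; have e := N_sym u0 one0 two0.
apply/eqP; rewrite -subr_eq0.
have -> : (r + p * u) * G u - (p + q * u) = N u 1 2 - N 1 u 2.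
  by rewrite /N /p /q /r; ring.
by rewrite e subrr.
Qed.

Theorem functional_equation_solution :
  (exists (lambda : R) (theta : C), 0 < lambda /\
     forall u, 0 < complex.Re u -> G u = lambda%:C * u /\ F u = theta) \/
  (exists delta kappa rho : C, case_c_coeffs delta kappa /\
     forall u, 0 < complex.Re u -> G u = (1 - delta * kappa) / (u + kappa) + delta /\
       F u = rho / (u + kappa) ^+ m).
Proof.
(* If p = 0, then G 2 = 2 G 1 and G is multiplication by G 1; otherwise division by p normalises the
   denominator to u + kappa. *)
have [p0|pn] := eqVneq p 0.
  left; have B : G 2 = 2 * G 1 by apply/eqP; rewrite eq_sym -subr_eq0; exact/eqP.
  have rn : 1 + 2 * G 1 != 0 by exact: one_plus_neq0 two0 (HG one0).
  have GA u : 0 < complex.Re u -> G u = G 1 * u.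
    move=> u0; have := G_linear u0; rewrite p0 mul0r addr0 add0r /r /q B => e.
    apply: (mulfI rn); rewrite -[LHS](_ : (1 + 2 * (2 * G 1 - G 1)) * G u = _); last by ring.
    by rewrite e; ring.
  have I0 : complex.Im (G 1) = 0.
    apply/eqP/negP => /negP n.
    (* Otherwise multiplication by G 1 would take this point of the half plane to the imaginary
       axis. *)
    have u0 : 0 < complex.Re (1 +i* (complex.Re (G 1) / complex.Im (G 1)) : C) by exact: ltr01.
    have := HG u0; rewrite GA// cReM/= mulr1 mulrC divfK//.
    by rewrite subrr ltxx.
  have GR : G 1 = (complex.Re (G 1))%:C.
    by move: I0; case: (G 1) => x y /= ->.
  exists (complex.Re (G 1)), (F 1); split; first exact: HG.
  move=> u u0; rewrite -GR; split; first exact: GA.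
  have n := expf_neq0 m (one_plus_neq0 u0 (HG one0)).
  have := FE u0 one0; rewrite mul1r (GA u u0) [G 1 * u]mulrC => e.
  exact: (mulIf n e).
right; pose delta := q / p; pose kappa := r / p.
have GL u : 0 < complex.Re u -> (u + kappa) * G u = 1 + delta * u.
  move=> u0; have := G_linear u0 => e; apply: (mulfI pn).
  transitivity ((r + p * u) * G u); first by rewrite /kappa; field.
  by rewrite e /delta; field.
(* If - kappa were in the half plane, the equation there would give delta kappa = 1, and G (1 -
   kappa) = delta; then kappa = 1 / delta has positive real part. *)
have k0 : 0 <= complex.Re kappa.
  rewrite leNgt; apply/negP => kn.
  have u0 : 0 < complex.Re (- kappa) by rewrite cReN oppr_gt0.
  have dk : delta * kappa = 1.
    have := GL _ u0; rewrite addNr mul0r mulrN => /esym/eqP.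
    by rewrite subr_eq0 => /eqP <-.
  have u1 : 0 < complex.Re (1 - kappa) by rewrite cReD addr_gt0.
  have := GL _ u1; rewrite subrK mul1r mulrBr mulr1 dk [RHS]addrC subrK => Gd.
  have := HG u1; rewrite Gd => d0; move: kn.
  have kE : kappa = delta^-1.
    by apply: (mulfI (cRe_eq0 d0)); rewrite dk mulfV// cRe_eq0.
  by rewrite kE ltNge ltW// Re_inv_gt0.
have kn u : 0 < complex.Re u -> u + kappa != 0.
  by move=> u0; apply: cRe_eq0; rewrite cReD ltr_wpDr.
have GE u : 0 < complex.Re u -> G u = (1 - delta * kappa) / (u + kappa) + delta.
  move=> u0; apply: (mulfI (kn u u0)); rewrite GL//.
  by move: (kn u u0) => n; field.
(* Once G is known, the equation at z = 1 determines F from F 1. *)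
exists delta, kappa, (F 1 * (1 + kappa) ^+ m); split.
  apply: case_c_coeffs_of_pos => // u u0; rewrite -GE//; exact: HG.
move=> u u0; split; first exact: GE.
have n := expf_neq0 m (one_plus_neq0 u0 (HG one0)).
have n' := expf_neq0 m (kn u u0).
have e : (1 + 1 * G u) * (u + kappa) = (1 + kappa) * (1 + u * G 1).
  have e1 := GL _ one0; have e2 := GL _ u0.
  have -> : (1 + 1 * G u) * (u + kappa) = u + kappa + (u + kappa) * G u by ring.
  have -> : (1 + kappa) * (1 + u * G 1) = 1 + kappa + u * ((1 + kappa) * G 1) by ring.
  by rewrite e1 e2; ring.
apply: (canRL (mulfK n')); apply: (mulIf n).
by rewrite mulrAC (FE u0 one0) -!mulrA -!exprMn e.
Qed.

End FunctionalEquation.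

(** * Selfadjointness *)

Section SelfadjointWeightedComposition.
Context {R : realType} (l : nat) (b : R[i]) (c : R).
Local Notation C := R[i].
Local Notation s := (scale l b).
Local Notation m := (l + 2)%N.
Local Notation K := (conjugation l b c).
Implicit Types (h k : Cplus R -> C) (z w u : Cplus R).
Hypothesis b0 : b != 0.

Definition sigma (z : C) : C := s%:C * z + 'i * c%:C.

Let s0 : 0 < s := scale_gt0 l b0.
Let sC : s%:C != 0 :> C := realC_neq0 (lt0r_neq0 s0).

Lemma Re_val z : 0 < complex.Re (val z). Proof. by case: z. Qed.

Lemma Re_sigma (z : C) : complex.Re (sigma z) = s * complex.Re z.
Proof. exact: Re_scaling. Qed.

Lemma Re_sigma_gt0 (z : C) : 0 < complex.Re z -> 0 < complex.Re (sigma z).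
Proof. by move=> z0; rewrite Re_sigma mulr_gt0. Qed.

Lemma sigma_rho (z : C) : sigma (rho l b c z) = ((sigma z)^*%C)^-1.
Proof.
rewrite /sigma /rho (fmorphV (real_complex R)) (fmorph_div (real_complex R)).
by move: (_^*%C)^-1 => X; field.
Qed.

Lemma Re_rho (z : C) : 0 < complex.Re z -> 0 < complex.Re (rho l b c z).
Proof.
move=> z0; rewrite -(pmulr_rgt0 _ s0) -Re_sigma sigma_rho Re_inv_gt0 cReJ.
exact: Re_sigma_gt0.
Qed.

Lemma conj_sigma (z : C) : (sigma z)^*%C = s%:C * z^*%C - 'i * c%:C.
Proof.
rewrite /sigma conjD !conjM !conj_re; congr (_ + _).
by apply/eqP; rewrite eq_complex/=; apply/andP; split; apply/eqP; ring.
Qed.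

Lemma kernel_sigma (w z : C) : s%:C ^+ m / (sigma z + (sigma w)^*%C) ^+ m =
  ((z + w^*%C) ^+ m)^-1.
Proof.
have -> : sigma z + (sigma w)^*%C = s%:C * (z + w^*%C).
  by rewrite conj_sigma /sigma; ring.
by rewrite exprMn invfM mulrA divff ?mul1r// expf_neq0.
Qed.

Lemma conjugationZ (a : C) h : K (fun z => a * h z) = fun z => a^*%C * K h z.
Proof.
apply/funext => z; rewrite !conjugationE//.
have r0 := Re_rho (Re_val z).
by rewrite (ext_in (fun z => a * h z) r0) -(ext_in h r0) conjM mulrCA.
Qed.

(** The denominator is symmetric in z and w, and is the source of the two powers in the functional
    equation. *)
Lemma conjugation_kernel w z :
  K (kernel l (val w)) z = b / b^*%C * (s%:C ^+ m / (1 + sigma (val z) * sigma (val w)) ^+ m).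
Proof.
rewrite conjugationE// -/(sigma (val z)) ext_kernel ?Re_rho ?Re_val//.
rewrite -kernel_sigma sigma_rho -mulrA; congr (_ * _).
have z0 := cRe_eq0 (Re_sigma_gt0 (Re_val z)).
rewrite -conj_inv -conjD conjM conj_inv !conjX conj_re conjcK.
have -> : 1 + sigma (val z) * sigma (val w) = sigma (val z) * ((sigma (val z))^-1 + sigma (val w)).
  by rewrite [RHS]mulrDr mulfV.
by rewrite exprMn invfM mulrCA.
Qed.

Lemma bergman_mull (a : C) h : bergman l h -> bergman l (fun z => a * h z).
Proof.
move=> bh; have := bergman_lin a bh (@bergman0 R l).
by congr bergman; apply/funext => z; rewrite addr0.
Qed.

Lemma innerZl (a : C) h k : bergman l h -> bergman l k ->
  inner l (fun z => a * h z) k = a * inner l h k.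
Proof.
move=> bh bk; have e (z : C) : ext (fun z => a * h z) z = a * ext h z.
  have [z0|z0] := ltP 0 (complex.Re z); first by rewrite !ext_in.
  by rewrite !ext_out// mulr0.
rewrite !innerE mulrCA -(cintZ a (cintegrable_pairing bh bk)); congr (_ * _).
by apply: eq_cint => p _; rewrite /pairing e; ring.
Qed.

Lemma innerZr (a : C) h k : bergman l h -> bergman l k ->
  inner l h (fun z => a * k z) = a^*%C * inner l h k.
Proof.
move=> bh bk; rewrite (inner_conj (bergman_mull a bk) bh) innerZl//.
by rewrite conjM -inner_conj.
Qed.

Lemma bnormZ (a : C) h : bergman l h ->
  bnorm l (fun z => a * h z) = modulus a * bnorm l h.
Proof.
move=> bh; have ba := bergman_mull a bh.
have : (bnorm l (fun z => a * h z) ^+ 2)%:C = ((modulus a * bnorm l h) ^+ 2)%:C :> C.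
  rewrite -inner_self (innerZl _ bh ba) (innerZr _ bh bh) inner_self mulrA mulJ.
  by rewrite -rmorphM exprMn.
case=> /eqP; rewrite eqrXn2 ?mulr_ge0 ?bnorm_ge0 ?modulus_ge0// => /eqP.
exact.
Qed.

Section operator.
Variable W : operator R.
Hypothesis hW : linear_operator l W.

Let domW : dom W `<=` bergman l. Proof. by case: hW. Qed.
Let bergmanW h : dom W h -> bergman l (W h). Proof. by case: hW => _ + _ _; apply. Qed.

(** As the conjugation is an involution of the whole space, W = C W^* C, domains included, unfolds
    into statements about adjoint values alone. *)
Lemma selfadjoint_wrt_conjugation : selfadjoint_wrt l (conj_bc l b c) W <->
  [/\ densely_defined l W,
      forall h, dom W h <-> bergman l h /\ exists k, adjoint_value l W (K h) k &
      forall h, dom W h -> adjoint_value l W (K h) (K (W h))].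
Proof.
set B := op_comp (conj_bc l b c) (op_comp (adjoint l W) (conj_bc l b c)).
have domB h : dom B h <-> bergman l h /\ exists k, adjoint_value l W (K h) k.
  split=> [[[/(dom_conj_bc _ _ b0) bh [_ [k kh]]] _]|[bh [k kh]]].
    by split => //; exists k; rewrite -conj_bcE.
  have kh' := kh; rewrite -(conj_bcE c b0 bh) in kh'.
  split; first split.
  - exact/(dom_conj_bc _ _ b0).
  - by split; [rewrite conj_bcE//; exact: bergman_conjugation|exists k].
  apply/(dom_conj_bc _ _ b0).
  by have [] : adjoint_value l W (conj_bc l b c h) (adjoint l W (conj_bc l b c h)) :=
    xgetPex (fun=> 0) (ex_intro _ _ kh').
have BE h k : densely_defined l W -> bergman l h -> adjoint_value l W (K h) k -> B h = K k.
  move=> dW bh kh.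
  transitivity (conj_bc l b c (adjoint l W (conj_bc l b c h))); first by [].
  by rewrite (conj_bcE c b0 bh) (adjointE dW domW kh) conj_bcE//; case: kh.
split=> [[dW [[sub1 eq1] [sub2 eq2]]]|[dW domE adjE]].
  have dE h : dom W h <-> bergman l h /\ exists k, adjoint_value l W (K h) k.
    by split=> [/sub1/domB|/domB/sub2].
  split; [exact: dW|exact: dE|move=> h Wh].
  have [bh [k kh]] := (dE h).1 Wh.
  by rewrite (eq1 h Wh) (BE h k dW bh kh) conjugationK.
have eqB h : dom W h -> W h = B h.
  by move=> Wh; rewrite (BE h _ dW (domW Wh) (adjE h Wh)) conjugationK.
split; [exact: dW|split; split => h].
- by move=> /domE/domB.
- exact: eqB.
- by move=> /domB/domE.
- by move=> /domB/domE Wh; rewrite -eqB.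
Qed.

End operator.

Section composition.
Variables (f : Cplus R -> C) (g : Cplus R -> Cplus R).
Hypotheses (hf : analytic f) (hg : analytic_self g).
Local Notation Wfg := (wcomp f g).

Definition functional_equation := forall u z,
  f u * (1 + sigma (val u) * sigma (val (g z))) ^+ m =
  f z * (1 + sigma (val z) * sigma (val (g u))) ^+ m.

Lemma inner_wcomp_kernel h z : bergman l h -> bergman l (Wfg h) ->
  inner l (Wfg h) (kernel l (val z)) =
  inner l h (fun w => (f z)^*%C * kernel l (val (g z)) w).
Proof.
move=> bh bWh; have rz := Re_val z; have rg := Re_val (g z).
rewrite (innerZr _ bh (bergman_kernel l rg)) (reproducing bWh rz) (reproducing bh rg).
by rewrite conjcK !extE /wcomp mulrCA.
Qed.

Let den z w : 1 + sigma (val z) * sigma (val w) != 0.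
Proof. by apply: one_plus_neq0; apply: Re_sigma_gt0; exact: Re_val. Qed.

Section selfadjoint.
Variable W : operator R.
Hypothesis hW : linear_operator l W.
Hypothesis hWmax : op_le W (Wmax l f g).

Let domW : dom W `<=` bergman l. Proof. by case: hW. Qed.
Let WE h : dom W h -> W h = Wfg h. Proof. by case: hWmax => _; apply. Qed.
Let bergmanW h : dom W h -> bergman l (W h). Proof. by case: hW => _ + _ _; apply. Qed.

(** Kernels belong to the domain of the adjoint of every restriction of the maximal operator, so
    selfadjointness puts their conjugates into [dom W], where W is known explicitly. *)
Lemma selfadjoint_functional_equation :
  selfadjoint_wrt l (conj_bc l b c) W -> functional_equation.
Proof.
move=> /(selfadjoint_wrt_conjugation hW)[dW domE adjE] u z.
have rz := Re_val z; have rg := Re_val (g z).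
have bk := bergman_kernel l rz; have bkg := bergman_kernel l rg.
pose k' w := (f z)^*%C * kernel l (val (g z)) w.
have bk' : bergman l k' := bergman_mull _ bkg.
have av : adjoint_value l W (kernel l (val z)) k'.
  split; [exact: bk'|move=> h Wh].
  have bWh : bergman l (Wfg h) by rewrite -(WE Wh); exact: bergmanW.
  by rewrite (WE Wh) (inner_wcomp_kernel z (domW Wh) bWh).
have bC : bergman l (K (kernel l (val z))) by exact: bergman_conjugation.
have WC : dom W (K (kernel l (val z))).
  by apply/domE; split; [exact: bC|exists k'; rewrite (conjugationK l c b0)].
have := adjE _ WC; rewrite (conjugationK l c b0) => av'.
have := adjoint_value_unique dW domW av' av => E.
have : K (K (W (K (kernel l (val z))))) = K k' by rewrite E.
rewrite (conjugationK l c b0) (WE WC) /k' conjugationZ conjcK => /(congr1 (fun f => f u)).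
rewrite /wcomp !conjugation_kernel.
have n1 := expf_neq0 m (den u (g z)).
have n2 := expf_neq0 m (den (g u) z).
rewrite [X in (1 + X) ^+ m](mulrC (sigma (val (g u)))) in n2 *.
have sm : s%:C ^+ m != 0 by rewrite expf_neq0.
have bb : b / b^*%C != 0 by rewrite mulf_neq0// invr_eq0 conjc_eq0.
move: ((1 + _) ^+ m) ((1 + _) ^+ m) n1 n2 => x y x0 y0 e.
have h : b / b^*%C * s%:C ^+ m != 0 by rewrite mulf_neq0.
apply: (mulfI h); transitivity (f u * (b / b^*%C * (s%:C ^+ m / y)) * x * y).
  by move: (b / b^*%C) (s%:C ^+ m) => B S; field.
rewrite e; move: (b / b^*%C) (s%:C ^+ m) => B S; by field.
Qed.
End selfadjoint.

(** All that the analysis of f and g has to supply: facts about the total map [wcomp f g], with no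
    mention of the domain of W. *)
Definition conj_symmetric := [/\ forall h, bergman l h -> bergman l (Wfg h),
  exists2 L : R, 0 < L & forall h, bergman l h -> bnorm l (Wfg h) <= L * bnorm l h &
  forall h k, bergman l h -> bergman l k ->
    inner l (Wfg h) k = inner l h (K (Wfg (K k)))].

Section fe.
Hypothesis fe : functional_equation.

Let rhoC z : Cplus R := exist (fun z : C => 0 < complex.Re z) _ (Re_rho (Re_val z)).
(** By the functional equation, W takes the kernel at z to [phi z] times another kernel. The
    conjugate of [phi] is the weight of C W C, which is why the two operators match on kernels. *)
Let phi z : C := sigma (val (rhoC z)) ^+ m / sigma (val (g (rhoC z))) ^+ m * f (rhoC z).

Let wcomp_kernel z :
  Wfg (kernel l (val z)) = fun u => phi z * kernel l (val (rhoC (g (rhoC z)))) u.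
Proof.
apply/funext => u; rewrite /wcomp; set e := rhoC z; set ge := g e.
have kE w v : kernel l (val w) v = s%:C ^+ m / (sigma (val v) + (sigma (val w))^*%C) ^+ m.
  by rewrite kernel_sigma.
rewrite kE [kernel l (val (rhoC ge)) u]kE.
have e0 := cRe_eq0 (Re_sigma_gt0 (Re_val e)).
have ge0 := cRe_eq0 (Re_sigma_gt0 (Re_val ge)).
have -> : (sigma (val z))^*%C = (sigma (val e))^-1.
  by rewrite [sigma (val e)](sigma_rho (val z)) invrK.
have -> : (sigma (val (rhoC ge)))^*%C = (sigma (val ge))^-1.
  by rewrite [sigma (val (rhoC ge))](sigma_rho (val ge)) conj_inv conjcK.
have E x y : y != 0 -> x + y^-1 = (1 + x * y) / y :> C by move=> y0; field.
rewrite (E _ _ e0) (E _ _ ge0) !expr_div_n /phi -/e -/ge.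
have := fe u e; have n1 := expf_neq0 m (den (g u) e); have n2 := expf_neq0 m (den u ge).
rewrite [sigma (val e) * _]mulrC.
have e1 := expf_neq0 m e0; have e2 := expf_neq0 m ge0.
move: ((1 + _) ^+ m) ((1 + _) ^+ m) n1 n2 => x y x0 y0 E'.
move: (sigma (val e) ^+ m) (sigma (val ge) ^+ m) (s%:C ^+ m) e1 e2 => A B S A0 B0.
apply: (mulIf y0); transitivity (f u * y * S * A / x); first by field; rewrite ?A0 ?x0.
by rewrite E'; field; rewrite ?x0 ?y0 ?B0.
Qed.

Let conj_wcomp_conj k z :
  K (Wfg (K k)) z = (phi z)^*%C * k (rhoC (g (rhoC z))).
Proof.
rewrite conjugationE// -/(sigma (val z)) -[rho l b c (val z)]/(val (rhoC z)) extE /wcomp.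
rewrite conjugationE// -/(sigma (val (g (rhoC z)))).
rewrite -[rho l b c (val (g (rhoC z)))]/(val (rhoC (g (rhoC z)))) extE.
rewrite /phi [sigma (val (rhoC z))](sigma_rho (val z)).
rewrite !conjM !conj_inv !conjX !conj_inv !conjcK exprVn.
have bb : b^*%C != 0 by rewrite conjc_eq0.
move: (sigma (val z) ^- m) ((sigma (val (g (rhoC z))))^*%C ^- m) => X Y.
by field; rewrite b0 bb.
Qed.

Let inner_kernel_wcomp k z : bergman l k ->
  inner l k (Wfg (kernel l (val z))) = (kernel_const l)%:C * K (Wfg (K k)) z.
Proof.
move=> bk; have rv := Re_val (rhoC (g (rhoC z))).
by rewrite wcomp_kernel (innerZr _ bk (bergman_kernel l rv)) (reproducing bk rv) extE conj_wcomp_conj; ring.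
Qed.

Lemma conj_symmetric_of_dominated M : 0 <= M -> dominated l f g M -> conj_symmetric.
Proof.
move=> M0 fgM; have bW h : bergman l h -> bergman l (Wfg h).
  by move=> bh; exact: (bergman_wcomp hf hg M0 fgM).
split => //.
  (* The bound has to be positive, and M may be 0. *)
  exists (Num.sqrt M + 1); first by rewrite ltr_wpDl ?sqrtr_ge0.
  move=> h bh; apply: (le_trans (bnorm_wcomp hf hg M0 fgM bh)).
  by rewrite ler_wpM2r ?bnorm_ge0// lerDl.
move=> h k bh bk; have bC h' : bergman l h' -> bergman l (K h') := bergman_conjugation c b0 (h:=h').
apply: (inner_wcomp hf hg M0 fgM bh bk); first exact: (bC _ (bW _ (bC _ bk))).
move=> w w0; have := inner_kernel_wcomp (exist (fun z : C => 0 < complex.Re z) w w0) bk.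
by rewrite [val _]/= => ->; rewrite ext_in.
Qed.

(* No integral has to be exchanged when g is constant: CWC k is then a multiple of a kernel. *)
Lemma conj_symmetric_of_constant (a : Cplus R) : (forall z, g z = a) -> bergman l f -> conj_symmetric.
Proof.
move=> ga bf; have WE h : Wfg h = fun z => h a * f z.
  by apply/funext => z; rewrite /wcomp ga mulrC.
have bW h : bergman l h -> bergman l (Wfg h) by move=> bh; rewrite WE; exact: bergman_mull.
have ka := bergman_kernel l (Re_val a).
have q0 := @kernel_const_gt0 R l.
split => //.
  (* The bound for evaluation at a, from [point_evaluation], times the norm of f; 1 is added for
     positivity. *)
  exists (bnorm l (kernel l (val a)) * bnorm l f / kernel_const l + 1).
    by rewrite ltr_wpDl//; apply: divr_ge0; [apply: mulr_ge0; exact: bnorm_ge0|exact: ltW].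
  move=> h bh; have := point_evaluation bh (Re_val a); rewrite extE => pe.
  rewrite WE (bnormZ _ bf) mulrDl mul1r -[leLHS]addr0.
  apply: lerD; last exact: bnorm_ge0.
  have -> : bnorm l (kernel l (val a)) * bnorm l f / kernel_const l * bnorm l h =
      bnorm l h * bnorm l (kernel l (val a)) / kernel_const l * bnorm l f by ring.
  by rewrite ler_wpM2r ?bnorm_ge0// ler_pdivlMr// mulrC.
move=> h k bh bk; rewrite WE (innerZl _ bf bk).
have r0 := realC_neq0 (lt0r_neq0 q0).
have -> : K (Wfg (K k)) = fun z => ((kernel_const l)%:C^-1 * inner l k f) * kernel l (val a) z.
  apply/funext => z; apply: (mulfI r0).
  rewrite -(inner_kernel_wcomp z bk) WE (innerZr _ bk bf) [RHS]mulrA mulVKf//.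
  by rewrite mulrC; congr (_ * _); rewrite /kernel conj_inv conjX conjD conjcK addrC.
rewrite (innerZr _ bh ka) (reproducing bh (Re_val a)) extE conjM -(inner_conj bk bf).
rewrite conj_inv conj_re; move: (inner l f k) (h a) => x y.
by rewrite [RHS]mulrAC mulrA mulVf// mul1r.
Qed.

End fe.
End composition.
End SelfadjointWeightedComposition.

(** * The cases for f and g *)

Section SelfadjointCases.
Context {R : realType} (l : nat) (b : R[i]) (c : R).
Local Notation C := R[i].
Local Notation T2 := (measurableTypeR R * measurableTypeR R)%type.
Local Notation H := (@half_plane R).
Local Notation s := (scale l b).
Local Notation m := (l + 2)%N.
Local Notation sigma := (sigma l b c).
Variables (f : Cplus R -> C) (g : Cplus R -> Cplus R).
Hypotheses (b0 : b != 0) (hf : analytic f) (hg : analytic_self g).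
Implicit Types (w : Cplus R).

Let s0 : 0 < s := scale_gt0 l b0.
Let sC : s%:C != 0 :> C := realC_neq0 (lt0r_neq0 s0).

Let gextE z (z0 : 0 < complex.Re z) : gext g z = val (g (exist _ z z0)).
Proof. by rewrite /gext ext_in. Qed.

Let sigmaK (z t : C) : sigma z = t -> z = (t - 'i * c%:C) / s%:C.
Proof. by move=> <-; rewrite /sigma; field. Qed.

Section mobius.
Variables delta kappa r : C.
Local Notation A := (1 - delta * kappa).
Hypothesis k0 : 0 <= complex.Re kappa.
Hypothesis schwarz_pick : forall u : C, 0 < complex.Re u ->
  modulus A * complex.Re u <= modulus (u + kappa) ^+ 2 * complex.Re (A / (u + kappa) + delta).
Hypothesis gE : forall w, sigma (val (g w)) = A / (sigma (val w) + kappa) + delta.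
Hypothesis fE : forall w, f w = r / (sigma (val w) + kappa) ^+ m.

Let den_neq0 (z : C) : 0 < complex.Re z -> sigma z + kappa != 0.
Proof. by move=> z0; apply: cRe_eq0; rewrite cReD ltr_wpDr// Re_sigma_gt0. Qed.

(** Over the denominator y + kappa, the numerator of 1 + x G(y) is x + y + kappa + delta x y,
    symmetric in x and y. *)
Lemma mobius_functional_equation : functional_equation l b c f g.
Proof.
move=> u z; rewrite !fE !gE.
have := den_neq0 (Re_val u); have := den_neq0 (Re_val z).
move: (sigma (val u)) (sigma (val z)) => t q q0 t0.
have e x y : y + kappa != 0 ->
    1 + x * (A / (y + kappa) + delta) = (y + kappa + x + delta * x * y) / (y + kappa).
  by move=> y0; field.
rewrite (e t q q0) (e q t t0) !expr_div_n.
have -> : t + kappa + q + delta * q * t = q + kappa + t + delta * t * q by ring.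
have t1 := expf_neq0 m t0; have q1 := expf_neq0 m q0.
move: ((t + kappa) ^+ m) ((q + kappa) ^+ m) (_ ^+ m) t1 q1 => x y n x0 y0.
by field; rewrite x0 y0.
Qed.

Let kappa' : C := (kappa + 'i * c%:C) / s%:C.

Let sigma_kappa (z : C) : sigma z + kappa = s%:C * (z + kappa').
Proof. by rewrite /sigma /kappa'; field. Qed.

(** A constant g gives no substitution, but here kappa = 1 / delta has positive real part, so f is a
    multiple of a kernel and lies in the space. *)
Let mobius_constant : A = 0 -> conj_symmetric l b c f g.
Proof.
move=> A0; have fe := mobius_functional_equation.
have one0 : 0 < complex.Re (1 : C) by exact: ltr01.
pose w1 : Cplus R := exist (fun z : C => 0 < complex.Re z) 1 one0.
have gd w : sigma (val (g w)) = delta by rewrite gE A0 mul0r add0r.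
apply: (conj_symmetric_of_constant b0 fe (a := g w1)) => [w|].
  by apply: val_inj; rewrite (sigmaK (gd w)) (sigmaK (gd w1)).
have d0 : 0 < complex.Re delta by rewrite -(gd w1) Re_sigma_gt0// Re_val.
have kE : kappa = delta^-1.
  apply: (mulfI (cRe_eq0 d0)); rewrite mulfV ?(cRe_eq0 d0)//.
  by apply/eqP; rewrite eq_sym -subr_eq0 A0.
have kp : 0 < complex.Re kappa'^*%C.
  rewrite cReJ -(pmulr_rgt0 _ s0) -cRe_scale /kappa' mulrC divfK// cReD kE.
  have -> : complex.Re ('i * c%:C) = 0 :> R by rewrite /= mul0r mulr0 subrr.
  by rewrite addr0 Re_inv_gt0.
have -> : f = fun w => (r / s%:C ^+ m) * kernel l kappa'^*%C w.
  apply/funext => w; rewrite fE sigma_kappa exprMn /kernel conjcK.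
  by rewrite invfM mulrA.
by apply: bergman_mull; exact: bergman_kernel.
Qed.

Lemma conj_symmetric_of_mobius : conj_symmetric l b c f g.
Proof.
have [A0|An] := eqVneq A 0; first exact: mobius_constant.
have fe := mobius_functional_equation.
(* The coefficients of g itself, while A, delta and kappa are those of g conjugated by sigma. *)
pose A' : C := A / s%:C ^+ 2; pose delta' : C := (delta - 'i * c%:C) / s%:C.
have An' : A' != 0 by rewrite mulf_neq0 ?invr_eq0 ?expf_neq0.
have k0' : 0 <= complex.Re kappa'.
  rewrite -(pmulr_rge0 _ s0) -cRe_scale /kappa' mulrC divfK// cReD.
  by rewrite /= mul0r mulr0 subrr addr0.
have ge (z : C) : 0 < complex.Re z -> gext g z = delta' + A' / (z + kappa').
  move=> z0; rewrite (gextE z0) (sigmaK (gE _)) [val _]/= sigma_kappa.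
  have : z + kappa' != 0 by apply: cRe_eq0; rewrite cReD ltr_wpDr.
  move: (z + kappa') => t t0; rewrite /delta' /A'; move: (A) => a.
  by field; rewrite t0 sC.
(* Schwarz-Pick bounds x^l by (|t|^2 Re g / |A'|)^l for t = z + kappa'. With |f| = |r| / (s |t|)^m
   and Jacobian |A'|^2 / |t|^4, all powers of |t| cancel and M remains. *)
pose M := modulus r ^+ 2 / ((s ^+ 2) ^+ m * modulus A' ^+ m).
have M0 : 0 <= M by rewrite divr_ge0 ?mulr_ge0 ?exprn_ge0 ?modulus_ge0// ltW.
apply: (conj_symmetric_of_dominated b0 hf hg fe M0).
apply: (dominated_of_cov hf hg (cov_mobius delta' An' k0') M0) => [p pH|p pH].
  by rewrite (ge (cplx p) pH).
have p0 : 0 < p.1 by [].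
rewrite p0 (ext_in f (z := cplx p) pH) fE [val _]/= sigma_kappa.
set t := cplx p + kappa'.
have t0 : t != 0 by apply: cRe_eq0; rewrite cReD ltr_wpDr.
have n0 : 0 < modulus t ^+ 2 by rewrite exprn_gt0// modulus_gt0.
have a0 : 0 < modulus A' by rewrite modulus_gt0.
have sp : modulus A' * p.1 <= modulus t ^+ 2 * complex.Re (gext g (cplx p)).
  have := schwarz_pick (@Re_sigma_gt0 R l b c b0 (cplx p) pH).
  have -> : A / (sigma (cplx p) + kappa) + delta = sigma (gext g (cplx p)).
    by rewrite (gextE (pH : 0 < complex.Re (cplx p))) gE.
  rewrite sigma_kappa -/t !(Re_sigma l b c) modulusM modulus_real (ger0_norm (ltW s0)).
  have -> : modulus A = s ^+ 2 * modulus A'.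
    rewrite /A' modulusM modulusV modulusX modulus_real (ger0_norm (ltW s0)).
    by rewrite mulrCA mulfV ?mulr1// expf_neq0// gt_eqF.
  have -> : complex.Re (cplx p) = p.1 by [].
  rewrite exprMn => h; rewrite -(ler_pM2l (exprn_gt0 3 s0)); move: h.
  by congr (_ <= _); ring.
have g0 := Re_gext g (pH : 0 < complex.Re (cplx p)).
have sp' : p.1 ^+ l <= (modulus t ^+ 2) ^+ l * complex.Re (gext g (cplx p)) ^+ l / modulus A' ^+ l.
  rewrite ler_pdivlMr ?exprn_gt0// -!exprMn [p.1 * _]mulrC lerXn2r// nnegrE.
    by rewrite mulr_ge0// ltW.
  by rewrite mulr_ge0// ltW.
rewrite modulusM modulusV modulusX modulusM modulus_real (ger0_norm (ltW s0)).
have q0 : 0 <= (modulus r / (s * modulus t) ^+ m) ^+ 2 by exact: sqr_ge0.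
apply: (le_trans (ler_wpM2r q0 sp')); rewrite le_eqVlt; apply/orP; left; apply/eqP.
rewrite /M (_ : modulus t ^+ 4 = (modulus t ^+ 2) ^+ 2); last by rewrite -exprM.
have -> : (modulus r / (s * modulus t) ^+ m) ^+ 2 =
    modulus r ^+ 2 / ((s ^+ 2) ^+ m * ((modulus t ^+ 2) ^+ l * (modulus t ^+ 2) ^+ 2)).
  have E (x y : R) : ((x * y) ^+ m) ^+ 2 = (x ^+ 2) ^+ m * (y ^+ 2) ^+ m.
    by rewrite [(x * y) ^+ m]exprMn [(_ * _) ^+ 2]exprMn !(exprAC _ m).
  by rewrite expr_div_n E [(modulus t ^+ 2) ^+ m]exprD.
rewrite [modulus A' ^+ m]exprD.
have s2 : (s ^+ 2) ^+ m != 0 by rewrite !expf_neq0// gt_eqF.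
have al : modulus A' ^+ l != 0 by rewrite expf_neq0// gt_eqF.
have nl : (modulus t ^+ 2) ^+ l != 0 by rewrite expf_neq0// gt_eqF.
have n1 : modulus t ^+ 2 != 0 by rewrite gt_eqF.
move: ((s ^+ 2) ^+ m) (modulus A' ^+ l) ((modulus t ^+ 2) ^+ l) (modulus t ^+ 2) s2 al nl n1.
move=> X Y Z T X0 Y0 Z0 T0.
by field; rewrite X0 Y0 Z0 T0 (gt_eqF a0).
Qed.
End mobius.

(* Case (a) is case (c) with delta kappa = 1, that is kappa = 1 / alpha. *)
Lemma case_a_conj_symmetric : case_a l b c f g -> conj_symmetric l b c f g.
Proof.
move=> [alpha [beta [a0 E]]]; have an := cRe_eq0 a0.
have A0 : 1 - alpha * alpha^-1 = 0 by rewrite mulfV// subrr.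
apply: (@conj_symmetric_of_mobius alpha alpha^-1 (beta / alpha ^+ m)).
- by rewrite ltW// Re_inv_gt0.
- move=> u u0; rewrite A0 modulus0 !mul0r add0r mulr_ge0 ?sqr_ge0// ltW//.
- by move=> w; rewrite (E w).1 A0 mul0r add0r /sigma; field.
move=> w; rewrite (E w).2 -/(sigma (val w)).
have -> : 1 + alpha * sigma (val w) = alpha * (sigma (val w) + alpha^-1) by field.
by rewrite exprMn invfM mulrA.
Qed.

Lemma case_c_conj_symmetric : case_c l b c f g -> conj_symmetric l b c f g.
Proof.
move=> [delta [kappa [r [cc E]]]]; have [k0 sp] := case_c_schwarz_pick cc.
apply: (@conj_symmetric_of_mobius delta kappa r) => // w; last by rewrite (E w).2.
by rewrite (E w).1 /sigma mulVKf// subrK.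
Qed.

Lemma case_b_conj_symmetric : case_b l b c f g -> conj_symmetric l b c f g.
Proof.
move=> [lambda [theta [l0 E]]].
have gE w : sigma (val (g w)) = lambda%:C * sigma (val w).
  by rewrite (E w).1 /sigma; field.
have fe : functional_equation l b c f g.
  by move=> u z; rewrite !(E _).2 !gE; congr (_ * (1 + _) ^+ _); ring.
(* Since Re g = lambda x and the Jacobian is lambda^2, the pointwise bound is an equality for this
   M. *)
pose M := modulus theta ^+ 2 / lambda ^+ m.
have M0 : 0 <= M by rewrite divr_ge0 ?sqr_ge0// exprn_ge0// ltW.
apply: (conj_symmetric_of_dominated b0 hf hg fe M0).
pose e : R := (lambda * c - c) / s.
have ge (z : C) : 0 < complex.Re z -> gext g z = lambda%:C * z + 'i * e%:C.
  move=> z0; rewrite (gextE z0) (E _).1 [val _]/= /e (fmorph_div (real_complex R)).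
  by rewrite rmorphB rmorphM; field.
apply: (dominated_of_cov hf hg (cov_scaling e l0) M0) => [p pH|p pH].
  by rewrite (ge (cplx p) pH).
have p0 : 0 < p.1 by [].
rewrite p0 (ge (cplx p) pH) Re_scaling (ext_in f (z := cplx p) pH) (E _).2.
rewrite le_eqVlt; apply/orP; left; apply/eqP; rewrite /M exprMn exprD.
have ll : lambda ^+ l != 0 by rewrite expf_neq0// gt_eqF.
rewrite [complex.Re _]/(p.1); move: (lambda ^+ l) (p.1 ^+ l) ll => L P L0.
by field; rewrite L0 gt_eqF.
Qed.

(** The functional equation and the domination, with M = 0, hold trivially for any g. *)
Lemma zero_conj_symmetric : (forall w, f w = 0) -> conj_symmetric l b c f g.
Proof.
move=> f0; have fe : functional_equation l b c f g by move=> u z; rewrite !f0 !mul0r.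
apply: (conj_symmetric_of_dominated b0 hf hg fe (lexx 0)) => G mG G0.
rewrite mul0e integral0_eq// => p pH.
by rewrite (ext_in f (z := cplx p) pH) f0 modulus0 expr0n mulr0 mul0e.
Qed.

Lemma conj_symmetric_of_cases :
  ((exists w, f w != 0) -> [\/ case_a l b c f g, case_b l b c f g | case_c l b c f g]) ->
  conj_symmetric l b c f g.
Proof.
move=> cases; have [/cases[]|nf] := pselect (exists w, f w != 0).
- exact: case_a_conj_symmetric.
- exact: case_b_conj_symmetric.
- exact: case_c_conj_symmetric.
by apply: zero_conj_symmetric => w; apply/eqP/negPn/negP => fw; apply: nf; exists w.
Qed.

(** Constant g, hence case (a), appears here as case (c) with delta kappa = 1. *)
Lemma cases_of_functional_equation : functional_equation l b c f g ->
  (exists w, f w != 0) -> case_b l b c f g \/ case_c l b c f g.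
Proof.
move=> fe [w0 fw0].
have f_neq0 w : f w != 0.
  have den (u z : Cplus R) : 1 + sigma (val u) * sigma (val z) != 0.
    by apply: one_plus_neq0; apply: Re_sigma_gt0 => //; exact: Re_val.
  have : f w0 * (1 + sigma (val w0) * sigma (val (g w))) ^+ m != 0.
    by rewrite mulf_neq0 ?expf_neq0.
  by rewrite -fe; apply: contraNneq => ->; rewrite mul0r.
pose tau (u : C) : C := s^-1%:C * u + 'i * (- c / s)%:C.
have tauK u : sigma (tau u) = u.
  rewrite /sigma /tau (fmorphV (real_complex R)) (fmorph_div (real_complex R)) rmorphN.
  by field.
have sigmaK' z : tau (sigma z) = z.
  rewrite /sigma /tau (fmorphV (real_complex R)) (fmorph_div (real_complex R)) rmorphN.
  by field.
have Re_tau u : 0 < complex.Re u -> 0 < complex.Re (tau u).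
  by move=> u0; rewrite Re_scaling mulr_gt0// invr_gt0.
pose F u := ext f (tau u); pose G u := sigma (gext g (tau u)).
have HG u : 0 < complex.Re u -> 0 < complex.Re (G u).
  by move=> u0; apply: Re_sigma_gt0 => //; apply: Re_gext; exact: Re_tau.
have dG u : 0 < complex.Re u -> cder G u.
  move=> u0; have dt : cder tau u by exact: cder_affine.
  have d1 := @cder_comp R (gext g) tau u dt (analytic_cder hg (Re_tau u u0)).
  have d2 : cder (fun z => s%:C * z + 'i * c%:C) (gext g (tau u)) by exact: cder_affine.
  exact: (@cder_comp R (fun z => s%:C * z + 'i * c%:C) (fun z => gext g (tau z)) u d1 d2).
have FE u z : 0 < complex.Re u -> 0 < complex.Re z ->
    F u * (1 + u * G z) ^+ m = F z * (1 + z * G u) ^+ m.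
  move=> u0 z0; rewrite /F /G (ext_in f (Re_tau u u0)) (ext_in f (Re_tau z z0)).
  rewrite (gextE (Re_tau u u0)) (gextE (Re_tau z z0)).
  have := fe (exist (fun z : C => 0 < complex.Re z) _ (Re_tau u u0))
    (exist (fun z : C => 0 < complex.Re z) _ (Re_tau z z0)).
  by rewrite -[X in sigma X * _]/(tau u) -[X in _ = _ * (1 + sigma X * _) ^+ _]/(tau z) !tauK.
have one0 : 0 < complex.Re (1 : C) by exact: ltr01.
have F1 : F 1 != 0 by rewrite /F (ext_in f (Re_tau 1 one0)).
have m0 : (0 < m)%N by rewrite addn2.
have sv w : 0 < complex.Re (sigma (val w)) by apply: Re_sigma_gt0 => //; exact: Re_val.
have Fv w : F (sigma (val w)) = f w by rewrite /F sigmaK' extE.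
have Gv w : G (sigma (val w)) = sigma (val (g w)) by rewrite /G sigmaK' /gext extE.
case: (functional_equation_solution m0 HG dG FE F1).
  move=> [lambda [theta [l0 E]]]; left; exists lambda, theta; split => // w.
  have [e1 e2] := E _ (sv w); rewrite Gv in e1; rewrite Fv in e2; split => //.
  by rewrite (sigmaK e1) /sigma; field.
move=> [delta [kappa [rho' [cc E]]]]; right; exists delta, kappa, rho'; split => // w.
have [e1 e2] := E _ (sv w); rewrite Gv in e1; rewrite Fv in e2; split => //.
by rewrite (sigmaK e1) mulrC /sigma -addrA; congr (_ * _); rewrite -?addrA.
Qed.

End SelfadjointCases.

(** * From symmetry to equality of domains *)

Section MaximalDomain.
Context {R : realType} (l : nat) (b : R[i]) (c : R).
Local Notation C := R[i].
Local Notation K := (conjugation l b c).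
Variables (f : Cplus R -> C) (g : Cplus R -> Cplus R) (W : operator R).
Hypotheses (b0 : b != 0) (hW : linear_operator l W) (hWmax : op_le W (Wmax l f g)).
Hypothesis fg_sym : conj_symmetric l b c f g.
Local Notation Wfg := (wcomp f g).

Let domW : dom W `<=` bergman l. Proof. by case: hW. Qed.
Let WE h : dom W h -> W h = Wfg h. Proof. by case: hWmax => _; apply. Qed.

(** Symmetry against all of the space provides this adjoint value for every h, however small the
    domain of W. *)
Let adjoint_value_conj h : bergman l h -> adjoint_value l W (K h) (K (Wfg h)).
Proof.
have [bW _ sym] := fg_sym; move=> bh; split.
  by apply: (bergman_conjugation c b0); exact: bW.
move=> h' Wh'; rewrite (WE Wh') (sym h' (K h) (domW Wh') (bergman_conjugation c b0 bh)).
by rewrite (conjugationK l c b0).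
Qed.

(** The adjoint of W is defined on the whole space, as W is a restriction of a bounded operator; W =
    C W^* C then makes W everywhere defined. *)
Lemma selfadjoint_full : selfadjoint_wrt l (conj_bc l b c) W -> bergman l `<=` dom W.
Proof.
move=> /(selfadjoint_wrt_conjugation c b0 hW)[dW domE _] h bh.
by apply/domE; split; [exact: bh|exists (K (Wfg h)); exact: adjoint_value_conj].
Qed.

Lemma selfadjoint_of_full : bergman l `<=` dom W -> selfadjoint_wrt l (conj_bc l b c) W.
Proof.
move=> fullW; apply/(selfadjoint_wrt_conjugation c b0 hW); split.
- exact: densely_defined_full.
- move=> h; split=> [Wh|[bh _]]; last exact: fullW.
  by split; [exact: domW|exists (K (Wfg h)); apply: adjoint_value_conj; exact: domW].
by move=> h Wh; rewrite (WE Wh); apply: adjoint_value_conj; exact: domW.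
Qed.

Lemma op_eq_Wmax : op_eq W (Wmax l f g) <-> bergman l `<=` dom W.
Proof.
have [bW _ _] := fg_sym; split=> [[_ [sub _]] h bh|fullW].
  by apply: sub; split; [exact: bh|exact: bW].
split; first exact: hWmax.
split=> [h [bh _]|h [bh _]]; first exact: fullW.
by rewrite (WE (fullW _ bh)).
Qed.

Lemma bounded_of_full : bergman l `<=` dom W -> bounded_operator l W.
Proof.
have [_ [L L0 HL] _] := fg_sym; move=> fullW; split.
  by apply/seteqP; split.
exists L => // h bh; rewrite (WE (fullW _ bh)); exact: HL.
Qed.

End MaximalDomain.

(** Condition (2) is conditional on f being nonzero: for f = 0 the maximal operator is 0, and
    selfadjointness says nothing about g. *)
Theorem theorem6p8 (R : realType) (l : nat) (b : R[i]) (c : R)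
    (f : Cplus R -> R[i]) (g : Cplus R -> Cplus R) (W : operator R)
    (hb : b != 0) (hf : analytic f) (hg : analytic_self g)
    (hW : linear_operator l W) (hWmax : op_le W (Wmax l f g)) :
  (selfadjoint_wrt l (conj_bc l b c) W <->
     op_eq W (Wmax l f g) /\
     ((exists w : Cplus R, f w != 0) ->
        [\/ case_a l b c f g, case_b l b c f g | case_c l b c f g])) /\
  (selfadjoint_wrt l (conj_bc l b c) W -> bounded_operator l W).
Proof.
have sa_cases : selfadjoint_wrt l (conj_bc l b c) W -> (exists w : Cplus R, f w != 0) ->
    [\/ case_a l b c f g, case_b l b c f g | case_c l b c f g].
  move=> sa nf; have fe := selfadjoint_functional_equation hb hW hWmax sa.
  by case: (cases_of_functional_equation hb hg fe nf) => h; [exact: Or32|exact: Or33].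
split; last first.
  move=> sa; have fg := conj_symmetric_of_cases hb hf hg (sa_cases sa).
  exact: (bounded_of_full hW hWmax fg (selfadjoint_full hb hW hWmax fg sa)).
split=> [sa|[eqW cases]].
  have fg := conj_symmetric_of_cases hb hf hg (sa_cases sa).
  split; last exact: sa_cases.
  by apply/(op_eq_Wmax hWmax fg); exact: (selfadjoint_full hb hW hWmax fg sa).
have fg := conj_symmetric_of_cases hb hf hg cases.
by apply: (selfadjoint_of_full hb hW hWmax fg); apply/(op_eq_Wmax hWmax fg).
Qed.
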